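(* The number of (unlabeled) combinatorial types of $d$-polytopes with $d+4$ vertices that have a realization $P$ with $\mathrm{xc}(P)=d+3$ is $\Theta(d^2)$ (as $d\to\infty$).
   Context: The extension complexity $\mathrm{xc}(P)$ of a polytope $P$ is the minimal number of facets of a polytope $Q$ (of any dimension) that can be mapped onto $P$ by an affine (linear) projection. Two polytopes have the same combinatorial type if their face lattices are isomorphic; a realization of a combinatorial type is any polytope of that type. A $d$-polytope is a polytope of dimension $d$. *)

(* Defs.v *)
From mathcomp Require Import all_boot all_order all_algebra.
From mathcomp Require Import all_classical all_reals all_analysis.

Set Implicit Arguments.
Unset Strict Implicit.
Unset Printing Implicit Defensive.

Import Order.TTheory GRing.Theory Num.Theory.
Import numFieldNormedType.Exports.

Local Open Scope classical_set_scope.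
Local Open Scope card_scope.
Local Open Scope ring_scope.

Definition affine_hull (R : realType) (n : nat) (A : set 'rV[R]_n) :
    set 'rV[R]_n :=
  [set x | exists (k : nat) (p : 'I_k -> 'rV[R]_n) (w : 'I_k -> R),
    [/\ forall i, A (p i), \sum_i w i = 1 & x = \sum_i w i *: p i]].

Definition convex_hull (R : realType) (n : nat) (A : set 'rV[R]_n) :
    set 'rV[R]_n :=
  [set x | exists (k : nat) (p : 'I_k -> 'rV[R]_n) (w : 'I_k -> R),
    [/\ forall i, A (p i), forall i, 0 <= w i, \sum_i w i = 1
      & x = \sum_i w i *: p i]].

Definition affinely_independent (R : realType) (n k : nat)
    (p : 'I_k -> 'rV[R]_n) : Prop :=
  forall w : 'I_k -> R,
    \sum_i w i = 0 -> \sum_i w i *: p i = 0 -> forall i, w i = 0.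

(* The affine hull of A is spanned by k affinely independent points, that is,
   dim A = k - 1; the shift accounts for the convention dim set0 = -1. *)
Definition affine_rank (R : realType) (n : nat) (A : set 'rV[R]_n) (k : nat) :
    Prop :=
  exists p : 'I_k -> 'rV[R]_n,
    affinely_independent p /\ affine_hull A = affine_hull (range p).

Definition has_dim (R : realType) (n : nat) (A : set 'rV[R]_n) (d : nat) :
    Prop :=
  affine_rank A d.+1.

(* Polytopes of all ambient dimensions form a single type, so that the classes
   of combinatorially equivalent polytopes are sets in that type. *)
Record polytope (R : realType) := Polytope {
  ambient : nat;
  body : set 'rV[R]_ambient;
  body_polytope : exists2 V : set 'rV[R]_ambient,
    finite_set V & body = convex_hull V }.
Arguments body {R} _.

(* Both set0 and P itself are faces: take l = 0 with b = 1, resp. b = 0. *)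
Definition faces (R : realType) (P : polytope R) :
    set (set 'rV[R]_(ambient P)) :=
  [set F | exists (l : {scalar 'rV[R]_(ambient P)}) (b : R),
    (forall x, body P x -> l x <= b) /\ F = body P `&` [set x | l x = b]].
Arguments faces {R} P.

Definition vertices (R : realType) (P : polytope R) :
    set 'rV[R]_(ambient P) :=
  [set v | faces P [set v]].
Arguments vertices {R} P.

(* The faces of dimension dim P - 1. *)
Definition facets (R : realType) (P : polytope R) :
    set (set 'rV[R]_(ambient P)) :=
  [set F | faces P F /\ exists k, affine_rank (body P) k.+1 /\ affine_rank F k].
Arguments facets {R} P.

Definition projects_onto (R : realType) (Q P : polytope R) : Prop :=
  exists (f : {linear 'rV[R]_(ambient Q) -> 'rV[R]_(ambient P)})
         (b : 'rV[R]_(ambient P)),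
    (fun x => f x + b) @` body Q = body P.

Definition extension_sizes (R : realType) (P : polytope R) : set nat :=
  [set k | exists2 Q : polytope R, projects_onto Q P & facets Q #= `I_k].
Arguments extension_sizes {R} P.

(* xc(P) = k *)
Definition has_xc (R : realType) (P : polytope R) (k : nat) : Prop :=
  extension_sizes P k /\ forall j, extension_sizes P j -> (k <= j)%N.

(* An order isomorphism between the face lattices. *)
Definition same_combinatorial_type (R : realType) (P Q : polytope R) : Prop :=
  exists phi : set 'rV[R]_(ambient P) -> set 'rV[R]_(ambient Q),
    set_bij (faces P) (faces Q) phi /\
    forall F G, faces P F -> faces P G -> (F `<=` G <-> phi F `<=` phi G).

Definition combinatorial_type (R : realType) (P : polytope R) :
    set (polytope R) :=
  [set Q | same_combinatorial_type P Q].
Arguments combinatorial_type {R} P.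

(* The types of d-polytopes with v vertices that have a realization of
   extension complexity k. *)
Definition types_with_xc (R : realType) (d v k : nat) :
    set (set (polytope R)) :=
  [set C | (exists P : polytope R,
              [/\ has_dim (body P) d, vertices P #= `I_v
                & C = combinatorial_type P])
           /\ exists2 P : polytope R, C P & has_xc P k].
Arguments types_with_xc R d v k : clear implicits.

(* Main.v *)
(* A polytope [Q] with [f] facets is, in slack coordinates, the intersection of
   the orthant [R^f_{>=0}] with a linear subspace [K] (taken up to scaling), so a
   polytope [P] that is a projection of [Q] is encoded by [K] and by the kernel
   [U] of the projection, and [dim U + codim K = f - dim P - 1].  By Farkas'
   lemma the face lattice of [P] depends only on the supports of the
   nonnegative vectors of [K] and of the orthogonal of [U].

   Take [f = d + 3] and [d + 4] vertices, so that [dim U + codim K = 2].  If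
   [K] is everything, [P] is the projection of a simplex and has at most
   [d + 3] vertices.  In the two other cases counting vertices shows that all
   but a bounded number of the unit vectors lie in [K] (pyramid apices); for
   those only the sign of the corresponding coordinate of a generator of [U]
   matters ([dim U <= 1]), which leaves [O(d^2)] face lattices.

   Conversely, for [codim K = dim U = 1], let [K] be the orthogonal of a vector
   with 2 positive and 3 negative entries (an iterated pyramid over the
   triangular prism) and let [U] be spanned by a vector with [k] positive and
   [l] negative entries, all at apices.  For [k, l >= 3] the projection has
   [d + 4] vertices and [xc = d + 3]; the number of facets avoiding a vertex
   takes the values [k] and [l], and otherwise only 1 and 2, so that distinct
   [{k, l}] give distinct types. *)
From HB Require Import structures.
Require Import Defs.
From mathcomp Require Import all_boot all_order all_algebra.
From mathcomp Require Import all_classical all_reals all_analysis.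
From mathcomp Require Import zify ring lra.

Set Implicit Arguments.
Unset Strict Implicit.
Unset Printing Implicit Defensive.

Import Order.TTheory GRing.Theory Num.Theory.
Import numFieldNormedType.Exports.

Local Open Scope ring_scope.

(** * Convex cones *)

Section ConvexCones.
Variable R : realFieldType.

(** A type fixes the dimension and the vertex number through one realization and the extension
    complexity through another, so both must first be read off the face lattice: vertices are its
    atoms, and the dimension comes from its longest chains. A type does not determine [K], [U] or
    the order of the coordinates; the upper bound therefore counts codes of support families up to
    permutation, equal codes forcing isomorphic lattices. Only two entries of a code grow with [d],
    the numbers of positive and of negative apices. Minimality of [d + 3] serves one purpose: when
    [dim U = codim K = 1], each sign must occur at least twice in the generator of [U], so that the
    projection loses at most two vertices of the lift. In codimension 2 there is no sign rule for
    the supports of [K], and a degree count on minimal supports replaces it. For [xc >= d + 3] in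
    the lower bound, a smaller extension would be a simplex or have [U = 0] and codimension 1; the
    first has too few vertices, and in the second no vertex avoids more than two facets. *)

Definition nonneg p q (A : 'M[R]_(p, q)) : Prop := forall i j, 0 <= A i j.

Lemma addmx_entry p q (A B : 'M[R]_(p, q)) i j : (A + B) i j = A i j + B i j.
Proof. by rewrite mxE. Qed.

Lemma oppmx_entry p q (A : 'M[R]_(p, q)) i j : (- A) i j = - A i j.
Proof. by rewrite mxE. Qed.

Lemma scalemx_entry p q a (A : 'M[R]_(p, q)) i j : (a *: A) i j = a * A i j.
Proof. by rewrite mxE. Qed.

Lemma nonneg_mul p q r (A : 'M[R]_(p, q)) (B : 'M[R]_(q, r)) :
  nonneg A -> nonneg B -> nonneg (A *m B).
Proof. by move=> hA hB i j; rewrite mxE sumr_ge0 // => k _; rewrite mulr_ge0. Qed.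

Lemma nonneg_add p q (A B : 'M[R]_(p, q)) :
  nonneg A -> nonneg B -> nonneg (A + B).
Proof. by move=> hA hB i j; rewrite mxE addr_ge0. Qed.

Lemma nonneg_scale p q a (A : 'M[R]_(p, q)) :
  0 <= a -> nonneg A -> nonneg (a *: A).
Proof. by move=> a0 hA i j; rewrite mxE mulr_ge0. Qed.

Lemma nonneg_sum p q (I : Type) (r : seq I) (P : pred I) (F : I -> 'M[R]_(p, q)) :
  (forall i, P i -> nonneg (F i)) -> nonneg (\sum_(i <- r | P i) F i).
Proof.
move=> h; elim/big_ind: _ => //; last exact: nonneg_add.
by move=> i j; rewrite mxE.
Qed.

Lemma nonneg_tr p q (A : 'M[R]_(p, q)) : nonneg A -> nonneg A^T.
Proof. by move=> h i j; rewrite mxE. Qed.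

Lemma nonneg_row_mx p q r (A : 'M[R]_(p, q)) (B : 'M[R]_(p, r)) :
  nonneg A -> nonneg B -> nonneg (row_mx A B).
Proof. by move=> hA hB i j; rewrite mxE; case: fintype.split. Qed.

Lemma nonneg_col_mx p q r (A : 'M[R]_(p, q)) (B : 'M[R]_(r, q)) :
  nonneg A -> nonneg B -> nonneg (col_mx A B).
Proof. by move=> hA hB i j; rewrite mxE; case: fintype.split. Qed.

(* Induction on the number of constraints: when the last constraint [a0] is
   needed, a point [z1] violating the conclusion and normalised by
   [z1 a0 = -1] allows projecting everything onto the hyperplane [z a0 = 0]. *)
Lemma farkas n N (A : 'M[R]_(n, N)) (b : 'cV[R]_n) :
  (forall z : 'rV_n, nonneg (z *m A) -> 0 <= (z *m b) 0 0) ->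
  exists2 c : 'cV_N, nonneg c & b = A *m c.
Proof.
elim: N A b => [|N IH] A b H.
  exists 0; first by move=> i j; rewrite mxE.
  have hb : (b^T *m b) 0 0 <= 0.
    rewrite -oppr_ge0 -oppmx_entry -mulNmx; apply: H.
    by move=> i [].
  rewrite mulmx0; apply/colP => i; rewrite mxE.
  have hs : \sum_j b j 0 ^+ 2 <= 0.
    by move: hb; rewrite mxE; under eq_bigr do rewrite mxE -expr2.
  have h0 : \sum_j b j 0 ^+ 2 = 0.
    by apply/le_anti; rewrite hs sumr_ge0 // => j _; rewrite sqr_ge0.
  move/eqP: h0; rewrite psumr_eq0; last by move=> j _; rewrite sqr_ge0.
  by move=> /allP /(_ i (mem_index_enum _)); rewrite sqrf_eq0 => /eqP.
move: A H; rewrite -[N.+1]/(1 + N)%N => A.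
rewrite -[A]hsubmxK; move: (lsubmx A) (rsubmx A) => a0 A1 {A} H.
case: (pselect (forall z : 'rV_n, nonneg (z *m A1) -> 0 <= (z *m b) 0 0)).
  move=> /IH [c hc ->]; exists (col_mx 0 c).
    by apply: nonneg_col_mx => // i j; rewrite mxE.
  by rewrite mul_row_col mulmx0 add0r.
move=> /existsNP[z0 /not_implyP[hz0 /negP]]; rewrite -ltNge => hb.
set al := (z0 *m a0) 0 0.
have hal : al < 0.
  rewrite ltNge; apply/negP => h; have := H z0; rewrite leNgt hb => /(_ _)/negP.
  apply=> //; rewrite mul_mx_row; apply: nonneg_row_mx => //.
  by move=> i j; rewrite !ord1.
pose z1 := (- al)^-1 *: z0.
have al0 : 0 < (- al)^-1 by rewrite invr_gt0 oppr_gt0.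
have z1A : nonneg (z1 *m A1).
  by rewrite -scalemxAl; apply: nonneg_scale; [exact: ltW|].
have z1a : z1 *m a0 = (-1)%:M.
  rewrite -scalemxAl [z0 *m a0]mx11_scalar -/al scale_scalar_mx.
  by rewrite invrN mulNr mulVf // lt_eqF.
have z1b : (z1 *m b) 0 0 < 0.
  by rewrite -scalemxAl mxE pmulr_rlt0.
have [z hz|c hc hbc] := IH (A1 + a0 *m (z1 *m A1)) (b + a0 *m (z1 *m b)).
  have e : forall q (X : 'M[R]_(n, q)),
    z *m (X + a0 *m (z1 *m X)) = (z + (z *m a0) *m z1) *m X.
    by move=> q X; rewrite mulmxDr mulmxDl !mulmxA.
  rewrite e; apply: H; rewrite mul_mx_row; apply: nonneg_row_mx.
    by rewrite mulmxDl -mulmxA z1a mul_mx_scalar scaleN1r subrr => i j; rewrite mxE.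
  by rewrite -e.
exists (col_mx (z1 *m A1 *m c - z1 *m b) c).
  apply: nonneg_col_mx => // i j; rewrite !ord1 addmx_entry oppmx_entry.
  by apply: addr_ge0; [exact: (nonneg_mul z1A hc)|rewrite oppr_ge0 ltW].
rewrite mul_row_col mulmxBr.
apply: (addIr (a0 *m (z1 *m b))); rewrite hbc mulmxDl -!mulmxA.
by rewrite [RHS]addrAC addrNK addrC.
Qed.

Lemma cone_separation n N (V : 'M[R]_(N, n)) (x : 'rV_n) :
  (exists2 w : 'rV_N, nonneg w & x = w *m V) \/
  (exists2 c : 'cV_n, nonneg (V *m c) & (x *m c) 0 0 < 0).
Proof.
case: (pselect (exists2 c : 'cV_n, nonneg (V *m c) & (x *m c) 0 0 < 0)).
  by right.
move=> h; left; case: (@farkas _ _ V^T x^T) => [z hz|c hc hx].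
  rewrite leNgt; apply/negP => hz'; apply: h; exists z^T.
    by rewrite -[V]trmxK -trmx_mul; apply: nonneg_tr.
  by move: hz'; rewrite -[z in z *m _]trmxK -trmx_mul mxE.
exists c^T; first exact: nonneg_tr.
by rewrite -[x]trmxK hx trmx_mul trmxK.
Qed.

(** The ratio test of the simplex method: [la] is the smallest quotient [a i / - b i] over the
    negative [b i], so the motion stops at the first sum to reach zero. *)
Lemma ratio_test (I : finType) (a b : I -> R) :
  (forall i, 0 <= a i) -> (exists i, b i < 0) ->
  exists2 la, 0 <= la & (forall i, 0 <= a i + la * b i) /\
    exists2 i, b i < 0 & a i + la * b i = 0.
Proof.
move=> ha [i0 hi0].
case: (@Order.TotalTheory.arg_minP _ _ _ i0 (fun i => b i < 0)
  (fun i => a i / - b i) hi0) => i hi hmin.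
have hb j : b j < 0 -> 0 < - b j by rewrite oppr_gt0.
exists (a i / - b i); first by rewrite divr_ge0 // ltW // hb.
split; last by exists i => //; rewrite invrN mulrN mulNr divfK ?subrr // lt_eqF.
move=> j; case: (ltP (b j) 0) => hj.
  have := hmin j hj; rewrite ler_pdivlMr ?hb // mulrN.
  by rewrite -subr_ge0 opprK.
by rewrite addr_ge0 // mulr_ge0 // divr_ge0 // ltW // hb.
Qed.

(** Generators off the hyperplane of [c] become zero rows instead of being dropped: the row space is
    the span of the tight ones, and the shape does not depend on [c]. *)
Definition tight N n (V : 'M[R]_(N, n)) (c : 'cV[R]_n) : 'M[R]_(N, n) :=
  \matrix_(i, j) (if (V *m c) i 0 == 0 then V i j else 0).

Lemma row_tight N n (V : 'M[R]_(N, n)) c i :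
  row i (tight V c) = if (V *m c) i 0 == 0 then row i V else 0.
Proof. by apply/rowP => j; rewrite !mxE; case: eqP => _; rewrite ?mxE. Qed.

Lemma tight_sub N n (V : 'M[R]_(N, n)) c : (tight V c <= V)%MS.
Proof.
apply/row_subP => i; rewrite row_tight; case: eqP => _; last exact: sub0mx.
exact: row_sub.
Qed.

Lemma tight_mul N n (V : 'M[R]_(N, n)) c : tight V c *m c = 0.
Proof.
apply/row_matrixP => i; rewrite row_mul row_tight row0.
case: eqP => [h|_]; last by rewrite mul0mx.
by rewrite -row_mul; apply/rowP => j; rewrite ord1 !mxE -[RHS]h mxE.
Qed.

Lemma row_mulE N n (V : 'M[R]_(N, n)) (c : 'cV_n) i :
  (row i V *m c) 0 0 = (V *m c) i 0.
Proof. by rewrite -row_mul mxE. Qed.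

Lemma mx_separation n p q (S : 'M[R]_(p, n)) (V : 'M[R]_(q, n)) :
  ~~ (V <= S)%MS -> exists2 c : 'cV[R]_n, S *m c = 0 & V *m c != 0.
Proof.
rewrite submxE => h.
have [j hj] : exists j, V *m col j (cokermx S) != 0.
  apply/existsP; apply: contraNT h => /existsPn h; apply/eqP/matrixP => i j.
  have /eqP/colP/(_ i) := negbNE (h j).
  by rewrite colE mulmxA -colE !mxE.
by exists (col j (cokermx S)) => //; rewrite colE mulmxA mulmx_coker mul0mx.
Qed.

(* Among the separating functionals take one whose tight set has maximal rank:
   if the rank were smaller than [\rank V - 1], the functional could be rotated
   around its tight set until a new generator becomes tight. *)
Lemma facet_separation n N (V : 'M[R]_(N, n)) (x : 'rV_n) :
  (x <= V)%MS -> ~ (exists2 w : 'rV_N, nonneg w & x = w *m V) ->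
  exists c : 'cV_n, [/\ nonneg (V *m c), (x *m c) 0 0 < 0
    & (\rank (tight V c)).+1 = \rank V].
Proof.
move=> hxV hx; have [//|[c0 hc0 xc0]] := cone_separation V x.
pose Q r := `[< exists c : 'cV_n, [/\ nonneg (V *m c), (x *m c) 0 0 < 0
  & \rank (tight V c) = r] >].
have exQ : exists r, Q r by exists (\rank (tight V c0)); apply/asboolP; exists c0.
have ubQ r : Q r -> (r <= \rank V)%N.
  by move=> /asboolP[c [_ _ <-]]; apply: mxrankS; exact: tight_sub.
case: (ex_maxnP exQ ubQ) => r /asboolP[c [hc xc rc]] hmax.
exists c; split=> //.
(* A tight set of full rank would have [x] in its span, forcing [x] onto the hyperplane of [c]. *)
have lt1 : (\rank (tight V c) < \rank V)%N.
  rewrite ltn_neqAle mxrankS ?tight_sub // andbT; apply/negP => /eqP h.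
  have : (V <= tight V c)%MS.
    by rewrite -(geq_leqif (mxrank_leqif_sup (tight_sub V c))) h.
  move=> /(submx_trans hxV)/submxP[D hD].
  by move: xc; rewrite hD -mulmxA tight_mul mulmx0 mxE ltxx.
apply/eqP; rewrite eqn_leq lt1 /= leqNgt; apply/negP => lt2.
(* The direction of rotation also vanishes at [x], so [x] stays strictly separated; the rank deficit
   of at least two leaves room for this extra condition. *)
have [c' + Vc'] : exists2 c' : 'cV_n, col_mx (tight V c) x *m c' = 0 & V *m c' != 0.
  apply: mx_separation; apply/negP => /mxrankS; rewrite leqNgt => /negP; apply.
  apply: leq_ltn_trans lt2; rewrite -addsmxE.
  apply: leq_trans (mxrank_adds_leqif _ _) _.
  by have := rank_leq_row x; lia.
rewrite mul_col_mx => /eqP; rewrite col_mx_eq0 => /andP[/eqP Tc' /eqP xc'].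
have [e [e' he]] : exists e : 'cV_n, [/\ tight V c *m e = 0, x *m e = 0
    & exists i, (V *m e) i 0 < 0].
  have [i hi] : exists i, (V *m c') i 0 != 0.
    apply/existsP; apply: contraNT Vc' => /existsPn h.
    by apply/eqP/colP => i; rewrite (eqP (negbNE (h i))) mxE.
  case: (ltrgtP ((V *m c') i 0) 0) hi => // hi _; first by exists c'; split=> //; exists i.
  exists (- c'); rewrite !mulmxN Tc' xc' !oppr0; split=> //; exists i.
  by rewrite oppmx_entry oppr_lt0.
move=> hneg; have [la la0 [hla [i0 hi0 ti0]]] := ratio_test (fun i => hc i 0) hneg.
pose d := c + la *: e.
have Vd i : (V *m d) i 0 = (V *m c) i 0 + la * (V *m e) i 0.
  by rewrite /d mulmxDr -scalemxAr mxE [X in _ + X]mxE.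
have hd : nonneg (V *m d) by move=> i j; rewrite ord1 Vd.
have xd : (x *m d) 0 0 < 0 by rewrite /d mulmxDr -scalemxAr he scaler0 addr0.
have : (\rank (tight V d) <= r)%N.
  by apply: hmax; apply/asboolP; exists d.
rewrite -rc leqNgt => /negP; apply.
have sub : (tight V c <= tight V d)%MS.
  apply/row_subP => i; rewrite row_tight; case: eqP => hi; last exact: sub0mx.
  have : row i (tight V d) = row i V.
    rewrite row_tight Vd hi add0r -row_mulE.
    have -> : row i V = row i (tight V c) by rewrite row_tight hi eqxx.
    by rewrite -row_mul e' row0 mxE mulr0 eqxx.
  by move=> <-; exact: row_sub.
rewrite ltn_neqAle mxrankS // andbT; apply/negP => /eqP heq.
have : (tight V d <= tight V c)%MS.
  by rewrite -(geq_leqif (mxrank_leqif_sup sub)) heq.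
move=> /(submx_trans (row_sub i0 _)); rewrite row_tight Vd ti0 eqxx => /submxP[D hD].
by move: hi0; rewrite -row_mulE hD -mulmxA e' mulmx0 mxE ltxx.
Qed.

End ConvexCones.

(** * Homogeneous coordinates *)

Section HomogeneousCoordinates.
Variable R : realType.

Definition hom n (x : 'rV[R]_n) : 'rV[R]_(n + 1) := row_mx x 1%:M.

Definition height n (z : 'rV[R]_(n + 1)) : R := z 0 (rshift n 0).

Definition hommx n k (p : 'I_k -> 'rV[R]_n) : 'M[R]_(k, n + 1) :=
  \matrix_i hom (p i).

Lemma hom_inj n : injective (@hom n).
Proof. by move=> x y /eq_row_mx[]. Qed.

Lemma height_hom n (x : 'rV_n) : height (hom x) = 1.
Proof. by rewrite /height /hom row_mxEr mxE. Qed.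

Lemma height_eq1 n (z : 'rV_(n + 1)) : height z = 1 -> z = hom (lsubmx z).
Proof.
move=> h; rewrite -[LHS]hsubmxK; congr row_mx; apply/matrixP => i j.
by rewrite !ord1 !mxE /= -[RHS]h.
Qed.

Lemma height_add n (y z : 'rV_(n + 1)) : height (y + z) = height y + height z.
Proof. exact: addmx_entry. Qed.

Lemma height_scale n a (z : 'rV_(n + 1)) : height (a *: z) = a * height z.
Proof. exact: scalemx_entry. Qed.

Lemma hom_comb n k (p : 'I_k -> 'rV_n) (w : 'rV_k) :
  w *m hommx p = row_mx (\sum_i w 0 i *: p i) (\sum_i w 0 i)%:M.
Proof.
rewrite mulmx_sum_row; under eq_bigr => i _.
  rewrite rowK /hom scale_row_mx scale_scalar_mx mulr1; over.
elim/big_rec3: _ => [|i a b _ _ ->]; first by rewrite raddf0 row_mx0.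
by rewrite add_row_mx raddfD.
Qed.

Lemma hom_comb_eq n k (p : 'I_k -> 'rV_n) (w : 'rV_k) x :
  hom x = w *m hommx p <-> x = \sum_i w 0 i *: p i /\ \sum_i w 0 i = 1.
Proof.
rewrite hom_comb; split=> [/eq_row_mx[-> /matrixP/(_ 0 0)]|[<- ->]] //.
by rewrite !mxE.
Qed.

Lemma scalar_col n (l : {scalar 'rV[R]_n}) (b : R) :
  exists g : 'cV[R]_(n + 1), forall x, (hom x *m g) 0 0 = b - l x.
Proof.
exists (col_mx (- \col_i l (delta_mx 0 i)) b%:M) => x.
rewrite mul_row_col mul1mx mulmxN addrC addmx_entry oppmx_entry mxE mulr1n.
congr (_ - _); rewrite [x in RHS]row_sum_delta linear_sum mxE.
by apply: eq_bigr => i _; rewrite linearZ mxE.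
Qed.

Lemma col_scalar n (g : 'cV[R]_(n + 1)) :
  exists (l : {scalar 'rV[R]_n}) (b : R), forall x, (hom x *m g) 0 0 = b - l x.
Proof.
pose f (x : 'rV[R]_n) : R := - (x *m usubmx g) 0 0.
have hf : linear_for *%R f.
  move=> a x y; rewrite /f mulmxDl -scalemxAl addmx_entry scalemx_entry.
  by rewrite opprD mulrN.
pose l : {scalar 'rV[R]_n} := HB.pack f (GRing.isLinear.Build _ _ _ _ f hf).
exists l, (dsubmx g 0 0) => x.
rewrite -[g in LHS]vsubmxK mul_row_col mul1mx addmx_entry addrC.
by rewrite -[l x]/(f x) /f opprK.
Qed.

Lemma facesP (P : polytope R) (F : set 'rV[R]_(ambient P)) :
  faces P F <-> exists2 g : 'cV_(ambient P + 1),
    (forall x, body P x -> 0 <= (hom x *m g) 0 0) &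
    F = [set x | body P x /\ (hom x *m g) 0 0 = 0]%classic.
Proof.
split=> [[l [b [hl ->]]]|[g hg ->]].
  have [g hg] := scalar_col l b; exists g => [x /hl|].
    by rewrite hg subr_ge0.
  apply/seteqP; split=> x /= [hx]; rewrite hg.
    by move=> ->; rewrite subrr.
  by move/eqP; rewrite subr_eq0 => /eqP ->.
have [l [b hl]] := col_scalar g; exists l, b; split=> [x /hg|].
  by rewrite hl subr_ge0.
apply/seteqP; split=> x /= [hx]; rewrite hl.
  by move/eqP; rewrite subr_eq0 => /eqP ->.
by move=> ->; rewrite subrr.
Qed.

(** The row space of [S] is the linear span of the homogenised points of [A], so [\rank S] is the
    dimension plus one. The minimality half is stated by duality, which avoids choosing a basis. *)
Definition hspan n (A : set 'rV[R]_n) q (S : 'M[R]_(q, n + 1)) : Prop :=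
  (forall a, A a -> (hom a <= S)%MS) /\
  (forall c : 'cV_(n + 1), (forall a, A a -> hom a *m c = 0) -> S *m c = 0).

Lemma hspan_sub n (A : set 'rV[R]_n) q r (S : 'M[R]_(q, n + 1)) (T : 'M[R]_(r, n + 1)) :
  hspan A S -> (forall a, A a -> (hom a <= T)%MS) -> (S <= T)%MS.
Proof.
move=> [_ hS] hT; apply/negPn/negP => /mx_separation[c Tc /eqP]; apply.
by apply: hS => a /hT /submxP[D ->]; rewrite -mulmxA Tc mulmx0.
Qed.

Lemma hspan_row n k (p : 'I_k -> 'rV[R]_n) : hspan (range p) (hommx p).
Proof.
split=> [_ [i _ <-]|c hc]; first by rewrite -(rowK (fun i => hom (p i))) row_sub.
by apply/row_matrixP => i; rewrite row_mul rowK row0 hc //; exists i.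
Qed.

Lemma hspan_exists n (A : set 'rV[R]_n) :
  exists k (p : 'I_k -> 'rV_n),
    [/\ forall i, A (p i), row_free (hommx p) & hspan A (hommx p)].
Proof.
pose Q r := `[< exists p : 'I_r -> 'rV_n, (forall i, A (p i)) /\ row_free (hommx p) >].
have ex0 : exists r, Q r.
  exists 0%N; apply/asboolP; exists (fun i => 0); split=> [[]//|].
  by rewrite /row_free eqn_leq rank_leq_row.
have ub r : Q r -> (r <= n + 1)%N.
  by move=> /asboolP[p [_ /eqP <-]]; exact: rank_leq_col.
case: (ex_maxnP ex0 ub) => r /asboolP[p [hp fp]] hmax.
exists r, p; split=> //; split=> [a ha|c hc]; last first.
  by apply/row_matrixP => i; rewrite row_mul rowK row0 hc.
apply/negPn/negP => hn; suff: (r.+1 <= r)%N by rewrite ltnn.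
apply: hmax; apply/asboolP.
pose q (i : 'I_(1 + r)) := match fintype.split i with inl _ => a | inr j => p j end.
exists q; split=> [i|]; first by rewrite /q; case: fintype.split.
have -> : hommx q = col_mx (hom a) (hommx p).
  apply/row_matrixP => i; rewrite rowK /q.
  case: (fintype.split_ordP i) => j {i}->.
    by rewrite (ord1 j) rowKu row_id.
  by rewrite rowKd rowK.
apply: (@inj_row_free _ (1 + r)%N) => v; rewrite -[v](@hsubmxK _ 1 1 r) mul_row_col => h0.
have l0 : lsubmx v = 0.
  apply/eqP; apply: contraNT hn => v0.
  have hv : lsubmx v 0 0 != 0.
    apply: contraNneq v0 => h; apply/eqP/matrixP => i j.
    by rewrite !ord1 h [RHS]mxE.
  move: h0; rewrite [lsubmx v]mx11_scalar mul_scalar_mx => /eqP.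
  rewrite addr_eq0 => /eqP h0.
  rewrite -(scale1r (hom a)) -(mulVf hv) -scalerA h0.
  by rewrite -mulNmx; apply: scalemx_sub; exact: submxMl.
move: h0; rewrite l0 mul0mx add0r -[RHS](mul0mx _ (hommx p)) => /(row_free_inj fp) ->.
by rewrite row_mx0.
Qed.

Lemma affine_hullE n (A : set 'rV[R]_n) q (S : 'M[R]_(q, n + 1)) x :
  hspan A S -> affine_hull A x <-> (hom x <= S)%MS.
Proof.
move=> hS; split=> [[k [p [w [hp hw hx]]]]|hx].
  have -> : hom x = (\row_i w i) *m hommx p.
    by apply/hom_comb_eq; rewrite hx -hw; split; apply: eq_bigr => i _; rewrite mxE.
  apply: mulmx_sub; apply/row_subP => i; rewrite rowK; exact: (hS.1).
have [k [p [hp _ hspanp]]] := hspan_exists A.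
have : (hom x <= hommx p)%MS.
  by apply: submx_trans hx _; apply: hspan_sub hS hspanp.1.
move=> /submxP[w /hom_comb_eq[hx1 hw]].
by exists k, p, (fun i => w 0 i).
Qed.

Lemma affinely_independentE n k (p : 'I_k -> 'rV[R]_n) :
  affinely_independent p <-> row_free (hommx p).
Proof.
split=> [hp|hp w hw hw0].
  apply: inj_row_free => v; rewrite hom_comb -[RHS]row_mx0 => /eq_row_mx[h1 h2].
  apply/rowP => i; rewrite [RHS]mxE; apply: (hp (fun i => v 0 i)) => //.
  by move/matrixP: h2 => /(_ 0 0); rewrite !mxE.
have h : (\row_i w i) *m hommx p = 0 *m hommx p.
  rewrite mul0mx hom_comb -[RHS]row_mx0; congr row_mx.
    by rewrite -[RHS]hw0; apply: eq_bigr => i _; rewrite mxE.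
  by under eq_bigr do rewrite mxE; rewrite hw raddf0.
by move=> i; move/(row_free_inj hp)/rowP: h => /(_ i); rewrite !mxE.
Qed.

Lemma affine_rankP n (A : set 'rV[R]_n) q (S : 'M[R]_(q, n + 1)) k :
  hspan A S -> affine_rank A k <-> \rank S = k.
Proof.
move=> hS; split=> [[p [/affinely_independentE/eqP hp hA]]|<-].
  rewrite -[RHS]hp; apply: eqmx_rank.
  apply/andP; split.
    apply: (hspan_sub hS) => a ha.
    apply/(affine_hullE _ (hspan_row p)); rewrite -hA.
    by apply/(affine_hullE _ hS); exact: hS.1.
  apply: (hspan_sub (hspan_row p)) => a ha.
  apply/(affine_hullE _ hS); rewrite hA.
  by apply/(affine_hullE _ (hspan_row p)); exact: (hspan_row p).1.
have [k' [p [hp fp sp]]] := hspan_exists A.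
have eS : (S :=: hommx p)%MS.
  apply/eqmxP/andP; split; first exact: hspan_sub hS sp.1.
  exact: hspan_sub sp hS.1.
have -> : \rank S = k' by rewrite eS; apply/eqP.
exists p; split; first exact/affinely_independentE.
apply/seteqP; split=> x.
  by move/(affine_hullE _ sp) => h; apply/(affine_hullE _ (hspan_row p)).
by move/(affine_hullE _ (hspan_row p)) => h; apply/(affine_hullE _ sp).
Qed.

Lemma convex_hullE n N (v : 'I_N -> 'rV[R]_n) x :
  convex_hull (range v) x <-> exists2 w : 'rV_N, nonneg w & hom x = w *m hommx v.
Proof.
split=> [[k [p [w [hp hw hw1 ->]]]]|[w hw /hom_comb_eq[-> w1]]]; last first.
  by exists N, v, (fun i => w 0 i); split=> // i; exists i.
have /choice[s hs] : forall i, exists j, v j = p i by move=> i; have [j _] := hp i; exists j.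
exists (\row_j \sum_(i | s i == j) w i).
  by move=> i j; rewrite mxE; apply: sumr_ge0.
apply/hom_comb_eq; split; last first.
  under eq_bigr do rewrite mxE; rewrite -hw1.
  by rewrite (partition_big s xpredT).
rewrite (partition_big s xpredT) //=; apply: eq_bigr => j _.
by rewrite mxE scaler_suml; apply: eq_bigr => i /eqP <-; rewrite hs.
Qed.

Lemma polytope_gens (P : polytope R) :
  exists N (v : 'I_N -> 'rV[R]_(ambient P)), forall x,
    body P x <-> exists2 w : 'rV_N, nonneg w & hom x = w *m hommx v.
Proof.
have [V /finite_seqP[s ->] hP] := body_polytope P.
exists (size s), (fun i => tnth (in_tuple s) i) => x; rewrite hP -convex_hullE.
suff -> : [set` s]%classic = range (tnth (in_tuple s)) by [].
apply/seteqP; split=> y /=; last by move=> [i _ <-]; exact: mem_tnth.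
by move=> /(nthP y)[i hi <-]; exists (Ordinal hi) => //; rewrite (tnth_nth y).
Qed.

Lemma polytope_of_gens n N (v : 'I_N -> 'rV[R]_n) (B : set 'rV[R]_n) :
  (forall x, B x <-> exists2 w : 'rV_N, nonneg w & hom x = w *m hommx v) ->
  exists2 V : set 'rV[R]_n, finite_set V & B = convex_hull V.
Proof.
move=> hB; exists (range v); first exact: finite_image.
by apply/seteqP; split=> x; rewrite convex_hullE hB.
Qed.

End HomogeneousCoordinates.

(** * Presentations and face lattices *)

Section OrderIsomorphisms.

Definition order_iso (S T : Type) (A : set S) (leS : S -> S -> Prop)
    (B : set T) (leT : T -> T -> Prop) : Prop :=
  exists phi : S -> T, set_bij A B phi /\
    forall x y, A x -> A y -> (leS x y <-> leT (phi x) (phi y)).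

Lemma order_iso_sym (S T : Type) (A : set S) leS (B : set T) leT :
  inhabited S -> order_iso A leS B leT -> order_iso B leT A leS.
Proof.
move=> [s0] [phi [[fphi iphi sphi] hphi]].
have /choice[g hg] : forall t, exists s, B t -> A s /\ phi s = t.
  move=> t; case: (pselect (B t)) => [/sphi[s As <-]|nB]; last by exists s0.
  by exists s.
exists g; split; last first.
  by move=> x y /hg[Ax ex] /hg[Ay ey]; rewrite hphi // ex ey.
split=> [t /hg[]//|t t' /set_mem/hg[_ e] /set_mem/hg[_ e'] h|s As].
  by rewrite -e -e' h.
exists (phi s); first exact: fphi.
have [Ag eg] := hg _ (fphi _ As).
by apply: iphi; rewrite ?inE.
Qed.

Lemma order_iso_trans (S T U : Type) (A : set S) leS (B : set T) leT (C : set U) leU :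
  order_iso A leS B leT -> order_iso B leT C leU -> order_iso A leS C leU.
Proof.
move=> [phi [[fphi iphi sphi] hphi]] [psi [[fpsi ipsi spsi] hpsi]].
exists (psi \o phi); split; last first.
  by move=> x y Ax Ay; rewrite hphi // hpsi //; exact: fphi.
split=> [s As|s t As At h|u /spsi[t /sphi[s As <-] <-]].
  by apply: fpsi; apply: fphi.
  apply: iphi => //; apply: ipsi => //; rewrite inE; apply: fphi; exact: set_mem.
by exists s.
Qed.

End OrderIsomorphisms.

(** * Closed sets of a pair of set families *)

Section FaceFamilies.
Variable I : finType.
Implicit Types (Cs Ys : {set {set I}}) (C X Y : {set I}).

(** For the supports [Ys] of a cone and the support [C] of a nonnegative functional, this is the
    support of a generic vector of the face where the functional vanishes. *)
Definition cl Ys C : {set I} := (\bigcup_(Y in Ys | [disjoint Y & C]) Y)%SET.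

Definition fam Cs Ys : {set {set I}} := [set cl Ys C | C in Cs]%SET.

Definition union_closed Ys : Prop :=
  finset.set0 \in Ys /\ {in Ys &, forall Y Y', (Y :|: Y')%SET \in Ys}.

Lemma clP Ys C i :
  reflect (exists Y, [/\ Y \in Ys, [disjoint Y & C] & i \in Y]) (i \in cl Ys C).
Proof.
apply: (iffP bigcupP) => [[Y /andP[h1 h2] h3]|[Y [h1 h2 h3]]]; exists Y => //.
by rewrite h1.
Qed.

Lemma sub_cl Ys C Y : Y \in Ys -> [disjoint Y & C] -> Y \subset cl Ys C.
Proof. by move=> hY hC; apply/fintype.subsetP => i hi; apply/clP; exists Y. Qed.

Lemma cl_disjoint Ys C : [disjoint cl Ys C & C].
Proof.
rewrite disjoint_subset; apply/fintype.subsetP => i /clP[Y [_ h hi]].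
by rewrite inE (disjointFr h hi).
Qed.

Lemma cl_mem Ys C : union_closed Ys -> cl Ys C \in Ys.
Proof.
move=> [h0 hU]; rewrite /cl; elim/big_ind: _ => //.
by move=> Y /andP[].
Qed.

Lemma clS Ys C C' : C \subset C' -> cl Ys C' \subset cl Ys C.
Proof.
move=> h; apply/fintype.subsetP => i /clP[Y [hY hd hi]]; apply/clP; exists Y; split=> //.
exact: disjointWr hd.
Qed.

End FaceFamilies.

Lemma mx_factor (F : fieldType) p q r (A : 'M[F]_(p, q)) (B : 'M[F]_(p, r)) :
  (forall z : 'rV_p, z *m A = 0 -> z *m B = 0) -> exists g, B = A *m g.
Proof.
move=> h; suff /submxP[D hD] : (B^T <= A^T)%MS.
  by exists D^T; rewrite -[B]trmxK hD trmx_mul trmxK.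
rewrite submxE; apply/eqP/trmx_inj; rewrite trmx_mul trmxK trmx0.
apply/row_matrixP => i; rewrite row0 row_mul h //.
apply: trmx_inj; rewrite trmx0 trmx_mul -tr_col trmxK colE mulmxA.
by rewrite mulmx_coker mul0mx.
Qed.

Section Presentations.
Variable R : realType.

Definition nnvec f (K : 'M[R]_f) (y : 'rV[R]_f) : Prop := (y <= K)%MS /\ nonneg y.

Definition supp f (y : 'rV[R]_f) : {set 'I_f} := [set i | y 0 i != 0]%SET.

(* [P] is the image under [Pi], in homogeneous coordinates, of the
   intersection of the subspace [K] with the nonnegative orthant. *)
Definition presents (P : polytope R) f (K : 'M[R]_f)
    (Pi : 'M[R]_(f, ambient P + 1)) : Prop :=
  (forall x, body P x <-> exists2 y, nnvec K y & y *m Pi = hom x) /\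
  (forall y, nnvec K y -> y != 0 -> 0 < height (y *m Pi)).

Arguments presents P {f} K Pi.

Definition vsupps f (K : 'M[R]_f) : {set {set 'I_f}} :=
  [set Y | `[< exists2 y, nnvec K y & supp y = Y >]]%SET.

(** [c] is orthogonal to the kernel of [Pi] on [K]: these are the nonnegative functionals that
    descend to the image and hence cut out faces of it. *)
Definition csupps f q (K : 'M[R]_f) (Pi : 'M[R]_(f, q)) : {set {set 'I_f}} :=
  [set C | `[< exists c : 'rV[R]_f, [/\ nonneg c, supp c = C &
    forall y : 'rV_f, (y <= K)%MS -> y *m Pi = 0 -> y *m c^T = 0] >]]%SET.

Lemma vsuppsP f (K : 'M[R]_f) Y :
  reflect (exists2 y, nnvec K y & supp y = Y) (Y \in vsupps K).
Proof. by rewrite inE; apply: asboolP. Qed.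

Lemma csuppsP f q (K : 'M[R]_f) (Pi : 'M[R]_(f, q)) C :
  reflect (exists c : 'rV[R]_f, [/\ nonneg c, supp c = C &
    forall y : 'rV_f, (y <= K)%MS -> y *m Pi = 0 -> y *m c^T = 0])
   (C \in csupps K Pi).
Proof. by rewrite inE; apply: asboolP. Qed.

Lemma nnvec_add f (K : 'M[R]_f) y z : nnvec K y -> nnvec K z -> nnvec K (y + z).
Proof.
by move=> [hy ny] [hz nz]; split; [exact: addmx_sub|exact: nonneg_add].
Qed.

Lemma nnvec_scale f (K : 'M[R]_f) a y : 0 <= a -> nnvec K y -> nnvec K (a *: y).
Proof.
by move=> a0 [hy ny]; split; [exact: scalemx_sub|exact: nonneg_scale].
Qed.

Lemma nnvec0 f (K : 'M[R]_f) : nnvec K 0.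
Proof. by split; [exact: sub0mx|move=> i j; rewrite mxE]. Qed.

Lemma supp0 f : supp (0 : 'rV[R]_f) = finset.set0.
Proof. by apply/setP => i; rewrite !inE mxE eqxx. Qed.

Lemma supp_eq0 f (y : 'rV[R]_f) : (supp y == finset.set0) = (y == 0).
Proof.
apply/eqP/eqP => [h|->]; last exact: supp0.
apply/rowP => i; move/setP: h => /(_ i); rewrite !inE mxE.
by move/negbFE/eqP.
Qed.

Lemma supp_scale f a (y : 'rV[R]_f) : a != 0 -> supp (a *: y) = supp y.
Proof. by move=> a0; apply/setP => i; rewrite !inE mxE mulf_eq0 negb_or a0. Qed.

Lemma supp_add f (y z : 'rV[R]_f) :
  nonneg y -> nonneg z -> supp (y + z) = (supp y :|: supp z)%SET.
Proof.
move=> hy hz; apply/setP => i; rewrite !inE mxE paddr_eq0 //.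
by rewrite negb_and.
Qed.

Lemma disjoint_dot f (y c : 'rV[R]_f) : nonneg y -> nonneg c ->
  ((y *m c^T) 0 0 == 0) = [disjoint supp y & supp c].
Proof.
move=> hy hc; rewrite mxE psumr_eq0; last first.
  by move=> i _; rewrite mxE mulr_ge0.
rewrite disjoint_subset; apply/allP/fintype.subsetP => h i.
  rewrite !inE => hi; have := h i (mem_index_enum _).
  by rewrite mxE mulf_eq0 (negbTE hi) /= => ->.
move=> _; rewrite /= mxE mulf_eq0; have := h i; rewrite !inE.
by case: (y 0 i =P 0) => //= _ /(_ isT)/negbNE.
Qed.

Lemma vsupps_union_closed f (K : 'M[R]_f) : union_closed (vsupps K).
Proof.
split; first by apply/vsuppsP; exists 0; [exact: nnvec0|exact: supp0].
move=> Y Z /vsuppsP[y hy <-] /vsuppsP[z hz <-].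
apply/vsuppsP; exists (y + z); first exact: nnvec_add.
by rewrite supp_add //; [exact: hy.2|exact: hz.2].
Qed.

Lemma csupps_union_closed f q (K : 'M[R]_f) (Pi : 'M[R]_(f, q)) :
  union_closed (csupps K Pi).
Proof.
split.
  apply/csuppsP; exists 0; split=> [i j||y _ _]; rewrite ?mxE ?supp0 //.
  by rewrite trmx0 mulmx0.
move=> Y Z /csuppsP[y [ny <- hy]] /csuppsP[z [nz <- hz]].
apply/csuppsP; exists (y + z); split; [exact: nonneg_add|exact: supp_add|].
by move=> x xK xPi; rewrite linearD /= mulmxDr hy // hz // addr0.
Qed.

(** A functional nonnegative on the cone need not have nonnegative coefficients; Farkas' lemma
    replaces it by one that has, with the same values on [K]. Its zeros on the cone are then visible
    from its support. *)
Lemma farkas_subspace f (K : 'M[R]_f) (g : 'cV[R]_f) :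
  (forall y, nnvec K y -> 0 <= (y *m g) 0 0) ->
  exists2 c : 'rV_f, nonneg c & forall y : 'rV_f, (y <= K)%MS -> y *m g = y *m c^T.
Proof.
move=> h; have [z hz|c hc e] := @farkas R f f K (K *m g).
  by rewrite mulmxA; apply: h; split=> //; exact: submxMl.
exists c^T; first exact: nonneg_tr.
by move=> y /submxP[D ->]; rewrite trmxK -!mulmxA e.
Qed.

Section Faces.
Variables (P : polytope R) (f : nat) (K : 'M[R]_f) (Pi : 'M[R]_(f, ambient P + 1)).
Hypothesis pres : presents P K Pi.

Lemma presents_scale y : nnvec K y -> y != 0 ->
  exists a x, [/\ 0 < a, nnvec K (a *: y), a *: y *m Pi = hom x & body P x].
Proof.
move=> hy y0; have hh := pres.2 y hy y0.
have ai : 0 < (height (y *m Pi))^-1 by rewrite invr_gt0.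
have hK := nnvec_scale (ltW ai) hy.
have e : (height (y *m Pi))^-1 *: y *m Pi =
    hom (lsubmx ((height (y *m Pi))^-1 *: y *m Pi)).
  by apply: height_eq1; rewrite -scalemxAl height_scale mulVf // gt_eqF.
exists (height (y *m Pi))^-1; eexists; split=> //; first exact: e.
by apply/(pres.1 _); eexists; [exact: hK|exact: e].
Qed.

Definition fface (C : {set 'I_f}) : set 'rV[R]_(ambient P) :=
  fun x => exists y, [/\ nnvec K y, y *m Pi = hom x & [disjoint supp y & C]].

Definition fsupp (F : set 'rV[R]_(ambient P)) : {set 'I_f} :=
  [set i | `[< exists y x, [/\ nnvec K y, F x, y *m Pi = hom x & i \in supp y] >]]%SET.

(** Two preimages of [x] differ by a kernel vector, at which [c] vanishes; so one nonnegative
    preimage avoiding [C] forces all of them to avoid it. *)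
Lemma ffaceP C x y : C \in csupps K Pi -> fface C x -> nnvec K y ->
  y *m Pi = hom x -> [disjoint supp y & C].
Proof.
move=> /csuppsP[c [nc <- hc]] [y' [[yK' ny'] e' dj]] [yK ny] e.
rewrite -disjoint_dot //.
have : (y - y') *m c^T = 0.
  by apply: hc; [rewrite addmx_sub ?eqmx_opp|rewrite mulmxBl e e' subrr].
rewrite mulmxBl => /eqP; rewrite subr_eq0 => /eqP ->.
by rewrite disjoint_dot.
Qed.

Lemma fface_face C : C \in csupps K Pi -> faces P (fface C).
Proof.
move=> hC; have /csuppsP[c [nc sc hc]] := hC.
have [g hg] : exists g, K *m c^T = K *m Pi *m g.
  apply: mx_factor => z; rewrite !mulmxA => hz; apply: hc => //; exact: submxMl.
have dot y : (y <= K)%MS -> y *m Pi *m g = y *m c^T.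
  by move=> /submxP[D ->]; rewrite -!mulmxA hg !mulmxA.
apply/facesP; exists g.
  move=> x /(pres.1 _)[y [yK ny] <-]; rewrite dot //.
  exact: (nonneg_mul ny (nonneg_tr nc)).
apply/seteqP; split=> x /=.
  move=> [y [[yK ny] e dj]]; split; first by apply/(pres.1 _); exists y.
  by rewrite -e dot //; apply/eqP; rewrite disjoint_dot // sc.
move=> [/(pres.1 _)[y [yK ny] e]]; rewrite -e dot // => /eqP.
by rewrite disjoint_dot // sc => dj; exists y.
Qed.

(** The functional defining the face is pulled back along [Pi] to the cone, where Farkas' lemma
    gives it nonnegative coefficients; vanishing at a nonnegative vector then means disjoint
    supports. *)
Lemma face_fface F : faces P F -> exists2 C, C \in csupps K Pi & F = fface C.
Proof.
move=> /facesP[g hg ->].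
have [y hy|c nc hc] := @farkas_subspace f K (Pi *m g).
  case: (eqVneq y 0) => [->|y0]; first by rewrite mul0mx mxE.
  have [a [x [a0 _ e bx]]] := presents_scale hy y0.
  have := hg x bx; rewrite -e -!scalemxAl scalemx_entry pmulr_rge0 //.
  by rewrite mulmxA.
exists (supp c).
  apply/csuppsP; exists c; split=> // y yK e.
  by rewrite -hc // mulmxA e mul0mx.
apply/seteqP; split=> x /=.
  move=> [/(pres.1 _)[y [yK ny] e]]; rewrite -e -mulmxA hc // => /eqP.
  by rewrite disjoint_dot // => dj; exists y.
move=> [y [[yK ny] e dj]]; split; first by apply/(pres.1 _); exists y.
by rewrite -e -mulmxA hc //; apply/eqP; rewrite disjoint_dot.
Qed.

Lemma fsupp_fface C : C \in csupps K Pi -> fsupp (fface C) = cl (vsupps K) C.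
Proof.
move=> hC; apply/setP => i; rewrite inE; apply/asboolP/clP.
  move=> [y [x [hy hx e hi]]]; exists (supp y); split=> //.
    by apply/vsuppsP; exists y.
  exact: ffaceP hx hy e.
move=> [Y [/vsuppsP[y hy <-] dj hi]].
have y0 : y != 0 by rewrite -supp_eq0; apply/finset.set0Pn; exists i.
have [a [x [a0 hay e bx]]] := presents_scale hy y0.
have sa : supp (a *: y) = supp y by rewrite supp_scale // gt_eqF.
exists (a *: y), x; rewrite sa; split=> //.
by exists (a *: y); rewrite sa.
Qed.

Lemma fface_sub C C' : C \in csupps K Pi -> C' \in csupps K Pi ->
  (fface C `<=` fface C')%classic <-> cl (vsupps K) C \subset cl (vsupps K) C'.
Proof.
move=> hC hC'; split=> [h|h x [y [hy e dj]]].
  rewrite -!fsupp_fface //; apply/fintype.subsetP => i; rewrite !inE.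
  move=> [y [x [hy hx e hi]]].
  by exists y, x; split=> //; exact: h.
exists y; split=> //; apply: disjointWl (cl_disjoint (vsupps K) C').
apply: fintype.subset_trans h; apply: sub_cl => //.
by apply/vsuppsP; exists y.
Qed.

(** Through this isomorphism the face lattice becomes a finite family of coordinate sets, free of
    the metric data of [P]. *)
Lemma faces_order_iso :
  order_iso (faces P) (fun F G => F `<=` G)%classic
    [set X | X \in fam (csupps K Pi) (vsupps K)]%classic (fun X Y => X \subset Y).
Proof.
exists fsupp; split; last first.
  move=> F G /face_fface[C hC ->] /face_fface[C' hC' ->].
  by rewrite fface_sub // !fsupp_fface.
split=> [F /face_fface[C hC ->]|F G|X /imsetP[C hC ->]].
  by rewrite /= fsupp_fface // imset_f.
  move=> /set_mem/face_fface[C hC ->] /set_mem/face_fface[C' hC' ->].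
  rewrite !fsupp_fface // => h.
  by apply/seteqP; split; apply/fface_sub => //; rewrite h.
exists (fface C); first exact: fface_face.
exact: fsupp_fface.
Qed.

End Faces.
End Presentations.
Arguments presents {R} P {f} K Pi.

(** * Presentations from facets *)

Lemma card_ordP T (A : set T) n :
  (A #= `I_n)%card <-> exists e : 'I_n -> T,
    [/\ injective e, forall i, A (e i) & forall t, A t -> exists i, e i = t].
Proof.
split=> [/card_set_bijP[phi [fphi iphi sphi]]|[e [ie Ae se]]].
  have /choice[e he] : forall i : 'I_n, exists t, A t /\ phi t = i.
    by move=> i; have [t At et] := sphi i (ltn_ord i); exists t.
  exists e; split=> [i j eij|i|t At].
  - by apply: ord_inj; rewrite -(he i).2 eij (he j).2.
  - exact: (he i).1.
  have := fphi t At => /= ht; exists (Ordinal ht); apply: iphi; rewrite ?inE //.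
    exact: (he _).1.
  by rewrite (he _).2.
have -> : A = range e.
  by apply/seteqP; split=> [t /se[i <-]|_ [i _ <-]] //; exists i.
apply: card_eq_trans (card_esym card_II).
by apply: inj_card_eq => i j _ _; exact: ie.
Qed.

Section FacetPresentation.
Variable R : realType.

(** The witness plays the role of a relative interior point of the facet [y_i = 0]. *)
Definition irredundant f (K : 'M[R]_f) : Prop :=
  forall i, exists y : 'rV_f,
    [/\ (y <= K)%MS, y 0 i = 0 & forall j, j != i -> 0 < y 0 j].

(** The nonnegative vectors span [K], in the dual form matching [hspan]; this ties [\rank (K *m Pi)]
    to the dimension of the polytope. *)
Definition nn_spanned f (K : 'M[R]_f) : Prop :=
  forall c : 'cV_f, (forall y, nnvec K y -> y *m c = 0) -> K *m c = 0.

Lemma span_rank_succ n p q (T : 'M[R]_(p, n)) (V : 'M[R]_(q, n)) (r : 'rV_n) :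
  (T <= V)%MS -> (r <= V)%MS -> ~~ (r <= T)%MS -> (\rank T).+1 = \rank V ->
  (V <= T + r)%MS.
Proof.
move=> TV rV rT e.
have sub : (T + r <= V)%MS by rewrite addsmx_sub TV.
rewrite -(geq_leqif (mxrank_leqif_sup sub)) -e.
rewrite ltn_neqAle mxrankS ?addsmxSl // andbT.
apply/negP => /eqP h; move: rT; apply/negP/negPn.
apply: submx_trans (addsmxSr T r) _.
by rewrite -(geq_leqif (mxrank_leqif_sup (addsmxSl T r))) h.
Qed.

Section Generators.
Variables (Q : polytope R) (N : nat) (v : 'I_N -> 'rV[R]_(ambient Q)).
Hypothesis hv : forall x,
  body Q x <-> exists2 w : 'rV_N, nonneg w & hom x = w *m hommx v.

Let V := hommx v.

Lemma gens_body j : body Q (v j).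
Proof.
apply/hv; exists (delta_mx 0 j); last by rewrite -rowE rowK.
by move=> a b; rewrite mxE; case: andP.
Qed.

Lemma gens_hspan : hspan (body Q) V.
Proof.
split=> [a /hv[w _ ->]|c hc]; first exact: submxMl.
by apply/row_matrixP => j; rewrite row_mul rowK row0 hc //; exact: gens_body.
Qed.

Lemma gens_height (w : 'rV_N) : height (w *m V) = \sum_j w 0 j.
Proof. by rewrite hom_comb /height row_mxEr mxE. Qed.

Lemma gens_face_nonneg (g : 'cV_(ambient Q + 1)) :
  (forall x, body Q x -> 0 <= (hom x *m g) 0 0) -> nonneg (V *m g).
Proof.
move=> hg j i; rewrite ord1 -row_mulE rowK; apply: hg; exact: gens_body.
Qed.

Lemma gens_face_hspan g : nonneg (V *m g) ->
  hspan [set x | body Q x /\ (hom x *m g) 0 0 = 0]%classic (tight V g).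
Proof.
move=> hg; split=> [x [/hv[w nw ->]]|c hc].
  rewrite -mulmxA mxE => /eqP; rewrite psumr_eq0; last first.
    by move=> j _; rewrite mulr_ge0.
  move=> /allP h0; suff -> : w *m V = w *m tight V g by exact: submxMl.
  rewrite !mulmx_sum_row; apply: eq_bigr => j _; rewrite row_tight.
  have := h0 j (mem_index_enum _); rewrite mulf_eq0 => /orP[/eqP ->|->] //.
  by rewrite !scale0r.
apply/row_matrixP => j; rewrite row_mul row_tight row0.
case: eqP => h; last by rewrite mul0mx.
by rewrite rowK hc //; split; [exact: gens_body|rewrite -h -row_mulE rowK].
Qed.

(** Every polytope is a projection of the simplex on its generators; this yields finiteness of the
    face lattice before any facets are available. *)
Lemma presents_gens : presents Q 1%:M V.
Proof.
split=> [x|w [_ nw] w0].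
  split=> [/hv[w nw ->]|[w [_ nw] e]]; last by apply/hv; exists w.
  by exists w => //; split=> //; exact: submx1.
rewrite gens_height lt_neqAle sumr_ge0 // andbT eq_sym.
apply: contraNneq w0 => /eqP; rewrite psumr_eq0 // => /allP h.
by apply/eqP/rowP => j; rewrite mxE; apply/eqP; exact: h (mem_index_enum _).
Qed.

Variables (f : nat) (F : 'I_f -> set 'rV[R]_(ambient Q)).
Hypothesis Finj : injective F.
Hypothesis Ffacet : forall i, facets Q (F i).
Hypothesis Fsurj : forall X, facets Q X -> exists i, F i = X.

Variable g : 'I_f -> 'cV[R]_(ambient Q + 1).
Hypothesis g_ge0 : forall i, nonneg (V *m g i).
Hypothesis g_face : forall i, F i = [set x | body Q x /\ (hom x *m g i) 0 0 = 0]%classic.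

Let G : 'M[R]_(ambient Q + 1, f) := \matrix_(a, i) g i a 0.

Lemma mulGE p (A : 'M[R]_(p, ambient Q + 1)) a i : (A *m G) a i = (A *m g i) a 0.
Proof. by rewrite !mxE; apply: eq_bigr => k _; rewrite mxE. Qed.

Lemma tight_rank i : (\rank (tight V (g i))).+1 = \rank V.
Proof.
have [_ [k []]] := Ffacet i; rewrite g_face.
move=> /(affine_rankP _ gens_hspan) -> /(affine_rankP _ (gens_face_hspan (g_ge0 i))).
by move=> ->.
Qed.

(** Facet inequalities suffice: a point outside the cone is cut off by a functional whose face is
    some facet [F i]. On the span of [V], functionals vanishing on that facet are proportional, so
    [g i] would cut the point off as well. *)
Lemma facet_cone (x : 'rV_(ambient Q + 1)) : (x <= V)%MS -> nonneg (x *m G) ->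
  exists2 w : 'rV_N, nonneg w & x = w *m V.
Proof.
move=> xV xG; apply: contrapT => /(facet_separation xV)[c [hc xc rc]].
have hFc := gens_face_hspan hc.
have [i hi] : exists i, F i = [set x | body Q x /\ (hom x *m c) 0 0 = 0]%classic.
  apply: Fsurj; split.
    apply/facesP; exists c => // z /hv[w nw ->].
    by rewrite -mulmxA; exact: (nonneg_mul nw hc).
  exists (\rank (tight V c)); split; apply/affine_rankP; first exact: gens_hspan.
  - by rewrite rc.
  - exact: hFc.
  by [].
set T := tight V (g i).
have TTc : (T <= tight V c)%MS.
  by apply: hspan_sub hFc.1; rewrite -hi g_face; exact: gens_face_hspan.
have Tc : T *m c = 0 by case/submxP: TTc => D ->; rewrite -mulmxA tight_mul mulmx0.
have Tg : T *m g i = 0 by exact: tight_mul.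
have [j hj] : exists j, ~~ (row j V <= T)%MS.
  apply/existsP; rewrite -negb_forall; apply/negP => /forallP h.
  have : (V <= T)%MS by apply/row_subP.
  by move=> /mxrankS; rewrite -(tight_rank i) ltnn.
have hjg : 0 < (V *m g i) j 0.
  rewrite lt_neqAle g_ge0 andbT eq_sym; apply: contra hj => h0.
  by apply: (submx_trans _ (row_sub j T)); rewrite row_tight h0.
have := span_rank_succ (tight_sub V (g i)) (row_sub j V) hj (tight_rank i).
move=> /(submx_trans xV)/sub_addsmxP[[u a] /= ex].
have dotE (b : 'cV_(ambient Q + 1)) : T *m b = 0 -> (x *m b) 0 0 = a 0 0 * (V *m b) j 0.
  move=> Tb; rewrite ex mulmxDl -mulmxA Tb mulmx0 add0r [a]mx11_scalar.
  by rewrite mul_scalar_mx -scalemxAl scalemx_entry row_mulE [_%:M 0 0]mxE mulr1n.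
have a0 : 0 <= a 0 0.
  by have := xG 0 i; rewrite mulGE (dotE _ Tg) pmulr_lge0.
by move: xc; rewrite (dotE _ Tc) ltNge mulr_ge0.
Qed.

Lemma gens_pointed (w : 'rV_N) : nonneg w -> height (w *m V) = 0 -> w *m V = 0.
Proof.
move=> nw; rewrite gens_height => /eqP; rewrite psumr_eq0 // => /allP h.
suff -> : w = 0 by rewrite mul0mx.
by apply/rowP => j; rewrite mxE; apply/eqP; exact: h (mem_index_enum _).
Qed.

(** If all slacks vanish, both [x] and [- x] lie in the cone, which is pointed because the height is
    positive on the generators. *)
Lemma facet_slack_inj (x : 'rV_(ambient Q + 1)) : (x <= V)%MS -> x *m G = 0 -> x = 0.
Proof.
move=> xV xG; have [w nw ew] : exists2 w : 'rV_N, nonneg w & x = w *m V.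
  by apply: facet_cone => //; rewrite xG => i j; rewrite mxE.
have [w' nw' ew'] : exists2 w : 'rV_N, nonneg w & - x = w *m V.
  by apply: facet_cone; rewrite ?eqmx_opp // mulNmx xG oppr0 => i j; rewrite mxE.
have h : height (w *m V) + height (w' *m V) = 0.
  by rewrite -height_add -ew -ew' subrr /height mxE.
have h1 : 0 <= height (w *m V) by rewrite gens_height sumr_ge0.
have h2 : 0 <= height (w' *m V) by rewrite gens_height sumr_ge0.
by rewrite ew; apply: gens_pointed => //; lra.
Qed.

Lemma VG_ge0 : nonneg (V *m G).
Proof. by move=> j i; rewrite mulGE; exact: g_ge0. Qed.

Variables (P : polytope R) (A : 'M[R]_(ambient Q + 1, ambient P + 1)).
Hypothesis A_height : forall z : 'rV_(ambient Q + 1), height (z *m A) = height z.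
Hypothesis A_image : forall x,
  body P x <-> exists2 q, body Q q & hom x = hom q *m A.

(** [K] is the image of the span of [Q] under the slack map, which is injective on that span; hence
    [A] factors through the slacks as [Pi]. Keeping [A] general covers both a projection onto [P]
    and the identity of [P]. *)
Lemma facet_presents : exists (K : 'M[R]_f) (Pi : 'M[R]_(f, ambient P + 1)),
  [/\ presents P K Pi, irredundant K, nn_spanned K &
    row_free A -> forall y : 'rV_f, (y <= K)%MS -> y *m Pi = 0 -> y = 0].
Proof.
have [Pi hPi] : exists Pi, V *m A = V *m G *m Pi.
  apply: mx_factor => z; rewrite !mulmxA => /facet_slack_inj ->; rewrite ?mul0mx //.
  exact: submxMl.
have KE y : (y <= <<V *m G>>)%MS -> exists2 u : 'rV_(ambient Q + 1),
    (u <= V)%MS & y = u *m G /\ y *m Pi = u *m A.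
  rewrite genmxE => /submxP[z ->]; exists (z *m V); first exact: submxMl.
  by rewrite -!mulmxA hPi !mulmxA.
have nnE y : nnvec <<V *m G>>%MS y -> exists2 w : 'rV_N,
    nonneg w & y = w *m V *m G /\ y *m Pi = w *m V *m A.
  move=> [/KE[u uV [yu yPi]] ny]; rewrite yu in ny.
  by have [w nw ew] := facet_cone uV ny; exists w; rewrite -?ew.
have wnn (w : 'rV_N) : nonneg w -> nnvec <<V *m G>>%MS (w *m (V *m G)).
  move=> nw; split; first by rewrite genmxE submxMl.
  exact: nonneg_mul nw VG_ge0.
exists <<V *m G>>%MS, Pi; split.
- split=> [x|y hy y0].
    split=> [/A_image[q /hv[w nw eq] ->]|[y /nnE[w nw [_ ->]] e]].
      exists (w *m (V *m G)); first exact: wnn.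
      by rewrite eq -!mulmxA hPi !mulmxA.
    have h1 : height (w *m V) = 1 by rewrite -A_height e height_hom.
    apply/A_image; exists (lsubmx (w *m V)); last by rewrite -height_eq1.
    by apply/hv; exists w; rewrite -?height_eq1.
  have [w nw [yw ->]] := nnE y hy; rewrite A_height.
  rewrite lt_neqAle eq_sym gens_height sumr_ge0 // andbT -gens_height.
  by apply: contraNneq y0 => /(gens_pointed nw) h; rewrite yw h mul0mx.
(* [w] sums the generators lying on [F i]. If another slack [l] vanished at this sum, [F i] would be
   contained in [F l], and equal ranks would make the two facets coincide. *)
- move=> i; pose w : 'rV[R]_N := \row_j ((V *m g i) j 0 == 0)%:R.
  have wT : w *m V = \sum_j row j (tight V (g i)).
    rewrite mulmx_sum_row; apply: eq_bigr => j _; rewrite row_tight mxE.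
    by case: eqP => _; rewrite ?scale1r ?scale0r.
  have nw : nonneg w by move=> a b; rewrite mxE ler0n.
  exists (w *m V *m G); split.
  - by rewrite -mulmxA; exact: (wnn w nw).1.
  - rewrite mulGE wT mulmx_suml summxE big1 // => j _.
    by rewrite -row_mul tight_mul row0 mxE.
  move=> l; rewrite mulGE wT mulmx_suml summxE => li.
  have pos j : 0 <= (row j (tight V (g i)) *m g l) 0 0.
    rewrite row_tight; case: eqP => _; first by rewrite row_mulE; exact: g_ge0.
    by rewrite mul0mx mxE.
  rewrite lt_neqAle sumr_ge0 // andbT eq_sym.
  apply: contraNneq li => /eqP; rewrite psumr_eq0 // => /allP h0.
  have Tl : tight V (g i) *m g l = 0.
    apply/row_matrixP => j; rewrite row0 row_mul [LHS]mx11_scalar.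
    by rewrite (eqP (h0 j (mem_index_enum _))) raddf0.
  have Fil : (F i `<=` F l)%classic.
    move=> x; rewrite !g_face => -[bx hx]; split=> //.
    have /submxP[D ->] := (gens_face_hspan (g_ge0 i)).1 x (conj bx hx).
    by rewrite -mulmxA Tl mulmx0 mxE.
  have sub : (tight V (g i) <= tight V (g l))%MS.
    apply: hspan_sub (gens_face_hspan (g_ge0 i)) _ => x hx.
    by apply: (gens_face_hspan (g_ge0 l)).1; have := Fil x; rewrite !g_face; apply.
  have sub' : (tight V (g l) <= tight V (g i))%MS.
    rewrite -(geq_leqif (mxrank_leqif_sup sub)).
    by rewrite -ltnS (tight_rank l) (tight_rank i).
  apply/eqP/Finj/seteqP; split=> // x; rewrite !g_face => -[bx hx]; split=> //.
  have := (gens_face_hspan (g_ge0 l)).1 x (conj bx hx).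
  move=> /submx_trans/(_ sub')/submxP[D ->].
  by rewrite -mulmxA tight_mul mulmx0 mxE.
- move=> c hc; suff : V *m G *m c = 0.
    move=> e; have : (<<V *m G>> <= V *m G)%MS by rewrite genmxE.
    by move=> /submxP[D ->]; rewrite -mulmxA e mulmx0.
  apply/row_matrixP => j; rewrite row0 row_mul; apply: hc.
  rewrite rowE; apply: wnn => a b; rewrite mxE; case: andP => //.
move=> fA y /KE[u uV [-> ->]] /eqP; rewrite -[X in _ == X](mul0mx _ A).
by move=> /eqP/(row_free_inj fA) ->; rewrite mul0mx.
Qed.

End Generators.

Lemma faces_finite (P : polytope R) : finite_set (faces P).
Proof.
have [N [v hv]] := polytope_gens P.
have := order_iso_sym (inhabits set0) (faces_order_iso (presents_gens hv)).
move=> [psi [[_ _ spsi] _]].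
apply: sub_finite_set (finite_image psi finite_finset); exact: spsi.
Qed.

Lemma facets_finite (P : polytope R) : exists f, (facets P #= `I_f)%card.
Proof. by apply/finite_setP; apply: sub_finite_set (faces_finite P) => F []. Qed.

Lemma facets_presents_gen (Q P : polytope R) (A : 'M[R]_(ambient Q + 1, ambient P + 1)) f :
  (forall z : 'rV_(ambient Q + 1), height (z *m A) = height z) ->
  (forall x, body P x <-> exists2 q, body Q q & hom x = hom q *m A) ->
  (facets Q #= `I_f)%card ->
  exists (K : 'M[R]_f) (Pi : 'M[R]_(f, ambient P + 1)),
  [/\ presents P K Pi, irredundant K, nn_spanned K &
    row_free A -> forall y : 'rV_f, (y <= K)%MS -> y *m Pi = 0 -> y = 0].
Proof.
move=> hA iA /card_ordP[F [Finj Ff Fs]].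
have [N [v hv]] := polytope_gens Q.
have /choice[g hg] : forall i, exists g : 'cV[R]_(ambient Q + 1),
    nonneg (hommx v *m g) /\ F i = [set x | body Q x /\ (hom x *m g) 0 0 = 0]%classic.
  move=> i; have [/facesP[g hg e] _] := Ff i; exists g; split=> //.
  exact: gens_face_nonneg.
by apply: (facet_presents hv Finj Ff Fs (fun i => (hg i).1) (fun i => (hg i).2)).
Qed.

Theorem facets_presents (Q P : polytope R) f :
  projects_onto Q P -> (facets Q #= `I_f)%card ->
  exists (K : 'M[R]_f) (Pi : 'M[R]_(f, ambient P + 1)),
  [/\ presents P K Pi, irredundant K & nn_spanned K].
Proof.
move=> [h [b hb]] hQ.
pose A : 'M[R]_(ambient Q + 1, ambient P + 1) := block_mx (lin1_mx h) 0 b 1%:M.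
have hA z : height (z *m A) = height z.
  rewrite -[z in LHS]hsubmxK mul_row_block mulmx0 add0r mulmx1.
  by rewrite /height row_mxEr mxE.
have homA q : hom q *m A = hom (h q + b).
  by rewrite /hom mul_row_block mulmx0 add0r mulmx1 mul1mx mul_rV_lin1.
have [x|K [Pi [h1 h2 h3 _]]] := facets_presents_gen hA _ hQ; last by exists K, Pi.
rewrite -hb; split=> [[q hq <-]|[q hq]]; first by exists q.
by rewrite homA => /hom_inj ->; exists q.
Qed.

(** The polytope as its own extension: the kernel is trivial, so every nonnegative functional is
    admissible. *)
Theorem self_presents (P : polytope R) :
  exists f (K : 'M[R]_f) (Pi : 'M[R]_(f, ambient P + 1)),
  [/\ presents P K Pi, irredundant K, nn_spanned K &
   forall y : 'rV_f, (y <= K)%MS -> y *m Pi = 0 -> y = 0].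
Proof.
have [f hf] := facets_finite P; exists f.
have [||K [Pi [h1 h2 h3 h4]]] := facets_presents_gen (A := 1%:M) _ _ hf.
- by move=> z; rewrite mulmx1.
- move=> x; split=> [bx|[q bq]]; first by exists x; rewrite ?mulmx1.
  by rewrite mulmx1 => /hom_inj ->.
exists K, Pi; split=> //; apply: h4.
by rewrite row_free_unit unitmx1.
Qed.

Lemma presents_hspan (P : polytope R) f (K : 'M[R]_f) (Pi : 'M[R]_(f, ambient P + 1)) :
  presents P K Pi -> nn_spanned K -> hspan (body P) (K *m Pi).
Proof.
move=> pres sK; split=> [x /(pres.1 _)[y [yK _] <-]|c hc].
  exact: submxMr.
rewrite -mulmxA; apply: sK => y hy; rewrite mulmxA.
case: (eqVneq y 0) => [->|y0]; first by rewrite !mul0mx.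
have [a [x [a0 _ e bx]]] := presents_scale pres hy y0.
have /eqP := hc x bx; rewrite -e -!scalemxAl scaler_eq0 gt_eqF //= => /eqP //.
Qed.

Lemma presents_dim (P : polytope R) f (K : 'M[R]_f) (Pi : 'M[R]_(f, ambient P + 1)) d :
  presents P K Pi -> nn_spanned K -> has_dim (body P) d <-> \rank (K *m Pi) = d.+1.
Proof. by move=> pres sK; apply: affine_rankP; exact: presents_hspan. Qed.

End FacetPresentation.

(** * Minimal supports and extensions *)

Section MinimalMembers.
Variable I : finType.
Implicit Types (Ys : {set {set I}}) (X Y M : {set I}).

Definition atoms Ys : {set {set I}} :=
  [set X in Ys | (X != finset.set0) &&
     [forall (Y | Y \in Ys), (Y != finset.set0) && (Y \subset X) ==> (Y == X)]]%SET.

Lemma atomsP Ys X :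
  reflect [/\ X \in Ys, X != finset.set0 &
             forall Y, Y \in Ys -> Y != finset.set0 -> Y \subset X -> Y = X]
    (X \in atoms Ys).
Proof.
rewrite inE; apply: (iffP and3P) => -[h1 h2 h3]; split=> //.
  by move=> Y hY Y0 sY; move/forall_inP/(_ Y hY)/implyP: h3 => h; apply/eqP/h; rewrite Y0.
apply/forall_inP => Y hY; apply/implyP => /andP[Y0 sY]; apply/eqP; exact: h3.
Qed.

Lemma exists_atom Ys Y : Y \in Ys -> Y != finset.set0 ->
  exists2 M, M \in atoms Ys & M \subset Y.
Proof.
have [n] := ubnP #|Y|; elim: n Y => // n IH Y /ltnSE hn hY Y0.
case: (boolP (Y \in atoms Ys)) => [hA|]; first by exists Y.
rewrite inE hY Y0 /= negb_forall_in => /exists_inP[Z hZ].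
rewrite negb_imply => /andP[/andP[Z0 sZ] nZ].
have [|M hM sM] := IH Z _ hZ Z0; last by exists M => //; exact: fintype.subset_trans sZ.
by apply: leq_trans hn; apply: proper_card; rewrite finset.properEneq nZ.
Qed.

End MinimalMembers.

(** * Generation of cones by vectors of minimal support *)

Section Generation.
Variable R : realType.

(** Moving from [y] along [z] until a first coordinate vanishes stays in the cone and creates no new
    coordinate, since [z] is zero wherever [y] is. *)
Lemma supp_ratio f (K : 'M[R]_f) (y z : 'rV_f) : nnvec K y -> (z <= K)%MS ->
  supp z \subset supp y -> (exists i, z 0 i < 0) ->
  exists2 la, 0 <= la & nnvec K (y + la *: z) /\ supp (y + la *: z) \proper supp y.
Proof.
move=> [yK ny] zK szy hneg.
have [la la0 [hla [i zi ei]]] := ratio_test (fun i => ny 0 i) hneg.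
exists la => //; split.
  split; first by rewrite addmx_sub // scalemx_sub.
  by move=> a j; rewrite ord1 addmx_entry scalemx_entry.
apply/properP; split.
  apply/fintype.subsetP => j; rewrite !inE addmx_entry scalemx_entry.
  apply: contraNneq => yj; have : j \notin supp y by rewrite inE yj eqxx.
  by move=> /(contra (fintype.subsetP szy j)); rewrite inE negbK yj => /eqP ->; rewrite mulr0 addr0.
exists i; last by rewrite inE addmx_entry scalemx_entry ei eqxx.
by apply: (fintype.subsetP szy); rewrite inE lt_eqF.
Qed.

(** Vectors of minimal support span extreme rays: if [z] were not proportional to [y], moving from
    [y] along [z] or [- z] would reach a nonzero vector of smaller support. *)
Lemma atom_ray f (K : 'M[R]_f) M (y z : 'rV_f) : M \in atoms (vsupps K) ->
  nnvec K y -> supp y = M -> (z <= K)%MS -> supp z \subset M ->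
  exists la, z = la *: y.
Proof.
move=> /atomsP[_ M0 minM] hy sy; rewrite -sy.
suff neg w : (w <= K)%MS -> supp w \subset supp y -> (exists i, w 0 i < 0) ->
    exists la, w = la *: y.
  move=> zK sz; case: (pselect (exists i, z 0 i < 0)) => [|nz]; first exact: neg.
  case: (eqVneq z 0) => [->|z0]; first by exists 0; rewrite scale0r.
  have [|||la e] := neg (- z); first by rewrite eqmx_opp.
  - by rewrite -scaleN1r supp_scale // oppr_eq0 oner_eq0.
  - move: z0; rewrite -supp_eq0 => /finset.set0Pn[i]; rewrite inE => zi.
    exists i; rewrite oppmx_entry oppr_lt0 lt_neqAle eq_sym zi leNgt.
    by apply/negP => h; apply: nz; exists i.
  by exists (- la); rewrite scaleNr -e opprK.
move=> wK sw hneg; have [la la0 [hv /andP[sp np]]] := supp_ratio hy wK sw hneg.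
have : y + la *: w = 0.
  apply/eqP; rewrite -supp_eq0; apply: contraNT np => h.
  suff -> : supp (y + la *: w) = supp y by [].
  by rewrite [RHS]sy; apply: minM => //; [apply/vsuppsP; eexists; [exact: hv|]|rewrite -sy].
have la_n0 : la != 0.
  apply: contraNneq M0 => la0'; move: np; rewrite la0' scale0r addr0.
  by rewrite fintype.subxx.
move=> /eqP; rewrite addr_eq0 => /eqP e; exists (- la^-1).
by rewrite e scaleNr scalerN opprK scalerA mulVf // scale1r.
Qed.

Lemma atom_decomposition f (K : 'M[R]_f) (y : 'rV_f) : nnvec K y ->
  exists s : seq 'rV[R]_f, y = \sum_(z <- s) z /\
    forall z, z \in s -> [/\ nnvec K z, supp z \in atoms (vsupps K) & supp z \subset supp y].
Proof.
have [n] := ubnP #|supp y|; elim: n y => // n IH y /ltnSE hn hy.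
case: (eqVneq y 0) => [->|y0]; first by exists [::]; rewrite big_nil.
have sy : supp y \in vsupps K by apply/vsuppsP; exists y.
have [|M hM sM] := exists_atom sy; first by rewrite supp_eq0.
have /atomsP[/vsuppsP[z hz sz] M0 _] := hM.
have [|||la la0 [hv pv]] := @supp_ratio _ _ y (- z) hy.
- by rewrite eqmx_opp; exact: hz.1.
- by rewrite -scaleN1r supp_scale ?oppr_eq0 ?oner_eq0 // sz.
- move: M0; rewrite -sz => /finset.set0Pn[i]; rewrite inE => zi.
  by exists i; rewrite oppmx_entry oppr_lt0 lt_neqAle eq_sym zi; exact: hz.2.
have [|s [es hs]] := IH _ _ hv; first exact: leq_trans (proper_card pv) hn.
have sub w : w \in s -> supp w \subset supp y.
  by move=> /hs[_ _ h]; apply: fintype.subset_trans h (proper_sub pv).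
case: (eqVneq la 0) => [l0|l0].
  exists s; split; first by rewrite -es l0 scale0r addr0.
  by move=> w ws; have [h1 h2 _] := hs w ws; split=> //; exact: sub.
exists (la *: z :: s); split.
  by rewrite big_cons -es scalerN addrC subrK.
move=> w; rewrite inE => /orP[/eqP ->|ws]; last first.
  by have [h1 h2 _] := hs w ws; split=> //; exact: sub.
by rewrite supp_scale // sz; split=> //; exact: nnvec_scale.
Qed.

Theorem nn_generators f (K : 'M[R]_f) :
  exists Y : 'I_#|atoms (vsupps K)| -> 'rV[R]_f,
   (forall j, nnvec K (Y j) /\ supp (Y j) = enum_val j) /\
   forall y, nnvec K y <-> exists2 w : 'I_#|atoms (vsupps K)| -> R,
     (forall j, 0 <= w j) & y = \sum_j w j *: Y j.
Proof.
have /choice[Y hY] : forall j : 'I_#|atoms (vsupps K)|, exists y : 'rV[R]_f,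
    nnvec K y /\ supp y = enum_val j.
  move=> j; have /atomsP[/vsuppsP[y hy sy] _ _] := enum_valP j.
  by exists y.
exists Y; split=> // y; split; last first.
  move=> [w hw ->]; split; last first.
    by apply: nonneg_sum => j _; apply: nonneg_scale => //; exact: (hY j).1.2.
  by apply: summx_sub => j _; apply: scalemx_sub; exact: (hY j).1.1.
move=> /atom_decomposition[s [-> hs']].
have {hs'} hs z : z \in s -> nnvec K z /\ supp z \in atoms (vsupps K).
  by move=> /hs'[].
elim: s hs => [|z s IH] hs.
  exists (fun=> 0) => //; rewrite big_nil big1 // => j _; exact: scale0r.
have [|w hw ew] := IH; first by move=> t ts; apply: hs; rewrite inE ts orbT.
have [hz sz] := hs z (mem_head _ _).
pose j0 := enum_rank_in sz (supp z).
have ej : enum_val j0 = supp z by rewrite enum_rankK_in.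
have [la ela] : exists la, z = la *: Y j0.
  apply: (@atom_ray _ K (supp z)) => //; [exact: (hY _).1| |exact: hz.1].
  by rewrite (hY _).2.
have la0 : 0 <= la.
  have /atomsP[_ /finset.set0Pn[i]] := sz; rewrite inE => zi _.
  have := hz.2 0 i; rewrite ela scalemx_entry pmulr_lge0 //.
  rewrite lt_neqAle (hY j0).1.2 andbT eq_sym.
  by apply: contraNneq zi => h; rewrite ela scalemx_entry h mulr0.
exists (fun j => w j + (j == j0)%:R * la).
  by move=> j; rewrite addr_ge0 // mulr_ge0 // ler0n.
rewrite big_cons ew; under [RHS]eq_bigr do rewrite scalerDl.
rewrite big_split addrC /=; congr (_ + _).
rewrite (bigD1 j0) //= eqxx mul1r big1 ?addr0 //.
by move=> j /negbTE ->; rewrite mul0r scale0r.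
Qed.

(** Positivity of the height lets the finitely many extreme rays be normalised to points, whose
    convex hull is the required body. *)
Theorem polytope_of_presentation f m (K : 'M[R]_f) (Pi : 'M[R]_(f, m + 1)) :
  (forall y, nnvec K y -> y != 0 -> 0 < height (y *m Pi)) ->
  exists (B : set 'rV[R]_m) (hB : exists2 V : set 'rV[R]_m,
    finite_set V & B = convex_hull V), presents (@Polytope R m B hB) K Pi.
Proof.
move=> hK; pose B : set 'rV[R]_m := fun x => exists2 y, nnvec K y & y *m Pi = hom x.
have [Y [hY gen]] := nn_generators K.
have Y0 j : Y j != 0.
  by rewrite -supp_eq0 (hY j).2; have /atomsP[] := enum_valP j.
pose a j := height (Y j *m Pi).
have a0 j : 0 < a j by apply: hK => //; exact: (hY j).1.
pose v j := lsubmx ((a j)^-1 *: (Y j *m Pi)).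
have hv j : hom (v j) = (a j)^-1 *: (Y j *m Pi).
  by rewrite /v -height_eq1 // height_scale mulVf // gt_eqF.
have hB : exists2 V : set 'rV[R]_m, finite_set V & B = convex_hull V.
  apply: (polytope_of_gens (v := v)) => x; split.
    move=> [y /gen[w hw ->] <-]; exists (\row_j (w j * a j)).
      by move=> i j; rewrite mxE mulr_ge0 // ltW.
    rewrite mulmx_suml mulmx_sum_row; apply: eq_bigr => j _.
    by rewrite rowK hv mxE scalerA mulfK ?gt_eqF // -scalemxAl.
  move=> [w nw hx]; exists (\sum_j (w 0 j / a j) *: Y j); last rewrite hx.
    by apply/gen; exists (fun j => w 0 j / a j) => // j; rewrite divr_ge0 // ltW.
  rewrite mulmx_suml mulmx_sum_row; apply: eq_bigr => j _.
  by rewrite rowK hv scalerA -scalemxAl.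
by exists B, hB.
Qed.

Lemma face_span (P : polytope R) F q (S : 'M[R]_(q, ambient P + 1)) x :
  faces P F -> hspan F S -> body P x -> (hom x <= S)%MS -> F x.
Proof.
move=> /facesP[g _ ->] [_ hS] bx /submxP[D hD]; split=> //.
by rewrite hD -mulmxA hS ?mulmx0 ?mxE // => y [_ e]; rewrite [LHS]mx11_scalar e raddf0.
Qed.

Lemma face_body (P : polytope R) F x : faces P F -> F x -> body P x.
Proof. by move=> /facesP[g _ ->] []. Qed.

(** A facet misses some point of [Q], whose preimage meets the defining set [C] at a coordinate [i];
    the proper face [y_i = 0] contains the facet, so it is the facet. Distinct facets thus yield
    distinct coordinates. *)
Lemma facets_le (Q : polytope R) f (K : 'M[R]_f) (Pi : 'M[R]_(f, ambient Q + 1)) :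
  presents Q K Pi -> (forall y : 'rV_f, (y <= K)%MS -> y *m Pi = 0 -> y = 0) ->
  exists2 j, (j <= #|cl (vsupps K) finset.set0|)%N & (facets Q #= `I_j)%card.
Proof.
move=> pres inj; have [j hj] := facets_finite Q; exists j => //.
have /card_ordP[F [Finj Ff _]] := hj.
have c1 i : [set i]%SET \in csupps K Pi.
  apply/csuppsP; exists (delta_mx 0 i); split=> [a b||y yK /(inj y yK) ->].
  - by rewrite mxE ler0n.
  - by apply/setP => l; rewrite !inE mxE eqxx /= pnatr_eq0 eqb0 negbK.
  by rewrite mul0mx.
have /choice[idx hidx] : forall l, exists i,
    i \in cl (vsupps K) finset.set0 /\ F l = fface K Pi [set i]%SET.
  move=> l; have [hF [k [rQ rF]]] := Ff l.
  have [kQ [pQ [_ _ sQ]]] := hspan_exists (body Q).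
  have [kF [pF [_ _ sF]]] := hspan_exists (F l).
  move/(affine_rankP _ sQ): rQ => rQ; move/(affine_rankP _ sF): rF => rF.
  have [x bx nFx] : exists2 x, body Q x & ~ F l x.
    apply: contrapT => h.
    have : (hommx pQ <= hommx pF)%MS.
      apply: hspan_sub sQ _ => x bx; apply: sF.1.
      by apply: contrapT => nF; apply: h; exists x.
    by move=> /mxrankS; rewrite rQ rF ltnn.
  have [C hC eC] := face_fface pres hF.
  have [y hy ey] : exists2 y, nnvec K y & y *m Pi = hom x by apply/(pres.1 x).
  have : ~~ [disjoint supp y & C].
    by apply/negP => dj; apply: nFx; rewrite eC; exists y.
  rewrite disjoint_subset => /fintype.subsetPn[i iy]; rewrite inE negbK => iC.
  have ytop : supp y \subset cl (vsupps K) finset.set0.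
    apply: sub_cl; first by apply/vsuppsP; exists y.
    by rewrite disjoint_sym finset.disjoints_subset finset.sub0set.
  exists i; split; first exact: (fintype.subsetP ytop).
  have FG : (F l `<=` fface K Pi [set i]%SET)%classic.
    rewrite eC => z [u [hu eu du]]; exists u; split=> //.
    by apply: disjointWr du; rewrite finset.sub1set.
  have nGx : ~ fface K Pi [set i]%SET x.
    move=> Gx; have := ffaceP (c1 i) Gx hy ey.
    by rewrite disjoint_sym disjoints1 iy.
  have hG := fface_face pres (c1 i).
  have [kG [pG [_ _ sG]]] := hspan_exists (fface K Pi [set i]%SET).
  have GF : (hommx pG <= hommx pF)%MS.
    have sub : (hommx pF <= hommx pG)%MS.
      by apply: hspan_sub sF _ => z /FG; exact: sG.1.
    rewrite -(geq_leqif (mxrank_leqif_sup sub)) rF -ltnS -rQ.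
    have subQ : (hommx pG <= hommx pQ)%MS.
      by apply: hspan_sub sG _ => z /(face_body hG); exact: sQ.1.
    rewrite ltn_neqAle mxrankS // andbT; apply/negP => /eqP e.
    apply: nGx; apply: (face_span hG sG bx).
    apply: submx_trans (sQ.1 x bx) _.
    by rewrite -(geq_leqif (mxrank_leqif_sup subQ)) e.
  apply/seteqP; split=> // z Gz; apply: (face_span hF sF (face_body hG Gz)).
  by apply: submx_trans GF; exact: sG.1.
have idx_inj : injective idx.
  by move=> l l' e; apply: Finj; rewrite (hidx l).2 (hidx l').2 e.
rewrite -{1}(card_ord j) -(card_codom idx_inj).
by apply: fintype.subset_leq_card; apply/fintype.subsetP => _ /codomP[l ->]; exact: (hidx l).1.
Qed.

(** Counting only the coordinates that are nonzero somewhere on the cone, rather than all [f], is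
    what later allows a coordinate to be discarded. *)
Theorem presents_extension (P : polytope R) f (K : 'M[R]_f) (Pi : 'M[R]_(f, ambient P + 1)) :
  presents P K Pi ->
  exists2 j, (j <= #|cl (vsupps K) finset.set0|)%N & extension_sizes P j.
Proof.
(* The extension keeps all coordinates of the cone, so it has no kernel; it is normalised by the
   height of [Pi], and [lsubmx Pi] maps it onto [P]. *)
move=> pres; pose Pi' : 'M[R]_(f, f + 1) := row_mx 1%:M (rsubmx Pi).
have hE (y : 'rV_f) : height (y *m Pi') = height (y *m Pi).
  rewrite /height mul_mx_row mulmx1 row_mxEr -[Pi in RHS]hsubmxK mul_mx_row.
  by rewrite row_mxEr.
have [|B [hB presQ]] := @polytope_of_presentation f f K Pi'.
  by move=> y hy y0; rewrite hE; exact: pres.2.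
have [y yK|j hj hf] := facets_le presQ.
  by rewrite /Pi' mul_mx_row mulmx1 -[RHS]row_mx0 => /eq_row_mx[].
exists j => //; exists (Polytope hB) => //.
exists (mulmxr (lsubmx Pi)), 0; apply/seteqP; split=> x /=.
  move=> [q /(presQ.1 _)[y hy ey] <-]; apply/(pres.1 _); exists y => //.
  have h1 : height (y *m Pi) = 1 by rewrite -hE ey height_hom.
  rewrite (height_eq1 h1); congr hom; rewrite addr0.
  move: ey; rewrite /Pi' mul_mx_row mulmx1 => /eq_row_mx[<- _].
  by rewrite -[Pi in LHS]hsubmxK mul_mx_row row_mxKl.
move=> /(pres.1 _)[y hy ey]; exists y.
  apply/(presQ.1 _); exists y => //.
  have h1 : height (y *m Pi') = 1 by rewrite hE ey height_hom.
  rewrite (height_eq1 h1); congr hom.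
  by rewrite /Pi' mul_mx_row mulmx1 row_mxKl.
rewrite addr0; move: ey; rewrite -[Pi in LHS]hsubmxK mul_mx_row.
by move=> /eq_row_mx[].
Qed.

End Generation.

(** * Invariants of the combinatorial type *)

Section FamilyInvariants.

Definition family_iso (I J : finType) (Fm : {set {set I}}) (Gm : {set {set J}}) : Prop :=
  order_iso [set X | X \in Fm]%classic (fun X Y : {set I} => X \subset Y)
            [set X | X \in Gm]%classic (fun X Y : {set J} => X \subset Y).

Definition istop (I : finType) (Fm : {set {set I}}) (X : {set I}) : bool :=
  [forall (Z | Z \in Fm), Z \subset X].

Definition coatoms (I : finType) (Fm : {set {set I}}) : {set {set I}} :=
  [set X in Fm | ~~ istop Fm X &&
     [forall (Y | Y \in Fm), (X \subset Y) ==> (Y == X) || istop Fm Y]]%SET.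

(** For a vertex [A] this is the number of facets avoiding it, the invariant that separates the
    types in the lower bound. *)
Definition codegree (I : finType) (Fm : {set {set I}}) (A : {set I}) : nat :=
  #|[set X in coatoms Fm | ~~ (A \subset X)]%SET|.

Lemma family_iso_sym (I J : finType) (Fm : {set {set I}}) (Gm : {set {set J}}) :
  family_iso Fm Gm -> family_iso Gm Fm.
Proof. by apply: order_iso_sym; exact: (inhabits finset.set0). Qed.

Section Transport.
Variables (I J : finType) (Fm : {set {set I}}) (Gm : {set {set J}}).
Variable phi : {set I} -> {set J}.
Hypothesis phi_mem : forall X, X \in Fm -> phi X \in Gm.
Hypothesis phi_inj : {in Fm &, injective phi}.
Hypothesis phi_surj : forall Y, Y \in Gm -> exists2 X, X \in Fm & phi X = Y.
Hypothesis phi_sub : {in Fm &, forall X Y, (phi X \subset phi Y) = (X \subset Y)}.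

Lemma istop_transport X : X \in Fm -> istop Gm (phi X) = istop Fm X.
Proof.
move=> hX; apply/forall_inP/forall_inP => h Z hZ.
  by rewrite -phi_sub // h // phi_mem.
by have [Y hY <-] := phi_surj hZ; rewrite phi_sub // h.
Qed.

Lemma coatoms_transport X : X \in Fm -> (phi X \in coatoms Gm) = (X \in coatoms Fm).
Proof.
move=> hX; rewrite !inE phi_mem // hX istop_transport //=; congr (_ && _).
apply/forall_inP/forall_inP => h Z hZ.
  have := h _ (phi_mem hZ); rewrite phi_sub // istop_transport //.
  by rewrite (inj_in_eq phi_inj).
have [Y hY <-] := phi_surj hZ; rewrite phi_sub // istop_transport //.
by rewrite (inj_in_eq phi_inj) //; exact: h.
Qed.

Lemma codegree_transport A : A \in Fm -> codegree Gm (phi A) = codegree Fm A.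
Proof.
move=> hA; rewrite /codegree.
have sub X : X \in coatoms Fm -> X \in Fm by rewrite inE => /andP[].
rewrite -[RHS](card_in_imset (f := phi)); last first.
  by move=> X Y /setIdP[/sub hX _] /setIdP[/sub hY _]; exact: phi_inj.
congr #|pred_of_set _|; apply/setP => Z; apply/idP/imsetP.
  move=> /setIdP[hZ nA].
  have /phi_surj[X hX eX] : Z \in Gm by move: hZ; rewrite inE => /andP[].
  exists X => //; apply/setIdP; rewrite -coatoms_transport // eX; split=> //.
  by move: nA; rewrite -eX phi_sub.
move=> [X /setIdP[hX nA] ->]; apply/setIdP.
by rewrite coatoms_transport ?hX ?phi_sub // sub.
Qed.

Lemma set0_transport : finset.set0 \in Fm -> finset.set0 \in Gm ->
  phi finset.set0 = finset.set0.
Proof.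
move=> hF /phi_surj[X hX eX]; apply/eqP; rewrite -finset.subset0 -eX phi_sub //.
exact: finset.sub0set.
Qed.

Lemma atoms_transport X : finset.set0 \in Fm -> finset.set0 \in Gm ->
  X \in atoms Fm -> phi X \in atoms Gm.
Proof.
move=> hF hG /atomsP[hX X0 minX]; have e0 := set0_transport hF hG.
apply/atomsP; split; first exact: phi_mem.
  by rewrite -e0 (inj_in_eq phi_inj).
move=> Y /phi_surj[Z hZ <-]; rewrite -e0 (inj_in_eq phi_inj) // phi_sub // => Z0 sZ.
by rewrite (minX Z).
Qed.

Lemma sorted_transport s : {subset s <= Fm} ->
  sorted (fun X Y : {set I} => X \proper Y) s ->
  sorted (fun X Y : {set J} => X \proper Y) (map phi s).
Proof.
move=> hs; rewrite sorted_map; apply: (sub_in_sorted (P := [in Fm])).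
  by move=> X Y hX hY; rewrite /= !properE !phi_sub.
by apply/allP.
Qed.

End Transport.

Lemma family_isoP (I J : finType) (Fm : {set {set I}}) (Gm : {set {set J}}) :
  family_iso Fm Gm -> exists phi : {set I} -> {set J},
  [/\ forall X, X \in Fm -> phi X \in Gm, {in Fm &, injective phi},
    forall Y, Y \in Gm -> exists2 X, X \in Fm & phi X = Y &
    {in Fm &, forall X Y, (phi X \subset phi Y) = (X \subset Y)}].
Proof.
move=> [phi [[h1 h2 h3] h4]]; exists phi; split=> //.
  by move=> X Y hX hY; apply: h2; rewrite inE.
by move=> X Y hX hY; apply/idP/idP => /h4; apply.
Qed.

Lemma card_atoms_iso (I J : finType) (Fm : {set {set I}}) (Gm : {set {set J}}) :
  finset.set0 \in Fm -> finset.set0 \in Gm -> family_iso Fm Gm ->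
  #|atoms Fm| = #|atoms Gm|.
Proof.
suff le (A B : finType) (Am : {set {set A}}) (Bm : {set {set B}}) :
    finset.set0 \in Am -> finset.set0 \in Bm -> family_iso Am Bm ->
    (#|atoms Am| <= #|atoms Bm|)%N.
  by move=> hF hG h; apply/eqP; rewrite eqn_leq !le //; exact: family_iso_sym.
move=> hA hB /family_isoP[phi [h1 h2 h3 h4]].
have sub X : X \in atoms Am -> X \in Am by move=> /atomsP[].
rewrite -(card_in_imset (f := phi)); last by move=> X Y /sub ? /sub ?; exact: h2.
apply: fintype.subset_leq_card; apply/fintype.subsetP => _ /imsetP[X hX ->].
exact: (atoms_transport h1 h2 h3 h4 hA hB).
Qed.

Lemma codegree_iso (I J : finType) (Fm : {set {set I}}) (Gm : {set {set J}}) A :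
  finset.set0 \in Fm -> finset.set0 \in Gm -> family_iso Fm Gm -> A \in atoms Fm ->
  exists2 B, B \in atoms Gm & codegree Gm B = codegree Fm A.
Proof.
move=> hF hG /family_isoP[phi [h1 h2 h3 h4]] hA; exists (phi A).
  exact: (atoms_transport h1 h2 h3 h4).
by apply: (codegree_transport h1 h2 h3 h4); have /atomsP[] := hA.
Qed.

End FamilyInvariants.

(** * Dimension as the length of chains of faces *)

Section Dimension.
Variable R : realType.

Lemma dominate f (u y : 'rV[R]_f) : nonneg y ->
  exists2 mu, 0 <= mu & forall i, 0 < y 0 i -> 0 < u 0 i + mu * y 0 i.
Proof.
move=> ny; pose t i := (`|u 0 i| + 1) / y 0 i.
have t0 i : 0 <= t i by rewrite divr_ge0 // addr_ge0.
exists (\sum_i t i); first by rewrite sumr_ge0.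
move=> i yi; have h : t i * y 0 i <= (\sum_i t i) * y 0 i.
  by rewrite ler_pM2r // (bigD1 i) //= lerDl sumr_ge0.
apply: lt_le_trans (_ : u 0 i + t i * y 0 i <= _); last by rewrite lerD2l.
rewrite /t divfK ?gt_eqF // addrCA.
by have := ler_norm (- u 0 i); rewrite normrN; lra.
Qed.

Definition coordmx f (X : {set 'I_f}) : 'M[R]_f := diag_mx (\row_i (i \in X)%:R).

Lemma mul_coordmx f (X : {set 'I_f}) (y : 'rV[R]_f) i :
  (y *m coordmx X) 0 i = if i \in X then y 0 i else 0.
Proof. by rewrite mul_mx_diag !mxE; case: (i \in X); rewrite ?mulr1 ?mulr0. Qed.

Lemma sub_coordmx f (X : {set 'I_f}) (y : 'rV[R]_f) :
  (y <= coordmx X)%MS = (supp y \subset X).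
Proof.
apply/idP/idP => [/submxP[D ->]|h].
  apply/fintype.subsetP => i; rewrite inE mul_coordmx.
  by case: (i \in X); rewrite ?eqxx.
suff -> : y = y *m coordmx X by exact: submxMl.
apply/rowP => i; rewrite mul_coordmx; case: ifP => // /negbT.
by move=> /(contra (fintype.subsetP h i)); rewrite inE negbK => /eqP.
Qed.

(** The dimension of the vectors of [K] supported in [X], which acts as a rank function along chains
    of supports. *)
Definition suppdim f (K : 'M[R]_f) (X : {set 'I_f}) : nat := \rank (K :&: coordmx X)%MS.

Lemma suppdim_lt f (K : 'M[R]_f) (X Y : {set 'I_f}) : Y \in vsupps K ->
  X \proper Y -> (suppdim K X < suppdim K Y)%N.
Proof.
move=> /vsuppsP[y [yK ny] sy] /properP[XY [i iY iX]].
have sub : (K :&: coordmx X <= K :&: coordmx Y)%MS.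
  apply: capmxS => //; apply/row_subP => j; rewrite sub_coordmx.
  by apply: fintype.subset_trans XY; rewrite -sub_coordmx row_sub.
rewrite ltn_neqAle mxrankS // andbT; apply/negP => /eqP e.
have : (K :&: coordmx Y <= K :&: coordmx X)%MS.
  by rewrite -(geq_leqif (mxrank_leqif_sup sub)) -/(suppdim K Y) -e.
have yY : (y <= K :&: coordmx Y)%MS by rewrite sub_capmx yK sub_coordmx sy /=.
move=> /(submx_trans yY); rewrite sub_capmx => /andP[_].
by rewrite sub_coordmx sy => /fintype.subsetP/(_ i iY); rewrite (negbTE iX).
Qed.

Lemma chain_bound f (K : 'M[R]_f) (s : seq {set 'I_f}) : {subset s <= vsupps K} ->
  sorted (fun X Y : {set 'I_f} => X \proper Y) s -> (size s <= (\rank K).+1)%N.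
Proof.
case: s => // X s hs; rewrite /= ltnS => hp.
suff h : (suppdim K X + size s <= \rank K)%N by apply: leq_trans h; rewrite leq_addl.
have {hs} : {subset s <= vsupps K} by move=> Y hY; apply: hs; rewrite inE hY orbT.
elim: s X hp => [|Y s IH] X /=; first by rewrite addn0 mxrankS // capmxSl.
move=> /andP[XY /IH h] hs; have Ys := hs _ (mem_head _ _).
apply: leq_trans (h _); last by move=> Z hZ; apply: hs; rewrite inE hZ orbT.
by rewrite addnS -addSn leq_add2r; exact: suppdim_lt.
Qed.

(** A smallest support [Y] above [X] works. If its rank exceeded that of [X] by two or more, a point
    over [Y] could be moved onto a support strictly between [X] and [Y]. *)
Lemma chain_step f (K : 'M[R]_f) X : nn_spanned K -> X \in vsupps K ->
  (suppdim K X < \rank K)%N ->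
  exists Y, [/\ Y \in vsupps K, X \proper Y & suppdim K Y = (suppdim K X).+1].
Proof.
move=> sK hX hlt; have [y hy sy] := vsuppsP _ _ hX.
have [Y0 hY0 pY0] : exists2 Y, Y \in vsupps K & X \proper Y.
  have [z hz nz] : exists2 z, nnvec K z & ~~ (z <= coordmx X)%MS.
    apply: contrapT => h; have : (K <= coordmx X)%MS.
      apply/negPn/negP => /mx_separation[c Xc /eqP]; apply; apply: sK => z hz.
      have /submxP[D ->] : (z <= coordmx X)%MS.
        by apply/negPn/negP => nz; apply: h; exists z.
      by rewrite -mulmxA Xc mulmx0.
    move=> h'; move: hlt; rewrite /suppdim ltnNge => /negP; apply.
    by apply: mxrankS; rewrite sub_capmx submx_refl.
  exists (supp (y + z)); first by apply/vsuppsP; exists (y + z) => //; exact: nnvec_add.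
  rewrite supp_add ?sy; [|exact: hy.2|exact: hz.2].
  rewrite properE finset.subsetUl finset.subUset fintype.subxx /=.
  by rewrite -sub_coordmx.
have ex : exists n, [exists Y in vsupps K, (X \proper Y) && (#|Y| == n)].
  by exists #|Y0|; apply/exists_inP; exists Y0; rewrite ?pY0 /=.
case: (ex_minnP ex) => n /exists_inP[Y hY /andP[pY /eqP nY]] minY.
exists Y; split=> //; have [y' hy' sy'] := vsuppsP _ _ hY.
apply/eqP; rewrite eqn_leq (suppdim_lt hY pY) andbT leqNgt; apply/negP => lt2.
(* A direction that is not a combination of [y'] and a vector supported in [X]; this choice excludes
   landing on [X] itself. *)
have [z zKY nz] : exists2 z : 'rV[R]_f, (z <= K :&: coordmx Y)%MS &
    ~~ (z <= (K :&: coordmx X) + y')%MS.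
  have : ~~ (K :&: coordmx Y <= (K :&: coordmx X) + y')%MS.
    apply/negP => /mxrankS; rewrite leqNgt => /negP; apply.
    apply: leq_ltn_trans lt2; apply: leq_trans (mxrank_adds_leqif _ _) _.
    by have := rank_leq_row y'; rewrite /suppdim; lia.
  by move=> /row_subPn[i hi]; exists (row i (K :&: coordmx Y)%MS) => //; exact: row_sub.
have [i iYX zi] : exists2 i, i \in (Y :\: X)%SET & z 0 i != 0.
  apply: contrapT => h; move: nz; apply/negP/negPn.
  apply: submx_trans (addsmxSl _ _).
  move: zKY; rewrite !sub_capmx => /andP[-> /=]; rewrite !sub_coordmx => sz.
  apply/fintype.subsetP => i iz; apply: contrapT => /negP iX; apply: h.
  by exists i; [rewrite inE iX (fintype.subsetP sz)|move: iz; rewrite inE].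
wlog zi0 : z zKY nz zi / z 0 i < 0.
  move=> H; case: (ltrgtP (z 0 i) 0) (zi) => // hz _; first exact: (H z).
  apply: (H (- z)); rewrite ?eqmx_opp //.
    by rewrite oppmx_entry oppr_eq0.
  by rewrite oppmx_entry oppr_lt0.
(* Only the coordinates in [D] limit the motion: negative entries inside [X] are repaired afterwards
   by a multiple of [y], whose support is [X]. *)
pose D := (Y :\: X)%SET.
have [la la0 [hla [k ak bk]]] : exists2 la, 0 <= la &
    (forall j, 0 <= (if j \in D then y' 0 j else 0) + la * (if j \in D then z 0 j else 0)) /\
    exists2 j, (if j \in D then z 0 j else 0) < 0 &
      (if j \in D then y' 0 j else 0) + la * (if j \in D then z 0 j else 0) = 0.
  apply: ratio_test; last by exists i; rewrite iYX.
  by move=> j; case: ifP => // _; exact: hy'.2.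
have kD : k \in D by move: ak; case: ifP; rewrite ?ltxx.
rewrite kD in bk.
have [mu mu0 hmu] := dominate (y' + la *: z) hy.2.
pose w := y' + la *: z + mu *: y.
have yX j : (0 < y 0 j) = (j \in X).
  by rewrite -sy inE lt_neqAle eq_sym hy.2 andbT.
have yX0 j : j \notin X -> y 0 j = 0.
  by rewrite -sy inE negbK => /eqP.
have wE j : w 0 j = y' 0 j + la * z 0 j + mu * y 0 j.
  by rewrite /w !addmx_entry !scalemx_entry.
move: zKY; rewrite sub_capmx => /andP[zK]; rewrite sub_coordmx => szY.
have wX j : j \in X -> 0 < w 0 j.
  by rewrite -yX => /hmu; rewrite addmx_entry scalemx_entry wE.
have wD j : j \in D -> 0 <= w 0 j.
  by move=> jD; have := hla j; rewrite wE jD yX0 ?mulr0 ?addr0 //; move: jD; rewrite inE => /andP[].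
have w0 j : j \notin Y -> w 0 j = 0.
  move=> jY; rewrite wE yX0; last first.
    by apply: contra jY; apply: fintype.subsetP; exact: proper_sub pY.
  have -> : y' 0 j = 0 by move: jY; rewrite -sy' inE negbK => /eqP.
  have -> : z 0 j = 0.
    by move: (contra (fintype.subsetP szY j) jY); rewrite inE negbK => /eqP.
  by rewrite !mulr0 !addr0.
have hw : nnvec K w.
  split; first by rewrite !addmx_sub ?scalemx_sub //; [exact: hy'.1|exact: hy.1].
  move=> a j; rewrite ord1; case: (boolP (j \in X)) => jX; first exact: ltW (wX j jX).
  case: (boolP (j \in Y)) => jY; last by rewrite w0.
  by apply: wD; rewrite inE jX.
have Xw : X \subset supp w by apply/fintype.subsetP => j /wX; rewrite inE => /gt_eqF ->.
have wY : supp w \proper Y.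
  apply/properP; split.
    by apply/fintype.subsetP => j; rewrite inE; apply: contraNT => /w0 ->.
  exists k; first by move: kD; rewrite inE => /andP[].
  rewrite inE wE bk add0r yX0 ?mulr0 ?eqxx //.
  by move: kD; rewrite inE => /andP[].
case: (eqVneq (supp w) X) => [ewX|nwX]; last first.
  have : (n <= #|supp w|)%N.
    apply: minY; apply/exists_inP; exists (supp w); first by apply/vsuppsP; exists w.
    by rewrite finset.properEneq eq_sym nwX Xw eqxx.
  by rewrite leqNgt -nY proper_card.
(* Landing on [X] would express [z] through [y'] and a vector supported in [X]. *)
have eX : ((y' + la *: z)%R <= K :&: coordmx X)%MS.
  rewrite sub_capmx; apply/andP; split.
    by apply: addmx_sub; [exact: hy'.1|exact: scalemx_sub].
  have -> : y' + la *: z = w + (- mu) *: y by rewrite /w scaleNr addrK.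
  by apply: addmx_sub; rewrite ?scalemx_sub // sub_coordmx ?ewX ?sy.
have la1 : la != 0.
  apply: contraTneq eX => ->; rewrite scale0r addr0 sub_capmx sub_coordmx sy'.
  by rewrite negb_and -[X in _ || X]/(~~ (Y \subset X)); move: pY; rewrite properE => /andP[_ ->]; rewrite orbT.
move: nz; apply/negP/negPn.
have -> : z = la^-1 *: ((y' + la *: z) + (- 1) *: y').
  by rewrite scaleN1r addrAC subrr add0r scalerA mulVf // scale1r.
apply: scalemx_sub; apply: addmx_sub; first exact: submx_trans eX (addsmxSl _ _).
by apply: scalemx_sub; exact: addsmxSr.
Qed.

Lemma chain_exists f (K : 'M[R]_f) : nn_spanned K ->
  exists s, [/\ {subset s <= vsupps K},
    sorted (fun X Y : {set 'I_f} => X \proper Y) s & size s = (\rank K).+1].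
Proof.
move=> sK; suff H n X : X \in vsupps K -> (\rank K - suppdim K X = n)%N ->
    exists s, [/\ {subset s <= vsupps K},
      path (fun X Y : {set 'I_f} => X \proper Y) X s & size s = n].
  have h0 := (vsupps_union_closed K).1.
  have d0 : suppdim K finset.set0 = 0%N.
    apply/eqP; rewrite /suppdim mxrank_eq0 -submx0; apply: submx_trans (capmxSr _ _) _.
    apply/row_subP => i; rewrite submx0 -supp_eq0 -finset.subset0 -sub_coordmx.
    exact: row_sub.
  have [|s [hs ps ss]] := H (\rank K) _ h0; first by rewrite d0 subn0.
  exists (finset.set0 :: s); split=> //=; last by rewrite ss.
  by move=> X; rewrite inE => /orP[/eqP ->|/hs].
elim: n X => [|n IH] X hX hn; first by exists [::].
have lt : (suppdim K X < \rank K)%N by rewrite -subn_gt0 hn.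
have [Y [hY XY dY]] := chain_step sK hX lt.
have [|s [hs ps ss]] := IH Y hY; first by rewrite dY; lia.
exists (Y :: s); split=> /=; [|by rewrite XY|by rewrite ss].
by move=> Z; rewrite inE => /orP[/eqP ->|/hs].
Qed.

(** With no kernel every set is the support of an admissible functional, and the complement of a
    support [Y] has closure [Y]. *)
Lemma fam_full f q (K : 'M[R]_f) (Pi : 'M[R]_(f, q)) :
  (forall y : 'rV_f, (y <= K)%MS -> y *m Pi = 0 -> y = 0) ->
  fam (csupps K Pi) (vsupps K) = vsupps K.
Proof.
move=> inj; apply/setP => Y; apply/imsetP/idP => [[C _ ->]|hY].
  exact: cl_mem (vsupps_union_closed K).
exists (~: Y)%SET.
  apply/csuppsP; exists (\row_i (i \in ~: Y)%:R); split=> [a b||y yK /(inj y yK) ->].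
  - by rewrite mxE ler0n.
  - by apply/setP => l; rewrite !inE mxE pnatr_eq0 eqb0 negbK !inE.
  by rewrite mul0mx.
apply/eqP; rewrite finset.eqEsubset sub_cl //=; last first.
  by rewrite finset.disjoints_subset finset.setCK.
by have := cl_disjoint (vsupps K) (~: Y)%SET; rewrite finset.disjoints_subset finset.setCK.
Qed.

(** [\rank K] is one less than the length of a longest chain of supports, hence visible in the order
    alone. *)
Lemma rank_iso f f' (K : 'M[R]_f) (K' : 'M[R]_f') :
  nn_spanned K -> nn_spanned K' ->
  family_iso (vsupps K) (vsupps K') -> \rank K = \rank K'.
Proof.
suff le a b (A : 'M[R]_a) (B : 'M[R]_b) : nn_spanned A ->
    family_iso (vsupps A) (vsupps B) -> (\rank A <= \rank B)%N.
  move=> sK sK' h; apply/eqP; rewrite eqn_leq !le //; exact: family_iso_sym.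
move=> sA /family_isoP[phi [h1 h2 h3 h4]].
have [s [hs ps ss]] := chain_exists sA.
rewrite -ltnS -ss -(size_map phi); apply: chain_bound.
  by move=> _ /mapP[X /hs hX ->]; exact: h1.
exact: (sorted_transport h4).
Qed.

End Dimension.

(** * Vertices as atoms; invariance of dimension and vertex number *)

Section Vertices.
Variable R : realType.

Lemma set0_face (P : polytope R) : faces P set0.
Proof.
exists \0, 1; split=> [x _|]; first by rewrite ler01.
apply/seteqP; split=> x //= [_ /eqP].
by rewrite eq_sym oner_eq0.
Qed.

Lemma set0_fam (P : polytope R) f (K : 'M[R]_f) (Pi : 'M[R]_(f, ambient P + 1)) :
  presents P K Pi -> finset.set0 \in fam (csupps K Pi) (vsupps K).
Proof.
move=> pres; have [phi [[fphi iphi sphi] hphi]] := faces_order_iso pres.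
have [C hC eC] := face_fface pres (set0_face P).
apply/imsetP; exists C => //; apply/eqP; rewrite eq_sym -finset.subset0.
rewrite -(fsupp_fface pres hC) -eC; apply/fintype.subsetP => i; rewrite inE.
by move=> /asboolP[y [x []]].
Qed.

(** In the facet presentation such a face belongs to a minimal support, over which the cone is a
    single ray; a ray has only one point of height 1. *)
Lemma minimal_face (P : polytope R) F : faces P F -> (F !=set0)%classic ->
  (forall G, faces P G -> (G !=set0)%classic -> (G `<=` F)%classic -> G = F) ->
  exists v, F = [set v]%classic.
Proof.
move=> hF [x Fx] minF.
have [f [K [Pi [pres _ _ inj]]]] := self_presents P.
have [C hC eC] := face_fface pres hF.
have [y [hy ey dy]] : fface K Pi C x by rewrite -eC.
have y0 : supp y != finset.set0.
  rewrite supp_eq0; apply: contra_eq_neq ey => ->; rewrite mul0mx.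
  apply/eqP => /(congr1 (@height R _)); rewrite height_hom /height mxE => /eqP.
  by rewrite eq_sym oner_eq0.
have [|M hM sM] := exists_atom (_ : supp y \in vsupps K) y0.
  by apply/vsuppsP; exists y.
have cM : (~: M)%SET \in csupps K Pi.
  apply/csuppsP; exists (\row_i (i \in ~: M)%:R); split=> [a b||z zK /(inj z zK) ->].
  - by rewrite mxE ler0n.
  - by apply/setP => l; rewrite !inE mxE pnatr_eq0 eqb0 negbK !inE.
  by rewrite mul0mx.
have /atomsP[/vsuppsP[z hz sz] M0 _] := hM.
have z0 : z != 0 by rewrite -supp_eq0 sz.
have [a [v [a0 haz eaz bv]]] := presents_scale pres hz z0.
have saz : supp (a *: z) = M by rewrite supp_scale ?gt_eqF.
exists v; rewrite -(minF (fface K Pi (~: M)%SET)).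
- apply/seteqP; split=> [u [w [hw ew dw]]|_ ->]; last first.
    exists (a *: z); split=> //.
    by rewrite saz finset.disjoints_subset finset.setCK.
  have sw : supp w \subset M by rewrite -[M]finset.setCK -finset.disjoints_subset.
  have [la ela] := atom_ray hM haz saz hw.1 sw.
  have la1 : la = 1.
    have := congr1 (@height R _) ew; rewrite ela -scalemxAl eaz height_scale.
    by rewrite !height_hom mulr1.
  by apply: hom_inj; rewrite -ew ela la1 scale1r eaz.
- exact: fface_face.
- by exists v, (a *: z); split=> //; rewrite saz finset.disjoints_subset finset.setCK.
rewrite eC => u [w [hw ew dw]]; exists w; split=> //.
apply: disjointWl dy; apply: fintype.subset_trans sM.
by rewrite -[M]finset.setCK -finset.disjoints_subset.
Qed.

Theorem card_vertices (P : polytope R) f (K : 'M[R]_f) (Pi : 'M[R]_(f, ambient P + 1)) :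
  presents P K Pi ->
  (vertices P #= `I_#|atoms (fam (csupps K Pi) (vsupps K))|)%card.
Proof.
move=> pres; set Fm := fam _ _.
have h0 : finset.set0 \in Fm := set0_fam pres.
have [phi [[fphi iphi sphi] hphi]] := faces_order_iso pres.
have phi0 : phi set0 = finset.set0.
  have [G hG eG] := sphi _ h0; apply/eqP; rewrite -finset.subset0 -eG.
  by apply/hphi => //; exact: set0_face.
have phi_n0 G : faces P G -> (G !=set0)%classic -> phi G != finset.set0.
  move=> hG [x Gx]; apply/eqP => e; have : G = set0.
    by apply: iphi; rewrite ?inE //; [exact: set0_face|rewrite e phi0].
  by move=> e'; rewrite e' in Gx.
have vatom v : vertices P v -> phi [set v]%classic \in atoms Fm.
  move=> hv; apply/atomsP; split; first exact: fphi.
    by apply: phi_n0 => //; exists v.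
  move=> Y /sphi[G hG <-] n0 /(hphi _ _ hG hv) sG; congr phi.
  apply/seteqP; split=> // _ ->.
  have [x Gx] : (G !=set0)%classic.
    by apply/set0P; apply: contraNneq n0 => ->; rewrite phi0.
  by rewrite -(sG x Gx).
have atomv X : X \in atoms Fm -> exists v, vertices P v /\ phi [set v]%classic = X.
  move=> /atomsP[/sphi[F hF eF] X0 minX].
  have Fn0 : (F !=set0)%classic.
    by apply/set0P; apply: contraNneq X0 => e; rewrite -eF e phi0.
  have [G hG Gn0 sG|v ev] := minimal_face hF Fn0.
    apply: iphi; rewrite ?inE // eF; apply: minX; first exact: fphi.
      exact: phi_n0.
    by rewrite -eF; apply/hphi.
  by exists v; rewrite /vertices /= -ev.
apply/card_ordP.
have /choice[e he] : forall i : 'I_#|atoms Fm|, exists v,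
    vertices P v /\ phi [set v]%classic = enum_val i.
  by move=> i; apply: atomv; exact: enum_valP.
exists e; split=> [i j eij|i|v hv].
- by apply: enum_val_inj; rewrite -(he i).2 -(he j).2 eij.
- exact: (he i).1.
have va := vatom v hv.
have [j ej] : exists j : 'I_#|atoms Fm|, enum_val j = phi [set v]%classic.
  by exists (enum_rank_in va (phi [set v]%classic)); rewrite enum_rankK_in.
exists j; have [h1 h2] := he j.
have : [set e j]%classic = [set v]%classic by apply: iphi; rewrite ?inE // h2.
by move=> /seteqP[h _]; have := h _ erefl.
Qed.

Lemma card_vertices_eq (P : polytope R) f (K : 'M[R]_f) (Pi : 'M[R]_(f, ambient P + 1)) n :
  presents P K Pi -> (vertices P #= `I_n)%card ->
  #|atoms (fam (csupps K Pi) (vsupps K))| = n.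
Proof.
move=> /card_vertices h1 /card_esym h2; apply/card_eq_II/card_esym.
exact: card_eq_trans h2 h1.
Qed.

Lemma presentation_iso (P P' : polytope R) f f' (K : 'M[R]_f)
    (Pi : 'M[R]_(f, ambient P + 1)) (K' : 'M[R]_f') (Pi' : 'M[R]_(f', ambient P' + 1)) :
  presents P K Pi -> presents P' K' Pi' ->
  same_combinatorial_type P P' <->
  family_iso (fam (csupps K Pi) (vsupps K)) (fam (csupps K' Pi') (vsupps K')).
Proof.
move=> /faces_order_iso pres /faces_order_iso pres'; split=> h.
  apply: order_iso_trans (order_iso_sym (inhabits set0) pres) _.
  exact: order_iso_trans h pres'.
apply: order_iso_trans pres _; apply: order_iso_trans h _.
exact: order_iso_sym (inhabits set0) pres'.
Qed.

(** Bridges the two realizations in [types_with_xc]: one fixes the dimension and the vertices, a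
    possibly different one has the required extension complexity. *)
Theorem type_invariants (P P' : polytope R) d n :
  same_combinatorial_type P P' -> has_dim (body P) d -> (vertices P #= `I_n)%card ->
  has_dim (body P') d /\ (vertices P' #= `I_n)%card.
Proof.
move=> hPP.
have [f [K [Pi [pres _ sK inj]]]] := self_presents P.
have [f' [K' [Pi' [pres' _ sK' inj']]]] := self_presents P'.
have iso := (presentation_iso pres pres').1 hPP.
move=> /(presents_dim _ pres sK) hd hn.
have rk g m (L : 'M[R]_g) (S : 'M[R]_(g, m)) :
    (forall y : 'rV_g, (y <= L)%MS -> y *m S = 0 -> y = 0) -> \rank (L *m S) = \rank L.
  move=> h; rewrite -[RHS](mxrank_mul_ker L S).
  suff -> : (L :&: kermx S)%MS = 0 by rewrite mxrank0 addn0.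
  apply/eqP; rewrite -submx0; apply/row_subP => i; rewrite submx0; apply/eqP/h.
    exact: submx_trans (row_sub i _) (capmxSl _ _).
  by apply/sub_kermxP; exact: submx_trans (row_sub i _) (capmxSr _ _).
split.
  apply/(presents_dim _ pres' sK'); rewrite rk // -hd rk //.
  by apply/esym/rank_iso => //; move: iso; rewrite !fam_full.
rewrite -(card_vertices_eq pres hn) (card_atoms_iso (set0_fam pres) (set0_fam pres') iso).
exact: card_vertices.
Qed.

End Vertices.

(** * Upper bound *)

Section SignConditions.
Variable R : realType.

Definition pos_set f (t : 'I_f -> R) : {set 'I_f} := [set i | 0 < t i]%SET.
Definition neg_set f (t : 'I_f -> R) : {set 'I_f} := [set i | t i < 0]%SET.

Definition overlap (I : finType) (A B : {set I}) : bool := ~~ [disjoint A & B].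

Lemma overlapP (I : finType) (A B : {set I}) :
  reflect (exists2 i, i \in A & i \in B) (overlap A B).
Proof.
rewrite /overlap disjoint_subset; apply: (iffP (fintype.subsetPn)).
  by move=> [i hA]; rewrite inE negbK; exists i.
by move=> [i hA hB]; exists i; rewrite // inE negbK.
Qed.

(** The sign condition for [Y] to be the support of a nonnegative vector orthogonal to [t]: both
    signs occur on [Y], or neither does. *)
Definition balanced f (t : 'I_f -> R) (Y : {set 'I_f}) : bool :=
  overlap Y (pos_set t) == overlap Y (neg_set t).

Lemma balancedP f (t : 'I_f -> R) (Y : {set 'I_f}) :
  reflect (exists y : 'rV[R]_f, [/\ nonneg y, supp y = Y & \sum_i y 0 i * t i = 0])
    (balanced t Y).
Proof.
apply: (iffP eqP); last first.
  suff sgn (s : 'I_f -> R) (y : 'rV[R]_f) : nonneg y -> supp y = Y -> \sum_i y 0 i * s i = 0 ->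
      overlap Y (pos_set s) -> overlap Y (neg_set s).
    move=> [y [ny sy ey]]; apply/idP/idP; first exact: (sgn t y).
    move=> h; have := sgn (fun i => - t i) y ny sy.
    have e : pos_set (fun i => - t i) = neg_set t.
      by apply/setP => i; rewrite !inE oppr_gt0.
    have e' : neg_set (fun i => - t i) = pos_set t.
      by apply/setP => i; rewrite !inE oppr_lt0.
    rewrite e e'; apply => //.
    by under eq_bigr do rewrite mulrN; rewrite sumrN ey oppr0.
  move=> ny sy ey /overlapP[i iY]; rewrite inE => ti.
  apply: contrapT => nm; have ge j : 0 <= y 0 j * s j.
    case: (leP 0 (s j)) => sj; first by rewrite mulr_ge0.
    have -> : y 0 j = 0; last by rewrite mul0r.
    apply: contrapT => /eqP yj; apply: nm; apply/overlapP; exists j; rewrite ?inE //.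
    by rewrite -sy inE.
  move: ey => /eqP; rewrite psumr_eq0 // => /allP/(_ i (mem_index_enum _)).
  rewrite mulf_eq0 (gt_eqF ti) orbF /= => /eqP yi.
  by move: iY; rewrite -sy inE yi eqxx.
move=> e; case: (boolP (overlap Y (pos_set t))) => hp; last first.
  have hn : ~~ overlap Y (neg_set t) by rewrite -e.
  exists (\row_i (i \in Y)%:R); split=> [i j||].
  - by rewrite mxE ler0n.
  - by apply/setP => i; rewrite !inE mxE pnatr_eq0 eqb0 negbK.
  rewrite big1 // => i _; rewrite mxE; case: (boolP (i \in Y)) => iY; last by rewrite mul0r.
  have -> : t i = 0; last by rewrite mulr0.
  apply/eqP; rewrite eq_le !leNgt; apply/andP; split; apply/negP => ti.
    by move: hp => /negP; apply; apply/overlapP; exists i; rewrite ?inE.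
  by move: hn => /negP; apply; apply/overlapP; exists i; rewrite ?inE.
have hn : overlap Y (neg_set t) by rewrite -e.
(* Weighting the positive entries by the total [be] of the negative ones, and conversely, makes the
   two contributions cancel. *)
pose al := \sum_(i | (i \in Y) && (0 < t i)) t i.
pose be := \sum_(i | (i \in Y) && (t i < 0)) - t i.
have al0 : 0 < al.
  have /overlapP[i iY] := hp; rewrite inE => ti.
  rewrite /al (bigD1 i) ?iY //= ltr_pwDl // sumr_ge0 // => j /andP[/andP[_ /ltW]] //.
have be0 : 0 < be.
  have /overlapP[i iY] := hn; rewrite inE => ti.
  rewrite /be (bigD1 i) ?iY //= ltr_pwDl ?oppr_gt0 //.
  by rewrite sumr_ge0 // => j /andP[/andP[_ /ltW]]; rewrite oppr_ge0.
exists (\row_i (if i \in Y then if 0 < t i then be else if t i < 0 then al else 1 else 0)).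
split=> [i j||].
- rewrite mxE; case: ifP => // _; case: ifP => _; first exact: ltW.
  by case: ifP => // _; exact: ltW.
- apply/setP => i; rewrite !inE mxE; case: ifP => _; last by rewrite eqxx.
  case: ifP => _; first by rewrite gt_eqF.
  by case: ifP => _; rewrite ?gt_eqF ?oner_eq0.
have -> : \sum_i (\row_i (if i \in Y then if 0 < t i then be else if t i < 0 then al else 1 else 0)) 0 i * t i
   = \sum_(i | (i \in Y) && (0 < t i)) be * t i + \sum_(i | (i \in Y) && (t i < 0)) al * t i.
  rewrite [X in X + _]big_mkcond [X in _ + X]big_mkcond -big_split /=.
  apply: eq_bigr => i _; rewrite mxE; case: (i \in Y) => /=; last by rewrite mul0r addr0.
  by case: (ltrgtP (t i) 0) => ti; rewrite ?addr0 ?add0r // ti mulr0.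
rewrite -!mulr_sumr -/al.
have -> : \sum_(i | (i \in Y) && (t i < 0)) t i = - be by rewrite /be sumrN opprK.
by rewrite mulrN mulrC subrr.
Qed.

Lemma hyperplane f (K : 'M[R]_f) : (\rank K).+1 = f ->
  exists2 t : 'cV[R]_f, t != 0 & forall y : 'rV_f, (y <= K)%MS = (y *m t == 0).
Proof.
move=> rK; have [t Kt] : exists2 t : 'cV[R]_f, K *m t = 0 & 1%:M *m t != 0.
  apply: mx_separation; apply/negP => /mxrankS; rewrite mxrank1 -{1}rK ltnn //.
rewrite mul1mx => t0; exists t => // y.
have sub : (K <= kermx t)%MS by apply/sub_kermxP.
have rt : \rank t = 1%N by apply/eqP; rewrite eqn_leq rank_leq_col lt0n mxrank_eq0.
have e : (kermx t <= K)%MS.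
  by rewrite -(geq_leqif (mxrank_leqif_sup sub)) mxrank_ker rt -{1}rK subn1.
by apply/idP/eqP => [/submx_trans/(_ sub)/sub_kermxP|/sub_kermxP/submx_trans]; last exact.
Qed.

Lemma sum_dot f (y : 'rV[R]_f) (t : 'cV[R]_f) :
  (y *m t == 0) = (\sum_i y 0 i * t i 0 == 0).
Proof.
apply/eqP/eqP => [/matrixP/(_ 0 0)|h]; first by rewrite !mxE.
by apply/matrixP => i j; rewrite !ord1 !mxE.
Qed.

Lemma vsupps_hyperplane f (K : 'M[R]_f) (t : 'cV[R]_f) :
  (forall y : 'rV_f, (y <= K)%MS = (y *m t == 0)) ->
  forall Y, (Y \in vsupps K) = balanced (fun i => t i 0) Y.
Proof.
move=> hK Y; apply/vsuppsP/balancedP => [[y [yK ny] sy]|[y [ny sy ey]]].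
  by exists y; split=> //; apply/eqP; rewrite -sum_dot -hK.
by exists y => //; split=> //; rewrite hK sum_dot ey.
Qed.

(** [u = 0] is allowed, so that a trivial kernel is covered too. *)
Lemma csupps_line f q (K : 'M[R]_f) (Pi : 'M[R]_(f, q)) (u : 'rV[R]_f) :
  (u <= K)%MS -> u *m Pi = 0 ->
  (forall y : 'rV_f, (y <= K)%MS -> y *m Pi = 0 -> exists a, y = a *: u) ->
  forall C, (C \in csupps K Pi) = balanced (fun i => u 0 i) C.
Proof.
move=> uK uPi hu C; have dotE (c : 'rV[R]_f) : (u *m c^T) 0 0 = \sum_i c 0 i * u 0 i.
  by rewrite mxE; apply: eq_bigr => i _; rewrite mxE mulrC.
apply/csuppsP/balancedP => [[c [nc sc hc]]|[c [nc sc ec]]]; exists c; split=> //.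
  by rewrite -dotE hc // mxE.
move=> y yK yPi; have [a ->] := hu y yK yPi.
rewrite -scalemxAl; suff -> : u *m c^T = 0 by rewrite scaler0.
by rewrite [LHS]mx11_scalar dotE ec raddf0.
Qed.

End SignConditions.

Section AtomsOfFamilies.
Variable I : finType.
Implicit Types (Cs Ys : {set {set I}}).

(** A projection has at most as many vertices as the lift: each vertex is assigned a minimal support
    below it. If the vertices given by [C] and [C'] share this support, the closure for [C :|: C']
    is nonempty and below both, so they are equal. *)
Lemma card_atoms_fam Cs Ys : union_closed Cs -> union_closed Ys ->
  (#|atoms (fam Cs Ys)| <= #|atoms Ys|)%N.
Proof.
move=> hC hY; pose g (X : {set I}) := odflt finset.set0 [pick M in atoms Ys | M \subset X].
have hg X : X \in atoms (fam Cs Ys) -> g X \in atoms Ys /\ g X \subset X.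
  move=> /atomsP[/imsetP[C _ eX] X0 _]; rewrite /g; case: pickP => [M /andP[]//|h].
  have [|M hM sM] := exists_atom (_ : X \in Ys) X0; first by rewrite eX cl_mem.
  by have := h M; rewrite hM sM.
rewrite -(card_in_imset (f := g)).
  by apply: fintype.subset_leq_card; apply/fintype.subsetP => _ /imsetP[X /hg[h _] ->].
move=> X X' hX hX' e; have [h1 h2] := hg X hX; have [h3 h4] := hg X' hX'.
have /atomsP[/imsetP[C cC eX] _ minX] := hX.
have /atomsP[/imsetP[C' cC' eX'] _ minX'] := hX'.
have /atomsP[gY g0 _] := h1.
pose Z := cl Ys (C :|: C')%SET.
have hZ : Z \in fam Cs Ys by apply: imset_f; exact: hC.2.
have gZ : g X \subset Z.
  apply: sub_cl => //; rewrite finset.disjoints_subset finset.setCU finset.subsetI.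
  rewrite -!finset.disjoints_subset; apply/andP; split.
    by apply: disjointWl h2 _; rewrite eX cl_disjoint.
  by rewrite e; apply: disjointWl h4 _; rewrite eX' cl_disjoint.
have Z0 : Z != finset.set0.
  by apply: contra g0 => /eqP e0; rewrite e0 finset.subset0 in gZ.
rewrite -(minX Z hZ Z0); last by rewrite eX clS // finset.subsetUl.
by rewrite -(minX' Z hZ Z0) // eX' clS // finset.subsetUr.
Qed.

(** A vertex [M] of the lift survives when some admissible functional is supported exactly on the
    complement of [M], and so vanishes at no other vertex. *)
Lemma atoms_fam_mem Cs Ys M : union_closed Ys -> M \in atoms Ys -> (~: M)%SET \in Cs ->
  M \in atoms (fam Cs Ys).
Proof.
move=> hY /atomsP[hM M0 minM] cM.
have eM : M = cl Ys (~: M)%SET.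
  apply/eqP; rewrite finset.eqEsubset sub_cl //=; last first.
    by rewrite finset.disjoints_subset finset.setCK.
  by have := cl_disjoint Ys (~: M)%SET; rewrite finset.disjoints_subset finset.setCK.
apply/atomsP; split=> //; first by apply/imsetP; exists (~: M)%SET.
by move=> Y /imsetP[C _ ->] Y0 sY; apply: minM => //; exact: cl_mem.
Qed.

End AtomsOfFamilies.

(** * Pyramid apices, and signs forced by irredundancy and minimality *)

Section Loops.
Variable R : realType.

(* The complement consists of the apices of iterated pyramids: the coordinate
   vectors lying in [K]. *)
Definition essential f (K : 'M[R]_f) : {set 'I_f} :=
  [set i | ~~ ((delta_mx 0 i : 'rV[R]_f) <= K)%MS]%SET.

(** At an inessential coordinate multiples of a unit vector of [K] can be added, so the support can
    be prescribed there freely. *)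
Lemma vsupps_essential f (K : 'M[R]_f) (Y Y' : {set 'I_f}) :
  (Y :&: essential K)%SET = (Y' :&: essential K)%SET -> Y \in vsupps K -> Y' \in vsupps K.
Proof.
move=> e /vsuppsP[y [yK ny] sy].
pose y' : 'rV[R]_f := \row_i (if i \in essential K then y 0 i else (i \in Y')%:R).
apply/vsuppsP; exists y'; last first.
  apply/setP => i; rewrite inE mxE; case: ifP => iE; last by rewrite pnatr_eq0 eqb0 negbK.
  have := congr1 (fun A : {set 'I_f} => i \in A) e; rewrite !inE in iE *.
  by rewrite -sy !inE iE !andbT.
split; last by move=> a i; rewrite mxE; case: ifP => // _; rewrite ?ord1.
rewrite -(subrK y y') addmx_sub // [y' - y]row_sum_delta summx_sub // => i _.
case: (boolP (i \in essential K)) => iE; last first.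
  by apply: scalemx_sub; move: iE; rewrite inE negbK.
by rewrite addmx_entry oppmx_entry mxE iE subrr scale0r sub0mx.
Qed.

Lemma irredundant_pos f (K : 'M[R]_f) (i j : 'I_f) : irredundant K -> i != j ->
  exists2 y, nnvec K y & 0 < y 0 i.
Proof.
move=> irr ij; have [y [yK yj hy]] := irr j; exists y; last exact: hy.
split=> // a k; rewrite ord1; case: (eqVneq k j) => [->|kj]; first by rewrite yj.
exact: ltW (hy k kj).
Qed.

Lemma irredundant_nn f (K : 'M[R]_f) i : irredundant K ->
  exists y, [/\ nnvec K y, y 0 i = 0 & forall j, j != i -> 0 < y 0 j].
Proof.
move=> irr; have [y [yK yi hy]] := irr i; exists y; split=> //; split=> // a k.
rewrite ord1; case: (eqVneq k i) => [->|ki]; first by rewrite yi.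
exact: ltW (hy k ki).
Qed.

(** If [t] is positive at most at [k], pairing it with a point vanishing only at [k] kills every
    other entry; pairing it with a point positive at [k] then kills the entry at [k]. *)
Lemma card_gt1_pos f (K : 'M[R]_f) (t : 'cV[R]_f) : (1 < f)%N -> irredundant K ->
  (forall y : 'rV_f, (y <= K)%MS -> y *m t = 0) -> t != 0 ->
  (1 < #|pos_set (fun i => t i 0%R)|)%N.
Proof.
move=> f1 irr Kt t0; rewrite ltnNge; apply/negP => h.
have other (k : 'I_f) : exists l : 'I_f, l != k.
  case: f f1 k {K t irr Kt t0 h} => [|[|f]] // _ k.
  by case: (eqVneq k ord0) => [->|k0]; [exists ord_max|exists ord0; rewrite // eq_sym].
have zero (y : 'rV[R]_f) : nnvec K y ->
    (forall i, 0 < t i 0 -> y 0 i = 0) -> forall i, y 0 i * t i 0 = 0.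
  move=> [yK ny] hy i; have := Kt y yK; move/matrixP/(_ 0 0); rewrite !mxE => e.
  have le j : 0 <= - (y 0 j * t j 0).
    rewrite oppr_ge0; case: (ltP 0 (t j 0)) => tj; first by rewrite hy // mul0r.
    by rewrite mulr_ge0_le0.
  have : \sum_j - (y 0 j * t j 0) = 0 by rewrite sumrN e oppr0.
  move/eqP; rewrite psumr_eq0 // => /allP/(_ i (mem_index_enum _)).
  by rewrite /= oppr_eq0 => /eqP.
have [k hk] : exists k : 'I_f, forall i, i != k -> ~ 0 < t i 0.
  case: (boolP (pos_set (fun i => t i 0) == finset.set0)) => [/eqP e0|/finset.set0Pn[k kp]].
    exists (Ordinal (ltnW f1)) => i _ ti.
    by have := congr1 (fun A : {set 'I_f} => i \in A) e0; rewrite !inE ti.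
  exists k => i ik ti; move/card_le1_eqP: h => /(_ i k); rewrite inE ti => /(_ isT kp) e.
  by rewrite e eqxx in ik.
have [y [hy yk ypos]] := irredundant_nn k irr.
have tz i : i != k -> t i 0 = 0.
  move=> ik; have /eqP : y 0 i * t i 0 = 0.
    apply: zero => // j tj; case: (eqVneq j k) => [->//|jk].
    by case: (hk j jk).
  by rewrite mulf_eq0 gt_eqF ?ypos //= => /eqP.
have [l lk] := other k.
have [z [hz zl zpos]] := irredundant_nn l irr.
have tk : t k 0 = 0.
  have := Kt z hz.1; move/matrixP/(_ 0 0); rewrite !mxE (bigD1 k) //= big1 ?addr0; last first.
    by move=> j jk; rewrite tz // mulr0.
  by move/eqP; rewrite mulf_eq0 gt_eqF ?zpos ?(eq_sym k) //= => /eqP.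
move: t0 => /eqP; apply; apply/colP => i; rewrite mxE.
by case: (eqVneq i k) => [->|/tz].
Qed.

(* If [u] were positive in the coordinate [k] only, subtracting multiples of
   [u] would move every point into the hyperplane [y_k = 0] without changing its
   image, and the coordinate [k] could be discarded. *)
Lemma card_gt1_line (P : polytope R) f (K : 'M[R]_f) (Pi : 'M[R]_(f, ambient P + 1))
    (u : 'rV[R]_f) : presents P K Pi -> (forall j, extension_sizes P j -> (f <= j)%N) ->
  (u <= K)%MS -> u *m Pi = 0 -> u != 0 -> (1 < #|pos_set (fun i => u 0%R i)|)%N.
Proof.
move=> pres minf uK uPi u0; rewrite ltnNge; apply/negP => h.
case: (boolP (pos_set (fun i => u 0 i) == finset.set0)) => [/eqP e0|/finset.set0Pn[k kp]].
  (* Without positive entries in [u], [- u] would be a nonzero vector of the cone with height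
     zero. *)
  have nu : nnvec K (- u).
    split; first by rewrite eqmx_opp.
    move=> a i; rewrite ord1 oppmx_entry oppr_ge0 leNgt; apply/negP => ui.
    by have := congr1 (fun A : {set 'I_f} => i \in A) e0; rewrite !inE ui.
  have := pres.2 _ nu; rewrite oppr_eq0 mulNmx uPi oppr0 /height mxE ltxx.
  by move=> /(_ u0).
have uk : 0 < u 0 k by move: kp; rewrite inE.
have hu i : i != k -> u 0 i <= 0.
  move=> ik; rewrite leNgt; apply/negP => ui; move/card_le1_eqP: h => /(_ i k).
  by rewrite inE ui => /(_ isT kp) e; rewrite e eqxx in ik.
pose K' := (K :&: coordmx R (~: [set k])%SET)%MS.
have K'E (y : 'rV_f) : (y <= K')%MS = (y <= K)%MS && (y 0 k == 0).
  rewrite sub_capmx sub_coordmx; congr (_ && _).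
  rewrite -finset.disjoints_subset disjoint_sym disjoints1 inE negbK //.
have pres' : presents P K' Pi.
  split=> [x|y [yK' ny]]; last first.
    by apply: pres.2; split=> //; move: yK'; rewrite K'E => /andP[].
  rewrite (pres.1 x); split=> [[y [yK ny] e]|[y [yK ny] e]]; last first.
    by exists y => //; split=> //; move: yK; rewrite K'E => /andP[].
  exists (y - (y 0 k / u 0 k) *: u); last by rewrite mulmxBl -scalemxAl uPi scaler0 subr0.
  split.
    rewrite K'E addmx_sub ?eqmx_opp ?scalemx_sub //=.
    by rewrite addmx_entry oppmx_entry scalemx_entry divfK ?subrr // (gt_eqF uk).
  move=> a i; rewrite ord1 addmx_entry oppmx_entry scalemx_entry.
  case: (eqVneq i k) => [->|ik]; first by rewrite divfK ?gt_eqF // subrr.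
  rewrite addr_ge0 // -mulrN mulr_ge0 ?oppr_ge0 ?hu // divr_ge0 //; exact: ltW.
have [j hj /minf] := presents_extension pres'.
move=> /leq_trans/(_ hj); rewrite leqNgt => /negP; apply.
rewrite -[X in (_ < X)%N]card_ord -cardsT; apply: proper_card.
apply/properP; split; first by apply/fintype.subsetP => i _; rewrite inE.
exists k; rewrite ?inE //; apply/negP => /clP[Y [/vsuppsP[y [yK _] <-] _]].
by move: yK; rewrite K'E => /andP[_ yk]; rewrite inE yk.
Qed.

End Loops.

(** * Bounding the number of essential coordinates *)

Section EssentialBound.
Variable R : realType.

Definition zero_set f (t : 'I_f -> R) : {set 'I_f} := [set i | t i == 0]%SET.

Lemma card_pos_neg_zero f (t : 'I_f -> R) :
  (#|pos_set t| + #|neg_set t| + #|zero_set t| = f)%N.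
Proof.
rewrite -[RHS]card_ord -(cardsC (pos_set t)) -addnA; congr (_ + _)%N.
rewrite -(cardsID (neg_set t) (~: pos_set t)%SET).
by congr (_ + _)%N; apply: eq_card => i; rewrite !inE; case: ltrgtP.
Qed.

Lemma balanced_set1 f (t : 'I_f -> R) i : t i = 0 -> balanced t [set i]%SET.
Proof.
by move=> ti; rewrite /balanced /overlap !disjoints1 !inE ti ltxx.
Qed.

Lemma balanced_set2 f (t : 'I_f -> R) i j : 0 < t i -> t j < 0 ->
  balanced t [set i; j]%SET.
Proof.
move=> ti tj; apply/eqP; transitivity true; [|apply/esym].
  by apply/overlapP; exists i; rewrite !inE ?eqxx.
by apply/overlapP; exists j; rewrite !inE ?eqxx ?orbT.
Qed.

(** The minimal nonempty balanced sets; for a hyperplane section of a simplex they are the supports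
    of its vertices. *)
Definition circuits f (t : 'I_f -> R) : {set {set 'I_f}} :=
  ([set [set p.1; p.2]%SET | p in finset.setX (pos_set t) (neg_set t)]
   :|: [set [set i]%SET | i in zero_set t])%SET.

Lemma circuitsP f (t : 'I_f -> R) (M : {set 'I_f}) :
  reflect ((exists i j, [/\ 0 < t i, t j < 0 & M = [set i; j]%SET]) \/
           (exists2 i, t i = 0 & M = [set i]%SET)) (M \in circuits t).
Proof.
apply: (iffP setUP) => -[h|h].
- left; case/imsetP: h => -[i j] /finset.setXP[]; rewrite !inE => hi hj ->.
  by exists i, j.
- by right; case/imsetP: h => i; rewrite inE => /eqP hi ->; exists i.
- left; have [i [j [hi hj ->]]] := h; apply/imsetP; exists (i, j) => //.
  by apply/finset.setXP; rewrite !inE.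
right; have [i hi ->] := h; apply/imsetP; exists i => //.
by rewrite inE hi.
Qed.

Lemma circuits_atoms f (Ys : {set {set 'I_f}}) (t : 'I_f -> R) :
  (forall Y, (Y \in Ys) = balanced t Y) -> atoms Ys = circuits t.
Proof.
move=> hY; have circ Y : Y \in Ys -> Y != finset.set0 ->
    exists2 M, M \in circuits t & M \subset Y.
  rewrite hY => /eqP e Y0; case: (boolP (overlap Y (pos_set t))) => hp.
    have /overlapP[i iY] := hp; rewrite inE => ti.
    have : overlap Y (neg_set t) by rewrite -e.
    move=> /overlapP[j jY]; rewrite inE => tj; exists [set i; j]%SET.
      by apply/circuitsP; left; exists i, j.
    by rewrite finset.subUset !finset.sub1set iY.
  have hn : ~~ overlap Y (neg_set t) by rewrite -e.
  have /finset.set0Pn[i iY] := Y0; exists [set i]%SET; last by rewrite finset.sub1set.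
  apply/circuitsP; right; exists i => //.
  apply/eqP; rewrite eq_le !leNgt; apply/andP; split; apply/negP => ti.
    by move: hp => /negP; apply; apply/overlapP; exists i; rewrite ?inE.
  by move: hn => /negP; apply; apply/overlapP; exists i; rewrite ?inE.
have mem M : M \in circuits t -> M \in Ys /\ M != finset.set0.
  move=> /circuitsP[[i [j [ti tj ->]]]|[i ti ->]]; rewrite hY; split.
  - exact: balanced_set2.
  - by apply/finset.set0Pn; exists i; rewrite !inE eqxx.
  - exact: balanced_set1.
  - by apply/finset.set0Pn; exists i; rewrite !inE eqxx.
have anti M M' : M \in circuits t -> M' \in circuits t -> M' \subset M -> M' = M.
  move=> hM /circuitsP[[i [j [ti tj ->]]]|[i ti ->]].
    rewrite finset.subUset !finset.sub1set; case/circuitsP: hM => [[k [l [tk tl ->]]]|[k tk ->]].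
      rewrite !inE => /andP[/orP[] /eqP ei /orP[] /eqP ej]; subst i j => //; exfalso; lra.
    by rewrite !inE => /andP[/eqP ei _]; subst i; move: ti; rewrite tk ltxx.
  rewrite finset.sub1set; case/circuitsP: hM => [[k [l [tk tl ->]]]|[k tk ->]].
    by rewrite !inE => /orP[] /eqP ei; subst i; exfalso; lra.
  by rewrite !inE => /eqP ->.
apply/setP => M; apply/idP/idP => [/atomsP[hM M0 minM]|hM].
  have [M' hM' sM] := circ M hM M0.
  by rewrite -(minM M' (mem M' hM').1 (mem M' hM').2 sM).
have [h1 h2] := mem M hM; apply/atomsP; split=> // Y hYY Y0 sY.
have [M' hM' sM'] := circ Y hYY Y0; apply/eqP; rewrite finset.eqEsubset sY /=.
by rewrite -(anti M M' hM hM' (fintype.subset_trans sM' sY)).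
Qed.

Lemma card_circuits f (t : 'I_f -> R) :
  #|circuits t| = (#|pos_set t| * #|neg_set t| + #|zero_set t|)%N.
Proof.
rewrite cardsU (_ : (_ :&: _)%SET = finset.set0) ?cards0 ?subn0; last first.
  apply/setP => M; rewrite finset.in_setI finset.in_set0; apply/negbTE/negP => /andP[].
  move=> /imsetP[[i j]] /finset.setXP[]; rewrite !inE => ti tj -> /imsetP[k].
  rewrite inE => /eqP tk e; have : i \in [set k]%SET by rewrite -e !inE eqxx.
  by rewrite inE => /eqP ei; subst i; move: ti; rewrite tk ltxx.
congr (_ + _)%N; last by rewrite card_imset //; exact: finset.set1_inj.
rewrite card_in_imset ?cardsX // => -[i j] [k l] /finset.setXP[/= hi hj] /finset.setXP[/= hk hl] /= e.
move: hi hj hk hl; rewrite !inE => hi hj hk hl.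
have : i \in [set k; l]%SET by rewrite -e !inE eqxx.
have : j \in [set k; l]%SET by rewrite -e !inE eqxx orbT.
by rewrite !inE => /orP[] /eqP ej /orP[] /eqP ei; subst i j => //; exfalso; lra.
Qed.

Lemma essential_hyperplane f (K : 'M[R]_f) (t : 'cV[R]_f) :
  (forall y : 'rV_f, (y <= K)%MS = (y *m t == 0)) ->
  essential K = (pos_set (fun i => t i 0) :|: neg_set (fun i => t i 0))%SET.
Proof.
move=> hK; apply/setP => i; rewrite !inE hK sum_dot (bigD1 i) //= big1 ?addr0.
  by rewrite mxE !eqxx mul1r; case: ltrgtP.
by move=> j ji; rewrite mxE (negbTE ji) andbF mul0r.
Qed.

Lemma pos_neg_setN f (t : 'I_f -> R) : pos_set (fun i => - t i) = neg_set t.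
Proof. by apply/setP => i; rewrite !inE oppr_gt0. Qed.

Lemma eq_pos_set f (s t : 'I_f -> R) : s =1 t -> pos_set s = pos_set t.
Proof. by move=> e; apply/setP => i; rewrite !inE e. Qed.

(* Of the [a * b + z] vertices of the lift only those two whose support is the
   positive or the negative part of [u] can disappear in the projection. *)
Lemma essential_bound1 (P : polytope R) f (K : 'M[R]_f) (Pi : 'M[R]_(f, ambient P + 1)) :
  (1 < f)%N -> presents P K Pi -> irredundant K ->
  (forall j, extension_sizes P j -> (f <= j)%N) ->
  (\rank K).+1 = f -> \rank (K :&: kermx Pi)%MS = 1%N ->
  #|atoms (fam (csupps K Pi) (vsupps K))| = f.+1 ->
  (#|essential K| <= 7)%N /\ exists2 u : 'rV[R]_f, (u <= K)%MS /\ u *m Pi = 0 &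
    forall y : 'rV_f, (y <= K)%MS -> y *m Pi = 0 -> exists a, y = a *: u.
Proof.
move=> f1 pres irr minf rK rU cat.
have [t t0 hK] := hyperplane rK.
have [u [uK uPi u0] hu] : exists2 u : 'rV[R]_f, [/\ (u <= K)%MS, u *m Pi = 0 & u != 0] &
    forall y : 'rV_f, (y <= K)%MS -> y *m Pi = 0 -> exists a, y = a *: u.
  have : ((K :&: kermx Pi)%MS != 0) by rewrite -mxrank_eq0 rU.
  move=> /rowV0Pn[u]; rewrite sub_capmx => /andP[uK /sub_kermxP uPi] u0.
  exists u => // y yK yPi; apply/sub_rVP.
  have sub : (u <= K :&: kermx Pi)%MS by rewrite sub_capmx uK; apply/sub_kermxP.
  apply: submx_trans (_ : (K :&: kermx Pi <= u)%MS).
    by rewrite sub_capmx yK; apply/sub_kermxP.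
  by rewrite -(geq_leqif (mxrank_leqif_sup sub)) rU rank_rV u0.
have Yb := vsupps_hyperplane hK.
have Cb := csupps_line uK uPi hu.
pose s i := t i 0; pose v i := u 0 i.
have hp : (1 < #|pos_set s|)%N.
  by apply: (card_gt1_pos f1 irr) t0 => y; rewrite hK => /eqP.
have hn : (1 < #|neg_set s|)%N.
  have := card_gt1_pos (t := - t) f1 irr; rewrite oppr_eq0 => /(_ _ t0).
  rewrite (eq_pos_set (t := fun i => - s i)); last by move=> i; rewrite oppmx_entry.
  rewrite pos_neg_setN; apply => y; rewrite hK => /eqP h.
  by rewrite mulmxN h oppr0.
have vp : (1 < #|pos_set v|)%N by apply: card_gt1_line pres minf uK uPi u0.
have vn : (1 < #|neg_set v|)%N.
  have := card_gt1_line (u := - u) pres minf.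
  rewrite eqmx_opp mulNmx uPi oppr0 oppr_eq0 => /(_ uK erefl u0).
  rewrite (eq_pos_set (t := fun i => - v i)); last by move=> i; rewrite oppmx_entry.
  by rewrite pos_neg_setN.
split; last by exists u.
(* A circuit has at most two elements and each sign of [v] occurs at least twice, so its complement
   meets both sign sets unless the circuit equals one of them. *)
have sub : (circuits s :\ pos_set v :\ neg_set v)%SET \subset
    atoms (fam (csupps K Pi) (vsupps K)).
  apply/fintype.subsetP => M; rewrite !in_setD1 => /and3P[Mn Mp hM].
  apply: atoms_fam_mem (vsupps_union_closed K) _ _.
    by rewrite (circuits_atoms Yb).
  have cM : (#|M| <= 2)%N.
    by case/circuitsP: hM => [[i [j [_ _ ->]]]|[i _ ->]]; rewrite ?cards1 // cards2; case: eqP.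
  have big (A : {set 'I_f}) : (1 < #|A|)%N -> M != A -> overlap (~: M)%SET A.
    move=> hA; apply: contraNT; rewrite negbK finset.disjoints_subset finset.setCS => h.
    by rewrite eq_sym finset.eqEcard h (leq_trans cM).
  by rewrite Cb /balanced !big.
have := fintype.subset_leq_card sub; rewrite cat.
have := cardsD1 (neg_set v) (circuits s :\ pos_set v)%SET.
have := cardsD1 (pos_set v) (circuits s).
have := card_circuits s; have := card_pos_neg_zero s.
rewrite (essential_hyperplane hK) -/s.
have : (#|pos_set s :|: neg_set s| <= #|pos_set s| + #|neg_set s|)%N.
  by rewrite cardsU leq_subr.
have b1 (b : bool) : (b <= 1)%N by case: b.
have := b1 (pos_set v \in circuits s).
have := b1 (neg_set v \in circuits s :\ pos_set v)%SET.
move: hp hn; move: #|pos_set s| #|neg_set s| => [|[|a]] // [|[|b]] //.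
(* With [a + 2] positive and [b + 2] negative entries the vertex count gives [a * b + a + b <= 3],
   hence at most [3 + 4] essential coordinates. *)
have -> : (a.+2 * b.+2 = a * b + 2 * a + 2 * b + 4)%N by ring.
move: (a * b)%N => ab; clear.
move: (nat_of_bool (_ \in circuits s)) (nat_of_bool (_ \in (circuits s :\ _)%SET)) => x y.
move: #|circuits s| #|(circuits s :\ _)%SET| #|(_ :\ _ :\ _)%SET| => c c1 c2.
lia.
Qed.

Lemma mul_delta f (z : 'rV[R]_f) (i : 'I_f) : (z *m (delta_mx i 0 : 'cV_f)) 0 0 = z 0 i.
Proof.
rewrite mxE (bigD1 i) //= big1 ?addr0; last by move=> j ji; rewrite mxE (negbTE ji) mulr0.
by rewrite mxE !eqxx mulr1.
Qed.

(** The vectors of minimal support avoiding [i] generate the face [y_i = 0], which by irredundancy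
    spans the whole section of [K] by that hyperplane, of rank at least [\rank K - 1]. *)
Lemma card_atoms_avoiding f (K : 'M[R]_f) (i : 'I_f) : irredundant K ->
  (\rank K <= #|[set M in atoms (vsupps K) | i \notin M]%SET|.+1)%N.
Proof.
move=> irr; set A := [set M in _ | _]%SET.
pose Ki := (K :&: kermx (delta_mx i (0 : 'I_1)))%MS.
have rKi : (\rank K <= (\rank Ki).+1)%N.
  have := mxrank_mul_ker K (delta_mx i (0 : 'I_1)) => <-.
  exact: leq_add (rank_leq_col _) (leqnn _).
apply: leq_trans rKi _; rewrite ltnS.
have /choice[Y hY] : forall M : {set 'I_f}, exists y : 'rV[R]_f,
    M \in atoms (vsupps K) -> nnvec K y /\ supp y = M.
  move=> M; case: (boolP (M \in atoms _)) => [/atomsP[/vsuppsP[y hy sy] _ _]|_].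
    by exists y.
  by exists 0.
pose W : 'M[R]_(#|A|, f) := \matrix_k Y (enum_val k).
have inW (y : 'rV[R]_f) : nnvec K y -> y 0 i = 0 -> (y <= W)%MS.
  move=> hy yi; have [s [es hs]] := atom_decomposition hy.
  rewrite es big_seq summx_sub // => z /hs[hz aM sM].
  have iz : i \notin supp z.
    by apply/negP => /(fintype.subsetP sM); rewrite inE yi eqxx.
  have zA : supp z \in A by rewrite inE aM.
  have [h1 h2] := hY _ aM.
  have [la ->] := atom_ray aM h1 h2 hz.1 (fintype.subxx _).
  apply: scalemx_sub; rewrite -[supp z](enum_rankK_in zA zA).
  by rewrite -(rowK (fun k => Y (enum_val k))) row_sub.
have [yp [hyp ypi yppos]] := irredundant_nn i irr.
apply: leq_trans (rank_leq_row W); apply: mxrankS; apply/row_subP => k.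
set z := row k Ki; have : (z <= Ki)%MS by exact: row_sub.
rewrite sub_capmx => /andP[zK /sub_kermxP z0].
have zi : z 0 i = 0 by rewrite -mul_delta z0 mxE.
have [mu mu0 hmu] := dominate z hyp.2.
have e : z = (z + mu *: yp) + (- mu) *: yp by rewrite scaleNr addrK.
rewrite [z]e; apply: addmx_sub; last by apply: scalemx_sub; exact: inW.
apply: inW; last by rewrite addmx_entry scalemx_entry zi ypi mulr0 addr0.
split; first by rewrite addmx_sub ?scalemx_sub //; exact: hyp.1.
move=> a j; rewrite ord1 addmx_entry scalemx_entry.
case: (eqVneq j i) => [->|ji]; first by rewrite zi ypi mulr0 addr0.
by apply: ltW; apply: hmu; exact: yppos.
Qed.

Lemma rank_coordmx f (M : {set 'I_f}) : (#|M| <= \rank (coordmx R M))%N.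
Proof.
pose W : 'M[R]_(#|M|, f) := \matrix_k delta_mx 0 (enum_val k).
have WW : W *m W^T = 1%:M.
  apply/matrixP => k l; rewrite !mxE (bigD1 (enum_val k)) //= big1 ?addr0; last first.
    by move=> j jk; rewrite !mxE (negbTE jk) mul0r.
  rewrite !mxE !eqxx mul1r /=; congr (_%:R); rewrite (inj_eq enum_val_inj).
  by rewrite eq_sym.
have <- : \rank W = #|M|.
  by apply/eqP; rewrite eqn_leq rank_leq_row -{1}(mxrank1 R #|M|) -WW mxrankM_maxl.
apply: mxrankS; apply/row_subP => k; rewrite rowK sub_coordmx.
apply/fintype.subsetP => j; rewrite inE mxE eqxx /= pnatr_eq0 eqb0 negbK => /eqP ->.
exact: enum_valP.
Qed.

(** [K] meets the coordinate subspace of a minimal support in a line only; the dimension formula for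
    the sum gives the bound. *)
Lemma card_atom f (K : 'M[R]_f) (M : {set 'I_f}) : M \in atoms (vsupps K) ->
  (#|M| + \rank K <= f.+1)%N.
Proof.
move=> hM; have /atomsP[/vsuppsP[y hy sy] _ _] := hM.
have : (\rank (K :&: coordmx R M)%MS <= 1)%N.
  apply: leq_trans (rank_leq_row y); apply: mxrankS; apply/row_subP => k.
  set z := row k _; have : (z <= K :&: coordmx R M)%MS by exact: row_sub.
  rewrite sub_capmx sub_coordmx => /andP[zK sz].
  have [la ->] := atom_ray hM hy sy zK sz.
  exact: scalemx_sub.
have := mxrank_sum_cap K (coordmx R M); have := rank_coordmx M.
have := rank_leq_col (K + coordmx R M)%MS.
by lia.
Qed.

Lemma leq_card_bigcup (I J : finType) (B : {set I}) (S : I -> {set J}) n :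
  (forall b, b \in B -> (#|S b| <= n)%N) -> (#|\bigcup_(b in B) S b|%SET <= #|B| * n)%N.
Proof.
move=> h; rewrite -sum_nat_const; elim/big_rec2: _ => [|b m X hb le]; first by rewrite cards0.
rewrite cardsU; apply: leq_trans (leq_subr _ _) _; apply: leq_add => //; exact: h.
Qed.

(** Adjoins a minimal support through a coordinate whose unit vector is still missing. In
    codimension two a round costs at most three coordinates, and two rounds suffice. *)
Lemma grow_base f (K : 'M[R]_f) (B : {set 'I_f}) : (1 < f)%N -> irredundant K ->
  B \in vsupps K -> (\rank (coordmx R B + K)%MS < f)%N ->
  exists B', [/\ B' \in vsupps K, (#|B'| + \rank K <= #|B| + f.+1)%N &
    (\rank (coordmx R B + K)%MS < \rank (coordmx R B' + K)%MS)%N].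
Proof.
move=> f1 irr hB lt; have [w hw] : exists w, ~~ ((delta_mx 0 w : 'rV[R]_f) <= coordmx R B + K)%MS.
  apply/existsP; rewrite -negb_forall; apply/negP => /forallP h.
  have : (1%:M <= coordmx R B + K)%MS.
    by apply/row_subP => i; rewrite row1.
  by move=> /mxrankS; rewrite mxrank1 leqNgt lt.
have [l lw] : exists l : 'I_f, w != l.
  case: f f1 w {K B irr hB lt hw} => [|[|f]] // _ k.
  by case: (eqVneq k ord0) => [->|k0]; [exists ord_max|exists ord0].
have [y hy yw] := irredundant_pos irr lw.
have [s [es hs]] := atom_decomposition hy.
have [z zs zw] : exists2 z, z \in s & z 0 w != 0.
  apply: contrapT => h; move: yw; rewrite es summxE big_seq big1 ?ltxx // => z zs.
  by apply/eqP/negPn/negP => zw; apply: h; exists z.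
have [hz aM _] := hs z zs.
have wM : w \in supp z by rewrite inE.
exists (B :|: supp z)%SET; split.
- by apply: (vsupps_union_closed K).2 => //; apply/vsuppsP; exists z.
- have := card_atom aM; have := cardsU B (supp z); lia.
have mono (X Y : {set 'I_f}) : X \subset Y -> (coordmx R X <= coordmx R Y)%MS.
  move=> XY; apply/row_subP => j; rewrite sub_coordmx.
  by apply: fintype.subset_trans XY; rewrite -sub_coordmx row_sub.
have sub : (coordmx R B + K <= coordmx R (B :|: supp z)%SET + K)%MS.
  by apply: addsmxS => //; apply: mono; rewrite finset.subsetUl.
rewrite ltn_neqAle mxrankS // andbT; apply/negP => /eqP e; move: hw; apply/negP/negPn.
apply: submx_trans (_ : (coordmx R (B :|: supp z)%SET + K <= _)%MS).
  apply: submx_trans (addsmxSl _ _); rewrite sub_coordmx.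
  apply/fintype.subsetP => j; rewrite inE mxE eqxx /= pnatr_eq0 eqb0 negbK => /eqP ->.
  by rewrite inE wM orbT.
by rewrite -(geq_leqif (mxrank_leqif_sup sub)) e.
Qed.

(* There is a set [B] of at most 6 coordinates with [R^B + K = R^f].  Every other
   essential coordinate [w] lies in a minimal support contained in [w |: B] and
   meeting [B], while each coordinate lies in at most 4 minimal supports. *)
Lemma essential_bound0 f (K : 'M[R]_f) : (1 < f)%N -> irredundant K ->
  (\rank K).+2 = f -> #|atoms (vsupps K)| = f.+1 -> (#|essential K| <= 30)%N.
Proof.
move=> f1 irr rK cat.
have [B hB [cB rB]] : exists2 B, B \in vsupps K & (#|B| <= 6)%N /\ \rank (coordmx R B + K)%MS = f.
  have h0 := (vsupps_union_closed K).1.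
  have rk (X : {set 'I_f}) := rank_leq_col (coordmx R X + K)%MS.
  have r0 : (\rank K <= \rank (coordmx R finset.set0 + K)%MS)%N.
    by apply: mxrankS; exact: addsmxSr.
  have c0 := cards0 'I_f.
  case: (ltnP (\rank (coordmx R finset.set0 + K)%MS) f) => h; last first.
    by exists finset.set0 => //; split; [lia|apply/eqP; rewrite eqn_leq rk].
  have [B1 [hB1 cB1 rB1]] := grow_base f1 irr h0 h.
  case: (ltnP (\rank (coordmx R B1 + K)%MS) f) => h1; last first.
    by exists B1 => //; split; [lia|apply/eqP; rewrite eqn_leq rk].
  have [B2 [hB2 cB2 rB2]] := grow_base f1 irr hB1 h1.
  by exists B2 => //; split; [lia|have := rk B2; lia].
(* Of the [f + 1] minimal supports at least [\rank K - 1 = f - 3] avoid [i]. *)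
have deg i : (#|[set M in atoms (vsupps K) | i \in M]%SET| <= 4)%N.
  have := card_atoms_avoiding i irr.
  have := cardsID [set M : {set 'I_f} | i \in M]%SET (atoms (vsupps K)).
  have -> : (atoms (vsupps K) :&: [set M : {set 'I_f} | i \in M])%SET = [set M in atoms (vsupps K) | i \in M]%SET.
    by apply/setP => M; rewrite !inE.
  have -> : (atoms (vsupps K) :\: [set M : {set 'I_f} | i \in M])%SET = [set M in atoms (vsupps K) | i \notin M]%SET.
    by apply/setP => M; rewrite !inE andbC.
  rewrite cat; move: rK; move: #|_| #|_| (\rank K) => x y r; clear; lia.
have [yB hyB sB] := vsuppsP _ _ hB.
have /choice[g hg] : forall w, exists M : {set 'I_f}, w \in (essential K :\: B)%SET ->
    [/\ M \in atoms (vsupps K), w \in M, M \subset (w |: B)%SET & overlap M B].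
  move=> w; case: (boolP (w \in (essential K :\: B)%SET)) => [|_]; last by exists finset.set0.
  rewrite !inE => /andP[wB wE].
  (* Splitting the unit vector at [w] along [R^B + K] leaves a vector of [K] that agrees with it
     outside [B]; a multiple of [yB] makes it nonnegative on [B], and a minimal vector through [w]
     is extracted. *)
  have : ((delta_mx 0 w : 'rV[R]_f) <= coordmx R B + K)%MS.
    apply: submx_trans (submx1 _) _; rewrite sub1mx /row_full rB //.
  move=> /sub_addsmxP[[D1 D2] /= e].
  pose x := D1 *m coordmx R B; pose k := D2 *m K.
  have xB i : i \notin B -> x 0 i = 0 by move=> iB; rewrite /x mul_coordmx (negbTE iB).
  have kE i : i \notin B -> k 0 i = (i == w)%:R.
    move=> iB; have : (delta_mx 0 w : 'rV[R]_f) 0 i = x 0 i + k 0 i by rewrite e addmx_entry.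
    by rewrite mxE eqxx /= xB // add0r => ->.
  have [mu mu0 hmu] := dominate k hyB.2.
  have yBi i : (0 < yB 0 i) = (i \in B) by rewrite -sB inE lt_neqAle eq_sym hyB.2 andbT.
  have yB0 i : i \notin B -> yB 0 i = 0 by rewrite -sB inE negbK => /eqP.
  pose y := k + mu *: yB.
  have yE i : y 0 i = k 0 i + mu * yB 0 i by rewrite /y addmx_entry scalemx_entry.
  have hy : nnvec K y.
    split; first by rewrite addmx_sub ?scalemx_sub ?submxMl //; exact: hyB.1.
    move=> a i; rewrite ord1; case: (boolP (i \in B)) => iB.
      by rewrite yE; apply: ltW; apply: hmu; rewrite yBi.
    by rewrite yE yB0 // kE // mulr0 addr0 ler0n.
  have yw : y 0 w = 1 by rewrite yE yB0 // kE // eqxx mulr0 addr0.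
  have sy : supp y \subset (w |: B)%SET.
    apply/fintype.subsetP => i; rewrite !inE yE; apply: contraR.
    by rewrite negb_or => /andP[iw iB]; rewrite yB0 // kE // (negbTE iw) mulr0 addr0.
  have [s [es hs]] := atom_decomposition hy.
  have [z zs zw] : exists2 z, z \in s & z 0 w != 0.
    apply: contrapT => h; have /eqP := yw; rewrite es summxE big_seq big1.
      by rewrite eq_sym oner_eq0.
    by move=> z zs; apply/eqP/negPn/negP => zw; apply: h; exists z.
  have [hz aM sM] := hs z zs.
  exists (supp z) => _; have sz := fintype.subset_trans sM sy.
  split=> //; first by rewrite inE.
  apply/overlapP; apply: contrapT => h.
  (* A minimal vector missing [B] would be a multiple of the unit vector at [w], which is not in [K]
     because [w] is essential. *)
  have ez : z = z 0 w *: delta_mx 0 w.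
    apply/rowP => i; rewrite !mxE eqxx /=; case: (eqVneq i w) => [->|iw]; first by rewrite mulr1.
    rewrite mulr0; apply/eqP/negPn/negP => zi; apply: h.
    have iz : i \in supp z by rewrite inE.
    exists i => //; have := fintype.subsetP sz i iz; rewrite !inE (negbTE iw) //.
  move: wE => /negP; apply; have := hz.1; rewrite ez => /(scalemx_sub (z 0 w)^-1).
  by rewrite scalerA mulVf // scale1r.
have card1 : (#|(essential K :\: B)%SET| <= #|B| * 4)%N.
  apply: leq_trans (leq_card_bigcup (fun b _ => deg b)).
  rewrite -(card_in_imset (f := g)).
    apply: fintype.subset_leq_card; apply/fintype.subsetP => _ /imsetP[w hw ->].
    have [h1 h2 h3 /overlapP[b bg bB]] := hg w hw.
    by apply/bigcupP; exists b => //; rewrite inE h1.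
  (* The coordinate [w] is recovered from [g w] as its only element outside [B]. *)
  move=> w w' hw hw' e; have [_ h2 _ _] := hg w hw; have [_ _ h3 _] := hg w' hw'.
  move: h2; rewrite e => /(fintype.subsetP h3); rewrite !inE => /orP[/eqP //|wB].
  by move: hw; rewrite inE wB.
(* At most 6 essential coordinates lie in [B] and at most [6 * 4] outside. *)
have := cardsID B (essential K); have := fintype.subset_leq_card (finset.subsetIr (essential K) B).
lia.
Qed.

End EssentialBound.

From mathcomp Require Import fingroup perm.

(** * Finite codes for pairs of support families *)

Section Colourings.

(* The first component names the essential coordinates injectively and is
   [None] on the others; the second one is the sign of the kernel vector. *)
Definition colour : Type := (option 'I_31 * option bool)%type.

Definition labels f (col : 'I_f -> colour) (Y : {set 'I_f}) : {set 'I_31} :=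
  [set a | [exists i in Y, (col i).1 == Some a]]%SET.

Definition sees f (col : 'I_f -> colour) (b : bool) (C : {set 'I_f}) : bool :=
  [exists i in C, (col i).2 == Some b].

Definition coloured f (Cs Ys : {set {set 'I_f}}) (col : 'I_f -> colour)
    (EE : {set {set 'I_31}}) : Prop :=
  [/\ forall C, (C \in Cs) = (sees col true C == sees col false C),
      forall Y, (Y \in Ys) = (labels col Y \in EE) &
      forall i j, (col i).1 = (col j).1 -> (col i).1 != None -> i = j].

(** The data on named coordinates range over a fixed finite set; only the numbers of unnamed
    coordinates of either sign grow with [f], which is the source of the exponent 2. *)
Definition code f : Type :=
  (({set {set 'I_31}} * {ffun 'I_31 * option bool -> bool}) * ('I_f.+1 * 'I_f.+1))%type.

Definition mkcode f (col : 'I_f -> colour) (EE : {set {set 'I_31}}) : code f :=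
  ((EE, [ffun x => [exists i, col i == (Some x.1, x.2)]]),
   (inord #|[pred i | col i == (None, Some true)]|,
    inord #|[pred i | col i == (None, Some false)]|)).

Lemma colour_count f (Cs Ys : {set {set 'I_f}}) col EE a s :
  coloured Cs Ys col EE ->
  #|[pred i | col i == (Some a, s)]| = [exists i, col i == (Some a, s)].
Proof.
move=> [_ _ inj]; case: (boolP [exists i, _]) => [/existsP[i /eqP ei]|].
  apply: etrans (card1 i); apply: eq_card => j; rewrite !inE.
  apply/eqP/eqP => [ej|->//]; apply: inj; by rewrite ?ej ?ei.
by move=> /existsPn h; apply: eq_card0 => i; rewrite !inE; apply/negbTE.
Qed.

(** Equal codes give equal multiplicities of all colours: a named colour occurs at most once, the
    two signed unnamed ones are counted, and the last one follows from the total [f]. *)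
Lemma perm_colouring f (Cs Ys Cs' Ys' : {set {set 'I_f}}) col col' EE EE' :
  coloured Cs Ys col EE -> coloured Cs' Ys' col' EE' ->
  mkcode col EE = mkcode col' EE' ->
  EE = EE' /\ exists p : 'S_f, forall i, col i = col' (p i).
Proof.
move=> hc hc' [eE /ffunP eF e1 e2]; split=> //.
have inordK' (A B : pred 'I_f) : (inord #|A| : 'I_f.+1) = inord #|B| -> #|A| = #|B|.
  move=> /(congr1 val); rewrite /= !inordK // ltnS -[X in (_ <= X)%N]card_ord; exact: max_card.
have cnt x : x != (None, None) -> #|[pred i | col i == x]| = #|[pred i | col' i == x]|.
  case: x => [[a|] s]; last by case: s => [[|]|] // _; exact: inordK'.
  move=> _; rewrite (colour_count _ _ hc) (colour_count _ _ hc').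
  by have := eF (a, s); rewrite !ffunE => ->.
have tot (c : 'I_f -> colour) : (\sum_x #|[pred i | c i == x]| = f)%N.
  rewrite -[RHS]card_ord -sum1_card (partition_big c xpredT) //=.
  by apply: eq_bigr => x _; rewrite sum1_card; apply: eq_card => i; rewrite !inE.
have cnt' x : #|[pred i | col i == x]| = #|[pred i | col' i == x]|.
  case: (eqVneq x (None, None)) => [->|]; last exact: cnt.
  have := tot col; rewrite -[in RHS](tot col') (bigD1 (None, None)) //= [in RHS](bigD1 (None, None)) //=.
  by rewrite (eq_bigr _ cnt) => /addIn.
have : perm_eq [tuple col i | i < f] [tuple col' i | i < f].
  apply/allP => x _ /=; apply/eqP; rewrite !count_map -!enumT.
  have count_card (c : 'I_f -> colour) : count (preim c (pred1 x)) (enum 'I_f) = #|[pred i | c i == x]|.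
    by rewrite -sum1_count -sum1_card big_enum_cond /=; apply: eq_bigl => i; rewrite !inE.
  by rewrite !count_card.
move=> /tuple_permP[p ep]; exists p => i.
have := congr1 (fun t : f.-tuple colour => tnth t i) (val_inj ep).
by rewrite !tnth_mktuple.
Qed.

Lemma coloured_iso f (Cs Ys Cs' Ys' : {set {set 'I_f}}) col col' EE EE' :
  coloured Cs Ys col EE -> coloured Cs' Ys' col' EE' ->
  mkcode col EE = mkcode col' EE' -> family_iso (fam Cs Ys) (fam Cs' Ys').
Proof.
move=> hc hc' hcode; have [eE [p hp]] := perm_colouring hc hc' hcode.
case: hc hc' => hC hY _ [hC' hY' _]; subst EE'.
have imE (P : colour -> bool) (X : {set 'I_f}) :
    [exists i in p @: X, P (col' i)] = [exists i in X, P (col i)].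
  apply/exists_inP/exists_inP => [[_ /imsetP[i iX ->] h]|[i iX h]].
    by exists i => //; rewrite hp.
  by exists (p i); rewrite ?imset_f // -hp.
have memC (C : {set 'I_f}) : (p @: C \in Cs')%SET = (C \in Cs).
  by rewrite hC hC' /sees (imE (fun x => x.2 == Some true)) (imE (fun x => x.2 == Some false)).
have memY (Y : {set 'I_f}) : (p @: Y \in Ys')%SET = (Y \in Ys).
  rewrite hY hY'; suff -> : labels col' (p @: Y)%SET = labels col Y by [].
  apply/setP => a; rewrite !inE.
  exact: (imE (fun x => x.1 == Some a)).
have injp := @perm_inj _ p.
have preim (X : {set 'I_f}) : exists Z : {set 'I_f}, X = (p @: Z)%SET.
  exists [set (p^-1)%g i | i in X]%SET; apply/setP => i; apply/idP/imsetP => [iX|].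
    by exists ((p^-1)%g i); rewrite ?permKV // imset_f.
  by move=> [j /imsetP[k kX ->] ->]; rewrite permKV.
have clE (C : {set 'I_f}) : cl Ys' (p @: C)%SET = (p @: cl Ys C)%SET.
  apply/setP => i; apply/clP/imsetP => [[Y [hYY dj iY]]|[j /clP[Y [hYY dj jY]] ->]].
    have [Z eZ] := preim Y; subst Y; case/imsetP: iY => j jZ ->; exists j => //.
    apply/clP; exists Z; split=> //; first by rewrite -memY.
    by rewrite imset_disjoint in dj => // x y _ _; exact: injp.
  exists (p @: Y)%SET; split; [by rewrite memY| |exact: imset_f].
  by rewrite imset_disjoint // => x y _ _; exact: injp.
exists (fun X : {set 'I_f} => (p @: X)%SET); split; last first.
  move=> X Y _ _; split=> [|h]; first exact: imsetS.
  apply/fintype.subsetP => i iX; have : p i \in (p @: Y)%SET.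
    by apply: (fintype.subsetP h); exact: imset_f.
  by rewrite mem_imset.
split=> [X /imsetP[C hCC ->]|X Y _ _|X /imsetP[C hCC ->]].
- by rewrite /= -clE; apply: imset_f; rewrite memC.
- by apply: imset_inj.
have [Z eZ] := preim C; exists (cl Ys Z); last by rewrite -clE -eZ.
by apply: imset_f; rewrite -memC -eZ.
Qed.

End Colourings.

(** * Quadratic upper bound *)

Section UpperBound.
Variable R : realType.

Lemma naming (T : finType) (E : {set T}) : (#|E| <= 30)%N ->
  exists e : T -> option 'I_31, (forall x, (e x == None) = (x \notin E)) /\
    {in E &, injective e}.
Proof.
move=> hE; exists (fun x => if x \in E then Some (inord (index x (enum E))) else None).
split=> [x|x y xE yE]; first by case: (x \in E).
have lt z : z \in E -> (index z (enum E) < 31)%N.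
  move=> zE; apply: leq_trans (_ : (index z (enum E) < #|E|)%N) _; last exact: leq_trans hE _.
  by rewrite cardE index_mem mem_enum.
rewrite xE yE => -[/(congr1 val)]; rewrite /= !inordK ?lt // => h.
rewrite -(nth_index x (_ : x \in enum E)) ?mem_enum // h nth_index ?mem_enum //.
Qed.

Definition sign (x : R) : option bool :=
  if 0 < x then Some true else if x < 0 then Some false else None.

(** Whether a set is a support of [K] depends only on its trace on the essential coordinates, and
    whether it is the support of an admissible functional only on the signs of [u]; the colours
    record both. *)
Lemma colouring_exists (P : polytope R) f (K : 'M[R]_f) (Pi : 'M[R]_(f, ambient P + 1)) (u : 'rV[R]_f) :
  (u <= K)%MS -> u *m Pi = 0 ->
  (forall y : 'rV_f, (y <= K)%MS -> y *m Pi = 0 -> exists a, y = a *: u) ->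
  (#|essential K| <= 30)%N ->
  exists col EE, coloured (csupps K Pi) (vsupps K) col EE.
Proof.
move=> uK uPi hu hE; have [e [eN eI]] := naming hE.
pose col i : colour := (e i, sign (u 0 i)).
have labE Y : labels col Y = [set a | [exists i in (Y :&: essential K), e i == Some a]]%SET.
  apply/setP => a; rewrite !inE; apply/exists_inP/exists_inP => -[i iY h]; exists i => //.
    move/eqP: h => /= h; by rewrite finset.in_setI iY -[X in _ && X]negbK -eN h.
  by move: iY; rewrite finset.in_setI => /andP[].
exists col, [set labels col Y | Y in vsupps K]%SET; split.
- move=> C; rewrite (csupps_line uK uPi hu) /balanced /sees; congr (_ == _).
    apply/overlapP/exists_inP => -[i iC h]; exists i => //; move: h; rewrite inE /= /sign.
      by move=> ->.
    by case: ltP => // _; case: ifP.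
  apply/overlapP/exists_inP => -[i iC h]; exists i => //; move: h; rewrite inE /= /sign.
    by move=> h; rewrite h ltNge (ltW h).
  by case: ltP => // _; case: ifP.
- move=> Y; apply/idP/imsetP => [hY|[Z hZ eYZ]]; first by exists Y.
  apply: vsupps_essential hZ; apply/setP => i.
  rewrite !finset.in_setI; case: (boolP (i \in essential K)) => iE; rewrite ?andbF ?andbT //.
  have [a ea] : exists a, e i = Some a.
    by case: (e i) (eN i) => [a _|]; [exists a|rewrite eqxx iE].
  have mem W : (a \in labels col W) = (i \in W).
    rewrite labE inE; apply/exists_inP/idP => [[j]|iW]; last first.
      by exists i; rewrite ?finset.in_setI ?iW ?iE // ea.
    rewrite finset.in_setI => /andP[jW jE] /eqP ej.
    by rewrite (eI i j) // ea ej.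
  by rewrite -!mem eYZ.
move=> i j /= eij ni; have iE : i \in essential K by rewrite -[X in is_true X]negbK -eN.
by apply: eI => //; rewrite -[X in is_true X]negbK -eN -eij.
Qed.

(** When [K] is the whole space the lift is a simplex with [f] vertices, and projecting cannot
    create more. *)
Lemma card_atoms_full q f (K : 'M[R]_f) (Pi : 'M[R]_(f, q)) : \rank K = f ->
  (#|atoms (fam (csupps K Pi) (vsupps K))| <= f)%N.
Proof.
move=> rK; have full (y : 'rV[R]_f) : (y <= K)%MS.
  by apply: submx_trans (submx1 _) _; rewrite sub1mx /row_full rK.
apply: leq_trans (card_atoms_fam (csupps_union_closed _ _) (vsupps_union_closed _)) _.
rewrite -[X in (_ <= X)%N]card_ord -(card_imset _ (@finset.set1_inj 'I_f)).
apply: fintype.subset_leq_card; apply/fintype.subsetP => M /atomsP[_ /finset.set0Pn[i iM] minM].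
apply/imsetP; exists i => //; apply/esym/minM; last by rewrite finset.sub1set.
  apply/vsuppsP; exists (delta_mx 0 i); last first.
    by apply/setP => j; rewrite !inE mxE eqxx /= pnatr_eq0 eqb0 negbK.
  by split=> // a b; rewrite mxE ler0n.
by apply/finset.set0Pn; exists i; rewrite inE.
Qed.

Theorem colouring_of_xc (P : polytope R) d :
  has_dim (body P) d -> (vertices P #= `I_(d + 4))%card -> has_xc P (d + 3) ->
  exists (K : 'M[R]_(d + 3)) (Pi : 'M[R]_(d + 3, ambient P + 1)) col EE,
    presents P K Pi /\ coloured (csupps K Pi) (vsupps K) col EE.
Proof.
move=> hd hn [[Q QP hQ] minf].
have [K [Pi [pres irr sK]]] := facets_presents QP hQ.
move/(presents_dim _ pres sK): hd => rKPi.
have cat := card_vertices_eq pres hn.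
have f1 : (1 < d + 3)%N by lia.
have rk := mxrank_mul_ker K Pi; rewrite rKPi in rk.
have rKf : (\rank K <= d + 3)%N := rank_leq_col K.
exists K, Pi; suff [u [uK uPi hu] hE] : exists2 u : 'rV[R]_(d + 3),
    [/\ (u <= K)%MS, u *m Pi = 0 &
      forall y : 'rV_(d + 3), (y <= K)%MS -> y *m Pi = 0 -> exists a, y = a *: u] &
    (#|essential K| <= 30)%N.
  by have [col [EE h]] := colouring_exists uK uPi hu hE; exists col, EE.
(* The rank of [K] is [d + 1] plus the rank of the kernel, and at most [d + 3]; the codimension is
   0, 1 or 2. *)
have [r2|[r1|r0]] : \rank K = d.+3 \/ \rank K = d.+2 \/ \rank K = d.+1 by lia.
- have := card_atoms_full Pi (etrans r2 (esym (addn3 d))).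
  by rewrite cat; lia.
- have [|||hE [u [uK uPi] hu]] := essential_bound1 f1 pres irr minf; [lia|lia|by rewrite cat addn4 addn3|].
  by exists u => //; apply: leq_trans hE _.
have inj (y : 'rV[R]_(d + 3)) : (y <= K)%MS -> y *m Pi = 0 -> y = 0.
  move=> yK yPi; apply/eqP; rewrite -submx0.
  have : (y <= K :&: kermx Pi)%MS by rewrite sub_capmx yK; apply/sub_kermxP.
  move=> /submx_trans; apply; rewrite submx0 -mxrank_eq0; apply/eqP.
  by move: rk r0; lia.
exists 0.
  split; [exact: sub0mx|by rewrite mul0mx|].
  by move=> y yK /(inj y yK) ->; exists 0; rewrite scaler0.
apply: (essential_bound0 f1 irr); first by rewrite r0; lia.
by rewrite -(fam_full inj) cat; lia.
Qed.

Lemma same_type_sym (P Q : polytope R) :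
  same_combinatorial_type P Q -> same_combinatorial_type Q P.
Proof. by apply: order_iso_sym; exact: (inhabits set0). Qed.

Lemma same_type_trans (P Q S : polytope R) :
  same_combinatorial_type P Q -> same_combinatorial_type Q S ->
  same_combinatorial_type P S.
Proof. exact: order_iso_trans. Qed.

Lemma combinatorial_type_eq (P Q : polytope R) :
  same_combinatorial_type P Q -> combinatorial_type P = combinatorial_type Q.
Proof.
move=> h; apply/seteqP; split=> S; rewrite /combinatorial_type /=.
  exact: same_type_trans (same_type_sym h).
exact: same_type_trans h.
Qed.

Theorem types_upper_bound : exists c : nat, forall d, exists2 n,
  (types_with_xc R d (d + 4) (d + 3) #= `I_n)%card & (n <= c * (d + 4) ^ 2)%N.
Proof.
(* The constant counts the bounded parts of a code; the factor [(d + 4) ^ 2] counts the two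
   multiplicities, each between 0 and [d + 3]. *)
exists #|{: {set {set 'I_31}} * {ffun 'I_31 * option bool -> bool}}| => d.
pose A := types_with_xc R d (d + 4) (d + 3).
have /choice[g hg] : forall C : set (polytope R), exists c : code (d + 3), A C ->
    exists (P : polytope R) (K : 'M[R]_(d + 3)) (Pi : 'M[R]_(d + 3, ambient P + 1)) col EE,
    [/\ C = combinatorial_type P, presents P K Pi,
      coloured (csupps K Pi) (vsupps K) col EE & c = mkcode col EE].
  move=> C; case: (pselect (A C)) => [|nA]; last first.
    by exists (mkcode (fun=> (None, None)) finset.set0).
  move=> [[P0 [hd hn eC]] [P CP hxc]].
  have h0 : same_combinatorial_type P0 P by move: CP; rewrite eC.
  have [hd' hn'] := type_invariants h0 hd hn.
  have [K [Pi [col [EE [pres hcol]]]]] := colouring_of_xc hd' hn' hxc.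
  exists (mkcode col EE) => _; exists P, K, Pi, col, EE; split=> //.
  by rewrite eC; exact: combinatorial_type_eq.
have ginj C C' : A C -> A C' -> g C = g C' -> C = C'.
  move=> /hg[P [K [Pi [col [EE [-> pres hcol ->]]]]]].
  move=> /hg[P' [K' [Pi' [col' [EE' [-> pres' hcol' ->]]]]]] e.
  apply: combinatorial_type_eq; apply/(presentation_iso pres pres').
  exact: coloured_iso e.
have : finite_set A.
  have e : (g @` A #= A)%card by apply: inj_card_eq => C C' /set_mem hC /set_mem hC'; exact: ginj.
  have /finite_setP[n hn] : finite_set (g @` A) by exact: finite_finset.
  by apply/finite_setP; exists n; exact: card_eq_trans (card_esym e) hn.
move=> /finite_setP[n hn]; exists n => //.
have /card_ordP[e [einj eA _]] := hn.
have := @leq_card _ _ (g \o e) _; rewrite card_ord => h; apply: leq_trans (h _) _.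
  by move=> i j /= /ginj h'; apply: einj; apply: h'.
rewrite /code card_prod leq_mul2l; apply/orP; right.
by rewrite card_prod !card_ord -mulnn (addnS d 3).
Qed.

End UpperBound.

(** * Lower bound *)

Section TwoSignVectors.
Variable R : realType.

(** By irredundancy every facet is the complement of a single coordinate, and it misses the vertex
    exactly when that coordinate lies in [M]. *)
Lemma codegree_le f (K : 'M[R]_f) (M : {set 'I_f}) : (1 < f)%N -> irredundant K ->
  M \in atoms (vsupps K) -> (codegree (vsupps K) M <= #|M|)%N.
Proof.
move=> f1 irr hM.
have cT i : (~: [set i])%SET \in vsupps K.
  have [y [hy yi ypos]] := irredundant_nn i irr; apply/vsuppsP; exists y => //.
  apply/setP => j; rewrite !inE; case: (eqVneq j i) => [->|ji]; first by rewrite yi eqxx.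
  by rewrite gt_eqF ?ypos.
have hT : finset.setT \in vsupps K.
  pose i0 := Ordinal (ltnW f1); pose i1 := Ordinal f1.
  have := (vsupps_union_closed K).2 _ _ (cT i0) (cT i1).
  rewrite -finset.setCI (_ : (_ :&: _)%SET = finset.set0) ?finset.setC0 //.
  apply/eqP; rewrite finset.setI_eq0 disjoints1 inE //.
have topE X : istop (vsupps K) X = (X == finset.setT).
  apply/forall_inP/eqP => [h|-> Z _]; last exact: finset.subsetT.
  by apply/eqP; rewrite -finset.subTset; exact: h.
apply: leq_trans (_ : (#|[set (~: [set i])%SET | i in M]%SET| <= _)%N); last exact: leq_imset_card.
apply: fintype.subset_leq_card; apply/fintype.subsetP => X /setIdP[hX nMX].
move: hX; rewrite inE => /and3P[hX nT /forall_inP maxX].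
have [i iX] : exists i, i \notin X.
  apply/existsP; rewrite -negb_forall; apply: contra nT => /forallP h.
  by rewrite topE; apply/eqP/setP => i; rewrite h inE.
have := maxX _ (cT i); rewrite topE -finset.disjoints_subset disjoint_sym disjoints1 iX /=.
have -> : ((~: [set i])%SET == finset.setT) = false.
  by apply/negbTE/eqP => /setP/(_ i); rewrite !inE eqxx.
rewrite orbF => /eqP e; apply/imsetP; exists i; last by rewrite e.
by move: nMX; rewrite -e -finset.disjoints_subset disjoint_sym disjoints1 negbK.
Qed.

(** [Pi0] projects along [u] onto the hyperplane [y_z = 0]. The height is a strictly positive
    functional [h] orthogonal to [u], which exists because both signs occur in [u]. *)
Lemma realize_sign_vectors f (t : 'cV[R]_f) (u : 'rV[R]_f) (z : 'I_f) :
  u *m t = 0 -> u 0 z != 0 -> balanced (fun i => u 0 i) finset.setT ->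
  exists (P : polytope R) (Pi : 'M[R]_(f, ambient P + 1)),
    [/\ presents P (kermx t) Pi, u *m Pi = 0 &
      forall y : 'rV_f, y *m Pi = 0 -> exists a, y = a *: u].
Proof.
move=> ut uz /balancedP[h [nh sh eh]].
have hpos i : 0 < h 0 i.
  have : i \in supp h by rewrite sh inE.
  by rewrite inE lt_neqAle eq_sym nh andbT.
pose Pi0 : 'M[R]_f := 1%:M - (delta_mx z 0 : 'cV_f) *m ((u 0 z)^-1 *: u).
pose Pi : 'M[R]_(f, f + 1) := row_mx Pi0 h^T.
have Pi0E (y : 'rV[R]_f) : y *m Pi0 = y - (y 0 z / u 0 z) *: u.
  rewrite /Pi0 mulmxBr mulmx1 mulmxA; congr (_ - _).
  by rewrite [y *m _]mx11_scalar mul_delta mul_scalar_mx scalerA.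
have [y [_ ny] y0|B [hB pres]] := @polytope_of_presentation R f f (kermx t) Pi.
  rewrite /height mul_mx_row row_mxEr mxE.
  have ge i : true -> 0 <= y 0 i * h^T i 0 by move=> _; rewrite mxE mulr_ge0.
  rewrite lt_neqAle sumr_ge0 // andbT eq_sym psumr_eq0 //.
  apply: contra y0 => /allP h0; apply/eqP/rowP => i; rewrite mxE.
  have := h0 i (mem_index_enum _); rewrite mxE mulf_eq0 (gt_eqF (hpos i)) orbF.
  by move/eqP.
exists (Polytope hB), Pi; split=> //.
  rewrite mul_mx_row Pi0E divff // scale1r subrr -[RHS]row_mx0; congr row_mx.
  rewrite [LHS]mx11_scalar; have -> : (u *m h^T) 0 0 = 0; last by rewrite raddf0.
  by rewrite mxE -[RHS]eh; apply: eq_bigr => i _; rewrite mxE mulrC.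
move=> y; rewrite mul_mx_row -[RHS]row_mx0 => /eq_row_mx[+ _].
by rewrite Pi0E => /eqP; rewrite subr_eq0 => /eqP e; exists (y 0 z / u 0 z).
Qed.

(** * Face lattice for two sign vectors with disjoint supports *)

Section Family.
Variables (f : nat) (Cs Ys : {set {set 'I_f}}) (t u : 'I_f -> R).
Hypothesis hC : forall C, (C \in Cs) = balanced u C.
Hypothesis hY : forall Y, (Y \in Ys) = balanced t Y.
Hypothesis ut : forall i, t i != 0 -> u i = 0.
Hypothesis pt : (1 < #|pos_set t|)%N.
Hypothesis nt : (1 < #|neg_set t|)%N.
Hypothesis pu : (2 < #|pos_set u|)%N.
Hypothesis nu : (2 < #|neg_set u|)%N.

Lemma circuit_card (s : 'I_f -> R) M : M \in circuits s -> (#|M| <= 2)%N.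
Proof.
by case/circuitsP => [[i [j [_ _ ->]]]|[i _ ->]]; rewrite ?cards1 // cards2; case: eqP.
Qed.

Lemma overlapC_big (M A : {set 'I_f}) : (#|M| < #|A|)%N -> overlap (~: M)%SET A.
Proof.
move=> h; apply/negP; rewrite finset.disjoints_subset finset.setCS => /fintype.subset_leq_card.
by rewrite leqNgt h.
Qed.

Lemma Ys_union_closed : union_closed Ys.
Proof.
split=> [|Y Z]; rewrite !hY /balanced /overlap.
  by rewrite !finset.disjoints_subset !finset.sub0set.
by rewrite -!finset.setI_eq0 !finset.setIUl !finset.setU_eq0 !negb_and => /eqP -> /eqP ->.
Qed.

Lemma Cs_union_closed : union_closed Cs.
Proof.
split=> [|Y Z]; rewrite !hC /balanced /overlap.
  by rewrite !finset.disjoints_subset !finset.sub0set.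
by rewrite -!finset.setI_eq0 !finset.setIUl !finset.setU_eq0 !negb_and => /eqP -> /eqP ->.
Qed.

(** No vertex of the lift is lost: a circuit of [t] has at most two elements, so its complement
    meets both sign sets of [u], of size at least three. By counting, there are no other atoms. *)
Lemma atoms_two_signs : atoms (fam Cs Ys) = circuits t.
Proof.
apply/esym/eqP; rewrite finset.eqEcard; apply/andP; split.
  apply/fintype.subsetP => M hM; apply: atoms_fam_mem.
  - exact: Ys_union_closed.
  - by rewrite (circuits_atoms hY).
  have cM := circuit_card hM.
  by rewrite hC /balanced !overlapC_big // (leq_ltn_trans cM).
rewrite -(circuits_atoms hY); apply: card_atoms_fam; first exact: Cs_union_closed.
exact: Ys_union_closed.
Qed.

(** A pair in [circuits u] consists of coordinates where [t] vanishes, and a singleton cannot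
    exhaust a sign of [t]; so both signs of [t] remain in the complement. *)
Lemma circuitC_Ys C : C \in circuits u -> (~: C)%SET \in Ys.
Proof.
rewrite hY /balanced => /circuitsP[[i [j [ui uj ->]]]|[i _ ->]]; last first.
  by rewrite !overlapC_big // cards1.
have ti : t i = 0 by apply/eqP; apply: contraTT ui => /ut ->; rewrite ltxx.
have tj : t j = 0 by apply/eqP; apply: contraTT uj => /ut ->; rewrite ltxx.
apply/eqP; transitivity true; [|apply/esym].
  have /card_gt0P[k kp] := ltnW pt.
  apply/overlapP; exists k => //; move: kp; rewrite !inE => tk.
  by apply/norP; split; apply: contraTneq tk => ->; rewrite ?ti ?tj ltxx.
have /card_gt0P[k kp] := ltnW nt.
apply/overlapP; exists k => //; move: kp; rewrite !inE => tk.
by apply/norP; split; apply: contraTneq tk => ->; rewrite ?ti ?tj ltxx.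
Qed.

Lemma cl_circuit C : C \in circuits u -> cl Ys C = (~: C)%SET.
Proof.
move=> hCC; apply/eqP; rewrite finset.eqEsubset -finset.disjoints_subset cl_disjoint /=.
by apply: sub_cl; [exact: circuitC_Ys|rewrite finset.disjoints_subset].
Qed.

Lemma setT_fam : finset.setT \in fam Cs Ys.
Proof.
apply/imsetP; exists finset.set0; first exact: Cs_union_closed.1.
apply/esym/eqP; rewrite -finset.subTset; apply: sub_cl.
  rewrite hY /balanced /overlap !finset.disjoints_subset !finset.subTset.
  have h (A : {set 'I_f}) : (1 < #|A|)%N -> ((~: A)%SET == finset.setT) = false.
    by move=> /ltnW/card_gt0P[k kA]; apply/eqP => /setP/(_ k); rewrite !inE kA.
  by rewrite !h.
by rewrite disjoint_sym finset.disjoints_subset finset.sub0set.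
Qed.

Lemma istop_fam X : istop (fam Cs Ys) X = (X == finset.setT).
Proof.
apply/forall_inP/eqP => [h|-> Z _]; last exact: finset.subsetT.
by apply/eqP; rewrite -finset.subTset; apply: h; exact: setT_fam.
Qed.

(** Dual to the description of the vertices: functionals of minimal support cut out the largest
    proper faces, so the facets are indexed by the circuits of [u]. *)
Lemma coatoms_two_signs : coatoms (fam Cs Ys) = [set (~: C)%SET | C in circuits u]%SET.
Proof.
have n0 C : C \in circuits u -> C != finset.set0.
  by rewrite -(circuits_atoms hC) => /atomsP[].
have mem C : C \in circuits u -> C \in Cs.
  by rewrite -(circuits_atoms hC) => /atomsP[].
have nT C : C \in circuits u -> ((~: C)%SET == finset.setT) = false.
  move=> /n0; rewrite -finset.setC0 (inj_eq (@finset.setC_inj _)).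
  by move/negbTE.
apply/setP => X; apply/idP/imsetP => [|[C hCC ->]].
  rewrite inE istop_fam => /and3P[/imsetP[C hCC eX] XT /forall_inP maxX].
  have C0 : C != finset.set0.
    apply: contra XT => /eqP e; have := setT_fam; rewrite -istop_fam.
    move=> hT; apply/forall_inP => Z /imsetP[C' _ ->]; rewrite eX e.
    exact: clS (finset.sub0set _).
  have [C1 hC1 sC1] := exists_atom hCC C0; rewrite (circuits_atoms hC) in hC1.
  exists C1 => //; have hX1 : cl Ys C1 \in fam Cs Ys by apply: imset_f; exact: mem.
  have := maxX _ hX1; rewrite istop_fam cl_circuit // nT // orbF => /implyP h.
  apply/esym/eqP; apply: h; rewrite -cl_circuit // eX; exact: clS.
have hX : (~: C)%SET \in fam Cs Ys by rewrite -cl_circuit //; apply: imset_f; exact: mem.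
rewrite inE hX istop_fam nT //=; apply/forall_inP => _ /imsetP[C' hC' ->].
apply/implyP => sub; rewrite istop_fam.
have sC : C' \subset C.
  rewrite -finset.setCS; apply: fintype.subset_trans sub _.
  by rewrite -finset.disjoints_subset cl_disjoint.
case: (eqVneq C' finset.set0) => [e|C'0].
  apply/orP; right; rewrite -istop_fam; apply/forall_inP => Z /imsetP[C2 _ ->].
  by rewrite e; exact: clS (finset.sub0set _).
have /atomsP[_ _ minC] : C \in atoms Cs by rewrite (circuits_atoms hC).
by rewrite (minC C') // cl_circuit // eqxx.
Qed.

Lemma codegree_two_signs M :
  codegree (fam Cs Ys) M = #|[set C in circuits u | overlap M C]%SET|.
Proof.
rewrite /codegree coatoms_two_signs.
rewrite -[RHS](card_imset _ (@finset.setC_inj _)); apply: eq_card => X.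
apply/setIdP/imsetP => [[/imsetP[C hCC ->] nM]|[C /setIdP[hCC oM] ->]].
  by exists C => //; apply/setIdP; rewrite /overlap finset.disjoints_subset.
by split; [exact: imset_f|rewrite -finset.disjoints_subset].
Qed.

Lemma circuits_through_zero z : u z = 0 ->
  [set C in circuits u | z \in C]%SET = [set [set z]]%SET.
Proof.
move=> uz; apply/setP => C; rewrite [RHS]inE; apply/setIdP/eqP => [[]|->]; last first.
  by split; [apply/circuitsP; right; exists z|rewrite inE].
case/circuitsP => [[i [j [ui uj ->]]]|[i ui ->]]; rewrite !inE.
  by move=> /orP[] /eqP e; subst z; exfalso; lra.
by move=> /eqP ->.
Qed.

Lemma codegree_zero z : u z = 0 -> codegree (fam Cs Ys) [set z]%SET = 1%N.
Proof.
move=> uz; rewrite codegree_two_signs -(cards1 [set z]%SET) -(circuits_through_zero uz).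
by apply: eq_card => C; rewrite !inE /overlap disjoints1 negbK.
Qed.

(** The pair lies where [u] vanishes, so only the facets indexed by [[set i]] and [[set j]] avoid
    it. *)
Lemma codegree_pair i j : 0 < t i -> t j < 0 ->
  codegree (fam Cs Ys) [set i; j]%SET = 2%N.
Proof.
move=> ti tj; have ui : u i = 0 by apply: ut; rewrite gt_eqF.
have uj : u j = 0 by apply: ut; rewrite lt_eqF.
have ij : i != j by apply: contraTneq ti => ->; rewrite -leNgt ltW.
rewrite codegree_two_signs; have -> : 2%N = #|[set [set i]; [set j]]%SET|.
  by rewrite cards2 (inj_eq finset.set1_inj) ij.
apply: eq_card => C; apply/setIdP/set2P => [[hCC /overlapP[k]]|].
  rewrite !inE => /orP[] /eqP -> kC; [left|right].
    by apply/set1P; rewrite -(circuits_through_zero ui); apply/setIdP.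
  by apply/set1P; rewrite -(circuits_through_zero uj); apply/setIdP.
case=> ->; split.
- by apply/circuitsP; right; exists i.
- by apply/overlapP; exists i; rewrite !inE eqxx.
- by apply/circuitsP; right; exists j.
- by apply/overlapP; exists j; rewrite !inE eqxx ?orbT.
Qed.

(** The circuits of [u] through a positive coordinate pair it with each negative one. *)
Lemma codegree_pos z : 0 < u z -> codegree (fam Cs Ys) [set z]%SET = #|neg_set u|.
Proof.
move=> uz; rewrite codegree_two_signs -(card_in_imset (f := fun j => [set z; j]%SET)).
  apply: eq_card => C; apply/setIdP/imsetP => [[hCC]|[j]].
    rewrite /overlap disjoints1 negbK; case/circuitsP: hCC => [[i [j [ui uj ->]]]|[i ui ->]].
      rewrite !inE => /orP[] /eqP e; first by exists j; rewrite ?inE // e.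
      by subst z; exfalso; lra.
    by rewrite inE => /eqP e; subst z; exfalso; lra.
  rewrite inE => uj ->; split; first by apply/circuitsP; left; exists z, j.
  by rewrite /overlap disjoints1 negbK !inE eqxx.
move=> i j; rewrite !inE => ui uj /setP/(_ i); rewrite !inE eqxx orbT => /esym/orP[] /eqP // e.
by subst z; exfalso; lra.
Qed.

Lemma codegree_neg z : u z < 0 -> codegree (fam Cs Ys) [set z]%SET = #|pos_set u|.
Proof.
move=> uz; rewrite codegree_two_signs -(card_in_imset (f := fun i => [set i; z]%SET)).
  apply: eq_card => C; apply/setIdP/imsetP => [[hCC]|[j]].
    rewrite /overlap disjoints1 negbK; case/circuitsP: hCC => [[i [j [ui uj ->]]]|[i ui ->]].
      rewrite !inE => /orP[] /eqP e; last by exists i; rewrite ?inE // e.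
      by subst z; exfalso; lra.
    by rewrite inE => /eqP e; subst z; exfalso; lra.
  rewrite inE => uj ->; split; first by apply/circuitsP; left; exists j, z.
  by rewrite /overlap disjoints1 negbK !inE eqxx orbT.
move=> i j; rewrite !inE => ui uj /setP/(_ i); rewrite !inE eqxx => /esym/orP[] /eqP // e.
by subst z; exfalso; lra.
Qed.

Lemma codegree_values M : M \in atoms (fam Cs Ys) ->
  codegree (fam Cs Ys) M \in [:: 1; 2; #|pos_set u|; #|neg_set u|]%N.
Proof.
rewrite atoms_two_signs => /circuitsP[[i [j [ti tj ->]]]|[z _ ->]].
  by rewrite codegree_pair // !inE eqxx orbT.
case: (ltrgtP (u z) 0) => uz.
- by rewrite codegree_neg // !inE eqxx !orbT.
- by rewrite codegree_pos // !inE eqxx !orbT.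
by rewrite codegree_zero // !inE eqxx.
Qed.

Lemma codegree_attained n : n \in [:: #|pos_set u|; #|neg_set u|] ->
  exists2 M, M \in atoms (fam Cs Ys) & codegree (fam Cs Ys) M = n.
Proof.
have single z : u z != 0 -> [set z]%SET \in atoms (fam Cs Ys).
  move=> uz; rewrite atoms_two_signs; apply/circuitsP; right; exists z => //.
  by apply/eqP; apply: contraNT uz => /ut ->.
rewrite !inE => /orP[] /eqP ->.
  have /card_gt0P[z] := leq_ltn_trans (leq0n _) nu; rewrite inE => uz.
  by exists [set z]%SET; [apply: single; rewrite lt_eqF|exact: codegree_neg].
have /card_gt0P[z] := leq_ltn_trans (leq0n _) pu; rewrite inE => uz.
by exists [set z]%SET; [apply: single; rewrite gt_eqF|exact: codegree_pos].
Qed.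

End Family.

End TwoSignVectors.

(** * Quadratic lower bound *)

Section LowerBound.
Variable R : realType.

Lemma card_ord_interval f a b : (a <= b)%N -> (b <= f)%N ->
  #|[set i : 'I_f | (a <= i) && (i < b)]%N%SET| = (b - a)%N.
Proof.
move=> ab bf.
have lt c : (c <= f)%N -> #|[set i : 'I_f | (i < c)%N]%SET| = c.
  move=> cf; rewrite -sum1_card -[RHS]card_ord -sum1_card (big_ord_widen f (fun=> 1%N)) //.
  by apply: eq_bigl => i; rewrite inE.
have := cardsID [set i : 'I_f | (i < a)%N]%SET [set i : 'I_f | (i < b)%N]%SET.
rewrite lt // (_ : (_ :&: _)%SET = [set i : 'I_f | (i < a)%N]%SET); last first.
  by apply/setP => i; rewrite !inE; lia.
rewrite lt ?(leq_trans ab) //.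
rewrite (_ : (_ :\: _)%SET = [set i : 'I_f | (a <= i) && (i < b)]%N%SET); last first.
  by apply/setP => i; rewrite !inE; lia.
by move=> e; rewrite -[b in RHS]e addKn.
Qed.

(** With fewer than [d + 3] facets the lift is a simplex, with too few vertices, or has trivial
    kernel and codimension one. In the latter case minimal supports have at most two elements, so no
    vertex avoids more than two facets. *)
Lemma xc_lower (P : polytope R) d f (K : 'M[R]_f) (Pi : 'M[R]_(f, ambient P + 1)) M :
  presents P K Pi -> has_dim (body P) d -> (vertices P #= `I_(d + 4))%card ->
  M \in atoms (fam (csupps K Pi) (vsupps K)) ->
  (2 < codegree (fam (csupps K Pi) (vsupps K)) M)%N ->
  forall j, extension_sizes P j -> (d + 3 <= j)%N.
Proof.
move=> pres hd hn hM cM j [Q QP hQ]; rewrite leqNgt; apply/negP => hj.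
have [K' [Pi' [pres' irr' sK']]] := facets_presents QP hQ.
move/(presents_dim _ pres' sK'): hd => rKPi.
have cat := card_vertices_eq pres' hn.
have rk := mxrank_mul_ker K' Pi'; rewrite rKPi in rk.
have rKf : (\rank K' <= j)%N := rank_leq_col K'.
have [rK|rK] : \rank K' = j \/ (\rank K' < j)%N by lia.
  by have := card_atoms_full Pi' rK; rewrite cat; lia.
have inj (y : 'rV[R]_j) : (y <= K')%MS -> y *m Pi' = 0 -> y = 0.
  move=> yK yPi; apply/eqP; rewrite -submx0.
  have : (y <= K' :&: kermx Pi')%MS by rewrite sub_capmx yK; apply/sub_kermxP.
  move=> /submx_trans; apply; rewrite submx0 -mxrank_eq0; apply/eqP.
  by move: rk rK hj; lia.
have iso : family_iso (fam (csupps K Pi) (vsupps K)) (fam (csupps K' Pi') (vsupps K')).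
  apply/(presentation_iso pres pres'); exists id; split=> //.
  by split=> [F|F G|F hF] //; exists F.
have [M' hM' eM'] := codegree_iso (set0_fam pres) (set0_fam pres') iso hM.
rewrite fam_full // in hM' eM'.
have j1 : (1 < j)%N by lia.
have := codegree_le j1 irr' hM'; have := card_atom hM'; rewrite eM'.
by lia.
Qed.

Theorem lower_family d k l : (2 < k)%N -> (2 < l)%N -> (k + l + 2 <= d)%N ->
  exists P : polytope R, [/\ has_dim (body P) d, (vertices P #= `I_(d + 4))%card,
    has_xc P (d + 3) & exists (f : nat) (K : 'M[R]_f) (Pi : 'M[R]_(f, ambient P + 1)),
    [/\ presents P K Pi,
      forall M, M \in atoms (fam (csupps K Pi) (vsupps K)) ->
        codegree (fam (csupps K Pi) (vsupps K)) M \in [:: 1; 2; k; l]%N &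
      forall n, n \in [:: k; l] -> exists2 M, M \in atoms (fam (csupps K Pi) (vsupps K)) &
        codegree (fam (csupps K Pi) (vsupps K)) M = n]].
Proof.
move=> hk hl hkl; pose f := (d + 3)%N.
pose t : 'cV[R]_f := \col_i (if (i < 2)%N then 1 else if (i < 5)%N then - 1 else 0).
(* The nonzero entries of [u] start after the five of [t]; they fit because [hkl] amounts to
   [5 + k + l <= d + 3]. *)
pose u : 'rV[R]_f := \row_i (if (i < 5)%N then 0 else if (i < 5 + k)%N then 1
  else if (i < 5 + k + l)%N then - 1 else 0).
have ut i : t i 0 != 0 -> u 0 i = 0.
  rewrite !mxE; case: (ltnP i 5) => // h; rewrite ltnNge (leq_trans _ h) //= eqxx //.
have ut0 : u *m t = 0.
  apply/matrixP => a b; rewrite !ord1 [RHS]mxE mxE big1 // => i _.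
  by case: (eqVneq (t i 0) 0) => [->|/ut ->]; rewrite ?mulr0 ?mul0r.
have lt10 : (0 : R) < -1 = false by rewrite ltr0N1.
have eN1 : ((-1 : R) < 0) by rewrite ltrN10.
have c1 : #|pos_set (fun i => t i 0)| = 2%N.
  rewrite -[RHS](subn0 2) -(card_ord_interval (f := f)) //; last by rewrite /f; lia.
  apply: eq_card => i; rewrite !inE mxE; case: (ltnP i 2) => _; first by rewrite ltr01.
  by case: ifP => _; rewrite ?ltxx ?lt10.
have c2 : #|neg_set (fun i => t i 0)| = 3%N.
  rewrite -[RHS]/(5 - 2)%N -(card_ord_interval (f := f)) //; last by rewrite /f; lia.
  apply: eq_card => i; rewrite !inE mxE; case: (ltnP i 2) => h; first by rewrite ltr10.
  by case: (ltnP i 5) => _; rewrite ?ltxx ?eN1.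
have c3 : #|pos_set (fun i => u 0 i)| = k.
  rewrite -[RHS](addKn 5) -(card_ord_interval (f := f)); [|by lia|by rewrite /f; lia].
  apply: eq_card => i; rewrite !inE mxE; case: (ltnP i 5) => h5; first by rewrite ltxx.
  by case: (ltnP i (5 + k)) => hk'; [rewrite ltr01|case: ifP => _; rewrite ?ltxx ?lt10].
have c4 : #|neg_set (fun i => u 0 i)| = l.
  rewrite -[RHS](addKn (5 + k)) -(card_ord_interval (f := f)); [|by lia|by rewrite /f; lia].
  apply: eq_card => i; rewrite !inE mxE; case: (ltnP i 5) => h5.
    by rewrite ltxx; apply/esym/negbTE; rewrite negb_and; lia.
  case: (ltnP i (5 + k)) => hk'; first by rewrite ltr10.
  by case: (ltnP i (5 + k + l)) => _; rewrite ?ltxx ?eN1.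
have full (s : 'I_f -> R) : (0 < #|pos_set s|)%N -> (0 < #|neg_set s|)%N ->
    balanced s finset.setT.
  move=> /card_gt0P[i hi] /card_gt0P[j hj]; apply/eqP; transitivity true; [|apply/esym].
    by apply/overlapP; exists i; rewrite // finset.in_setT.
  by apply/overlapP; exists j; rewrite // finset.in_setT.
have /card_gt0P[z] : (0 < #|pos_set (fun i => u 0%R i)|)%N by rewrite c3; lia.
rewrite inE => uz.
have uz0 : u 0 z != 0 by rewrite gt_eqF.
have [|P [Pi [pres uPi hu]]] := realize_sign_vectors ut0 uz0.
  by apply: full; rewrite ?c3 ?c4; lia.
have KE (y : 'rV[R]_f) : (y <= kermx t)%MS = (y *m t == 0) by rewrite sub_kermx.
have uK : (u <= kermx t)%MS by rewrite KE ut0.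
have hC := csupps_line uK uPi (fun y _ => hu y).
have hY := vsupps_hyperplane KE.
have t0 : t != 0.
  have /card_gt0P[i] : (0 < #|pos_set (fun i => t i 0%R)|)%N by rewrite c1.
  by rewrite inE; apply: contraTneq => ->; rewrite mxE ltxx.
(* The hyperplane contains a strictly positive vector, a large multiple of which makes any other
   vector of the hyperplane nonnegative. *)
have sK : nn_spanned (kermx t).
  have /balancedP[y [ny sy ey]] : balanced (fun i => t i 0) finset.setT.
    by apply: full; rewrite ?c1 ?c2.
  have hy : nnvec (kermx t) y by split=> //; rewrite KE sum_dot ey.
  move=> c hc; apply/row_matrixP => i; rewrite row_mul row0.
  have [mu mu0 hmu] := dominate (row i (kermx t)) ny.
  have : nnvec (kermx t) (row i (kermx t) + mu *: y).
    split; first by rewrite addmx_sub ?scalemx_sub ?row_sub //; exact: hy.1.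
    move=> a j; rewrite ord1 addmx_entry scalemx_entry; apply/ltW/hmu.
    have : j \in supp y by rewrite sy inE.
    by rewrite inE lt_neqAle eq_sym ny andbT.
  by move=> /hc; rewrite mulmxDl -scalemxAl (hc y hy) scaler0 addr0.
have hd : has_dim (body P) d.
  apply/(presents_dim _ pres sK).
  have := mxrank_mul_ker (kermx t) Pi; rewrite mxrank_ker.
  have -> : \rank t = 1%N by apply/eqP; rewrite eqn_leq rank_leq_col lt0n mxrank_eq0.
  have -> : \rank (kermx t :&: kermx Pi)%MS = 1%N.
    apply/eqP; rewrite eqn_leq; apply/andP; split.
      apply: leq_trans (rank_leq_row u); apply: mxrankS; apply/row_subP => i.
      have : (row i (kermx t :&: kermx Pi)%MS <= kermx t :&: kermx Pi)%MS by exact: row_sub.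
      by rewrite sub_capmx => /andP[_ /sub_kermxP/hu[a ->]]; exact: scalemx_sub.
    have : (u <= kermx t :&: kermx Pi)%MS by rewrite sub_capmx uK; apply/sub_kermxP.
    move=> /mxrankS; apply: leq_trans; rewrite rank_rV.
    by case: eqP => // u00; move: uz; rewrite u00 mxE ltxx.
  by move: (\rank (kermx t *m Pi)) => r; rewrite /f; lia.
have [pt nt] : (1 < #|pos_set (fun i => t i 0%R)|)%N /\ (1 < #|neg_set (fun i => t i 0%R)|)%N.
  by rewrite c1 c2.
have [pu nu] : (2 < #|pos_set (fun i => u 0%R i)|)%N /\ (2 < #|neg_set (fun i => u 0%R i)|)%N.
  by rewrite c3 c4.
have hn : (vertices P #= `I_(d + 4))%card.
  have := card_vertices pres; rewrite (atoms_two_signs hC hY pu nu) card_circuits.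
  have := card_pos_neg_zero (fun i => t i 0); rewrite c1 c2 /f => e.
  (* Six pairs of opposite signs, and the [d - 2] coordinates where [t] vanishes. *)
  have -> : (2 * 3 + #|zero_set (fun i => t i 0%R)| = d + 4)%N.
    by move: e; move: #|zero_set _| => w; lia.
  by [].
have att := codegree_attained hC hY ut pt nt pu nu; rewrite c3 c4 in att.
have vals := codegree_values hC hY ut pt nt pu nu; rewrite c3 c4 in vals.
exists P; split=> //; last by exists f, (kermx t), Pi.
have [M hM cM] := att k (mem_head _ _).
have low : forall j, extension_sizes P j -> (d + 3 <= j)%N.
  by apply: (xc_lower pres hd hn hM); rewrite cM.
split=> //; have [j hj ej] := presents_extension pres.
suff -> : (d + 3)%N = j by [].
apply/eqP; rewrite eqn_leq low //= (leq_trans hj) //.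
by rewrite -[X in (_ <= X)%N]card_ord; exact: max_card.
Qed.

(** The parameters are [k = a + 3], between 3 and [D], and [l = b + D + 1], between [D + 1] and
    [2 * D]. The ranges are disjoint and avoid 1 and 2, so the set of codegrees determines [(a, b)];
    the hypothesis on [d] ensures [k + l + 2 <= d]. *)
Theorem types_lower_bound d D n : (3 * D + 2 <= d)%N ->
  (types_with_xc R d (d + 4) (d + 3) #= `I_n)%card -> ((D - 2) * D <= n)%N.
Proof.
move=> hD /card_ordP[e [einj eA esurj]].
have /choice[g hg] : forall x : 'I_(D - 2) * 'I_D, exists P : polytope R,
    [/\ has_dim (body P) d, (vertices P #= `I_(d + 4))%card, has_xc P (d + 3) &
    exists (f : nat) (K : 'M[R]_f) (Pi : 'M[R]_(f, ambient P + 1)),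
    [/\ presents P K Pi,
      forall M, M \in atoms (fam (csupps K Pi) (vsupps K)) ->
        codegree (fam (csupps K Pi) (vsupps K)) M \in [:: 1; 2; x.1 + 3; x.2 + D + 1]%N &
      forall n, n \in [:: x.1 + 3; x.2 + D + 1]%N ->
        exists2 M, M \in atoms (fam (csupps K Pi) (vsupps K)) &
        codegree (fam (csupps K Pi) (vsupps K)) M = n]].
  move=> [a b]; apply: lower_family; have := ltn_ord a; have := ltn_ord b => /=; lia.
have /choice[idx hidx] : forall x, exists i, e i = combinatorial_type (g x).
  move=> x; apply: esurj; have [hd hn hxc _] := hg x; split; first by exists (g x).
  exists (g x) => //; exists id; split=> //.
  by split=> [F|F G|F hF] //; exists F.
have same x y : idx x = idx y -> same_combinatorial_type (g x) (g y).
  move=> exy; have : combinatorial_type (g x) (g y); last by [].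
  rewrite -hidx exy hidx; exists id; split=> //.
  by split=> [F|F G|F hF] //; exists F.
have sub x y : same_combinatorial_type (g x) (g y) ->
    forall m, m \in [:: x.1 + 3; x.2 + D + 1]%N -> m \in [:: 1; 2; y.1 + 3; y.2 + D + 1]%N.
  have [_ _ _ [f [K [Pi [pres _ att]]]]] := hg x.
  have [_ _ _ [f' [K' [Pi' [pres' vals _]]]]] := hg y.
  move=> /(presentation_iso pres pres') iso m /att[M hM <-].
  have [M' hM' <-] := codegree_iso (set0_fam pres) (set0_fam pres') iso hM.
  exact: vals.
have inj : injective idx.
  move=> [a b] [a' b'] /same/sub /= h.
  have := h (a + 3)%N; have := h (b + D + 1)%N; rewrite !inE !eqxx orbT => /(_ isT) h1 /(_ isT) h2.
  have := ltn_ord a; have := ltn_ord a'; have := ltn_ord b; have := ltn_ord b'.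
  by move=> l1 l2 l3 l4; congr (_, _); apply: ord_inj; move: h1 h2; lia.
by have := leq_card _ inj; rewrite card_prod !card_ord.
Qed.

End LowerBound.

Local Open Scope classical_set_scope.
Local Open Scope card_scope.
Local Open Scope ring_scope.

Theorem corollary16 (R : realType) :
  exists N : nat -> nat,
    (forall d : nat, types_with_xc R d (d + 4) (d + 3) #= `I_(N d)) /\
    (fun d : nat => (N d)%:R : R^o) \is
      'Theta_\oo (fun d : nat => d%:R ^+ 2 : R^o).
Proof.
have [c hc] := types_upper_bound R.
have /choice[N hN] : forall d, exists n,
    (types_with_xc R d (d + 4) (d + 3) #= `I_n) /\ (n <= c * (d + 4) ^ 2)%N.
  by move=> d; have [n h1 h2] := hc d; exists n.
exists N; split=> [d|]; first exact: (hN d).1.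
(* With [D] the quotient of [d - 2] by 3, [16] comes from [d <= 4 * (D - 2)] and [d <= 4 * D], and
   [4 * c] from [d + 4 <= 2 * d]; the [+ 1] keeps the constant positive. *)
apply/asboolP; exists (16^-1, (4 * c + 1)%:R); first by rewrite /= invr_gt0 !ltr0n addn1.
(* [d >= 40] gives [D >= 12], which is what [3 * D + 4 <= 4 * (D - 2)] requires. *)
near=> d; have d40 : (40 <= d)%N by near: d; exact: nbhs_infty_ge.
rewrite /= !ger0_norm ?ler0n ?sqr_ge0 // -natrX; split.
  rewrite mulrC ler_pdivrMr // -natrM ler_nat.
  have hD : (3 * ((d - 2) %/ 3) + 2 <= d)%N by have := leq_trunc_div (d - 2) 3; lia.
  have := types_lower_bound hD (hN d).1; have := divn_eq (d - 2) 3.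
  have := ltn_pmod (d - 2) (isT : (0 < 3)%N).
  move: ((d - 2) %/ 3)%N ((d - 2) %% 3)%N => D r hr eD.
  have h1 : (d <= 4 * (D - 2))%N by lia.
  have h2 : (d <= 4 * D)%N by lia.
  have := leq_mul h1 h2; rewrite mulnn; lia.
rewrite -natrM ler_nat; apply: leq_trans (hN d).2 _.
have h1 : (d + 4 <= 2 * d)%N by lia.
have := leq_mul h1 h1; rewrite !mulnn expnMn => h2.
apply: leq_trans (leq_mul (leqnn c) h2) _.
by rewrite mulnA leq_mul2r; apply/orP; right; lia.
Unshelve. all: by end_near.
Qed.
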